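(* Let $1\le p<\infty$. Then a composition operator $C_\psi$ in $C(\mathcal{F}_\varphi^p,\mathcal{F}_\varphi^p)$ is essentially isolated if and only if it is isolated.
   Context: Weight: $\varphi:[0,\infty)\to[0,\infty)$ is a twice continuously differentiable function, extended to $\mathbb{C}$ by $\varphi(z)=\varphi(|z|)$, with Laplacian $\Delta\varphi>0$. It is assumed that there is a positive radial differentiable function $\tau$ on $\mathbb{C}$ with $\tau(z)\simeq(\Delta\varphi(z))^{-1/2}$ for $|z|\ge 1$ and $\tau(z)\simeq 1$ for $0\le|z|<1$, satisfying $\lim_{r\to\infty}\tau(r)=0$ and $\lim_{r\to\infty}\tau'(r)=0$, and such that either there exists a constant $C>0$ for which $\tau(r)r^C$ increases for large $r$, or $\lim_{r\to\infty}\tau'(r)\log\frac{1}{\tau(r)}=0$. Here $U\simeq V$ means that $U\le cV$ and $V\le cU$ on the set in question for some constant $c>0$. Spaces: $\mathcal{F}_\varphi^p$ is the space of entire functions $f$ with $\|f\|_p^p=\int_{\mathbb{C}}|f(z)|^pe^{-p\varphi(z)}\,dA(z)<\infty$, where $dA$ is Lebesgue area measure on $\mathbb{C}$. Operators: for a holomorphic map $\psi$ on $\mathbb{C}$, $C_\psi f=f\circ\psi$. $C(\mathcal{F}_\varphi^p,\mathcal{F}_\varphi^p)$ is the set of all bounded composition operators on $\mathcal{F}_\varphi^p$. The essential norm of a bounded operator $T$ is $\|T\|_e=\inf\{\|T-K\|:K\text{ compact on }\mathcal{F}_\varphi^p\}$. $C_\psi$ is isolated if it is an isolated point of $C(\mathcal{F}_\varphi^p,\mathcal{F}_\varphi^p)$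 in the operator norm topology, i.e. there is $c>0$ with $\|C_\psi-C_{\psi_1}\|\ge c$ for all $C_{\psi_1}\in C(\mathcal{F}_\varphi^p,\mathcal{F}_\varphi^p)$ with $\psi_1\ne\psi$; it is essentially isolated if it is an isolated point in the topology induced by the essential norm, i.e. there is $c>0$ with $\|C_\psi-C_{\psi_1}\|_e\ge c$ for all such $\psi_1$. *)

(* Defs.v *)
From HB Require Import structures.
From mathcomp Require Import all_boot all_order all_algebra.
From mathcomp Require Import all_classical all_reals all_analysis.
From mathcomp Require Import complex.

Set Implicit Arguments.
Unset Strict Implicit.
Unset Printing Implicit Defensive.
Import Order.TTheory GRing.Theory Num.Theory.
Import numFieldNormedType.Exports.
Import ComplexField.

Local Open Scope classical_set_scope.
Local Open Scope ring_scope.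
Local Open Scope complex_scope.

Section Weights.
Context {R : realType}.
Implicit Types (phi : R -> R) (tau u v : R[i] -> R) (z : R[i]).

(* The derivative is taken relative to [0, +oo[, so it is one-sided at 0 and
   does not depend on the values of f at negative reals. *)
Definition has_deriv_ge0 (f : R -> R) (r l : R) : Prop :=
  (fun s => (f s - f r) / (s - r)) @ within [set s | 0 <= s] r^' --> l.

Definition C2_ge0 (f : R -> R) : Prop :=
  exists f1 f2 : R -> R,
    [/\ forall r : R, 0 <= r -> has_deriv_ge0 f r (f1 r),
        forall r : R, 0 <= r -> has_deriv_ge0 f1 r (f2 r) &
        {within [set r | 0 <= r], continuous f2}].

Definition radial_ext phi : R[i] -> R := fun z => phi (Normc.normc z).

Definition laplacian u : R[i] -> R := fun z =>
  derive1n 2 (fun x : R => u (x +i* complex.Im z)) (complex.Re z) +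
  derive1n 2 (fun y : R => u (complex.Re z +i* y)) (complex.Im z).

Definition comparable_on (A : set R[i]) u v : Prop :=
  exists2 c : R, 0 < c & forall z, A z -> u z <= c * v z /\ v z <= c * u z.

Definition radial tau : Prop := forall z, tau z = tau (Normc.normc z)%:C.

Definition real_differentiable tau : Prop :=
  forall w0 : R * R, differentiable (fun w : R * R => tau (w.1 +i* w.2)) w0.

Definition profile tau : R -> R := fun r => tau r%:C.

(* The Laplacian of the radial extension of phi is required to be positive off
   the origin only: at 0 it may fail to exist (phi r = r + r ^+ 2) or may vanish
   (phi r = r ^+ 3). Off the origin it exists because phi is C^2. *)
Definition admissible_weight phi : Prop :=
  [/\ forall r : R, 0 <= r -> 0 <= phi r,
      C2_ge0 phi,
      forall z, z != 0 -> 0 < laplacian (radial_ext phi) z &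
      exists tau : R[i] -> R,
        [/\ [/\ forall z, 0 < tau z, radial tau & real_differentiable tau],
            comparable_on [set z | 1 <= Normc.normc z] tau
              (fun z => laplacian (radial_ext phi) z `^ (- 2^-1)),
            comparable_on [set z | Normc.normc z < 1] tau (fun=> 1),
            profile tau r @[r --> +oo] --> (0 : R) /\
            derive1 (profile tau) r @[r --> +oo] --> (0 : R) &
            (exists2 c : R, 0 < c & exists r0 : R,
                {in `[r0, +oo[ &, {homo (fun r => profile tau r * r `^ c) :
                  r s / r < s}}) \/
            derive1 (profile tau) r * ln (profile tau r)^-1
              @[r --> +oo] --> (0 : R)]].

End Weights.

Section FockSpaces.
Context {R : realType}.
Variables (phi : R -> R) (p : R).
Implicit Types (f g psi : R[i] -> R[i]).
Implicit Types (T K : (R[i] -> R[i]) -> (R[i] -> R[i])).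

(* R[i]^o is normed over R[i], so this is complex differentiability. *)
Definition entire f : Prop :=
  forall z : R[i], derivable (f : R[i]^o -> R[i]^o) z 1.

Definition area_integral (h : R[i] -> \bar R) : \bar R :=
  (\int[@lebesgue_measure R \x @lebesgue_measure R]_w h (w.1 +i* w.2))%E.

Definition fock_integral f : \bar R :=
  area_integral (fun z =>
    (Normc.normc (f z) `^ p * expR (- (p * radial_ext phi z)))%:E).

Definition fock_norm f : \bar R := (fock_integral f `^ p^-1)%E.

Definition fock_space : set (R[i] -> R[i]) :=
  [set f | entire f /\ (fock_integral f < +oo)%E].

(* An operator on the Fock space is encoded as a map on all functions; only its
   values on the space are used. *)
Definition linear_operator T : Prop :=
  (forall f, fock_space f -> fock_space (T f)) /\
  (forall (a : R[i]) f g, fock_space f -> fock_space g ->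
     T (fun z => a * f z + g z) = fun z => a * T f z + T g z).

Definition bounded_operator T : Prop :=
  linear_operator T /\
  exists M : R, forall f, fock_space f ->
    (fock_norm (T f) <= M%:E * fock_norm f)%E.

Definition compact_operator K : Prop :=
  linear_operator K /\
  forall f_ : nat -> R[i] -> R[i],
    (forall n, fock_space (f_ n)) ->
    (exists M : R, forall n, (fock_norm (f_ n) <= M%:E)%E) ->
    exists2 s : nat -> nat, increasing_seq s &
      exists2 g, fock_space g &
        fock_norm (K (f_ (s n)) \- g) @[n --> \oo] --> 0%E.

Definition op_norm T : \bar R :=
  ereal_sup [set fock_norm (T f) | f in
    [set f | fock_space f /\ (fock_norm f <= 1)%E]].

Definition op_sub T K : (R[i] -> R[i]) -> (R[i] -> R[i]) :=
  fun f => T f \- K f.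

Definition ess_norm T : \bar R :=
  ereal_inf [set op_norm (op_sub T K) | K in compact_operator].

Definition composition_operator psi : (R[i] -> R[i]) -> (R[i] -> R[i]) :=
  fun f => f \o psi.

Definition bounded_composition psi : Prop :=
  entire psi /\ bounded_operator (composition_operator psi).

Definition isolated_for (N : ((R[i] -> R[i]) -> (R[i] -> R[i])) -> \bar R)
    psi : Prop :=
  exists2 c : R, 0 < c & forall psi1, bounded_composition psi1 -> psi1 <> psi ->
    (c%:E <= N (op_sub (composition_operator psi)
                       (composition_operator psi1)))%E.

Definition isolated_composition psi : Prop := isolated_for op_norm psi.

Definition essentially_isolated_composition psi : Prop := isolated_for ess_norm psi.

End FockSpaces.

(* Main.v *)
(* Call [N r = r phi'(r)]. Since tau tends to 0, the Laplacian of the weight is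
   eventually at least 1; hence [phi] is increasing, convex in [ln r], and
   [phi'(r) >= r / 4] for large [r]. Cauchy's formula on squares, averaged over
   the squares, bounds |f(z)| by C exp(phi(|z| + 2e)) on the unit ball. Testing
   this on the monomials z^n with n close to [N |psi z|] shows that a bounded
   [C_psi] satisfies |psi z| <= |z| + 3e for large z and every e > 0, so by
   Liouville psi(z) = a z + b with |a| <= 1, and b = 0 if |a| = 1.

   If |a| < 1, the operators of [psi + t] converge to [C_psi] in norm as t
   tends to 0, so [C_psi] is not isolated. If |a| = 1 then [C_psi] is even
   essentially isolated: for every other bounded [C_psi1], the images [D_n] of
   the normalized monomials under [C_psi - C_psi1] tend to 0 pointwise while
   their norms do not, and such a sequence stays at a positive distance from
   every norm convergent one, in particular from the images under a compact
   operator along a subsequence.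
   This works for p = 1 as well, where the normalized monomials need not be
   weakly null. *)

(* The Fock integral gives no bound for f along a prescribed line, but in every strip some parallel
   line carries at most a fixed multiple of its average. This is why Cauchy's formula is used on
   rectangles whose sides may be moved. Contour integrals are kept as real parts; moduli are
   recovered by multiplying f by the constants 1 and -i. Degree about N s is the right choice
   because r^n exp(- phi r) peaks where N r = n. Point evaluation costs a shift 2e of the radius;
   integrability and the rounding of the degree cost five powers of s = |psi z|. Over a further step
   e the weight gains at least a multiple of e |z|, which outgrows the logarithm of these powers:
   hence the bound |z| + 3e. Sums in the Fock space are estimated by |x + y|^p <= 2^p (|x|^p +
   |y|^p). The resulting constants are far from sharp, but isolation asks only for a positive
   constant that does not depend on psi1. *)
Require Import Defs.
From mathcomp Require Import all_boot all_order all_algebra.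
From mathcomp Require Import all_classical all_reals all_analysis.
From mathcomp Require Import complex.
From mathcomp Require Import measurable_realfun ring lra.

Set Implicit Arguments.
Unset Strict Implicit.
Unset Printing Implicit Defensive.
Import Order.TTheory GRing.Theory Num.Theory.
Import numFieldNormedType.Exports.
Import ComplexField.

Local Open Scope classical_set_scope.
Local Open Scope ring_scope.
Local Open Scope complex_scope.

(** * Complex numbers and Cauchy's formula on rectangles *)

Section ComplexModulus.
Context {R : realType}.
Implicit Types (z w : R[i]) (x y : R).
Local Notation normc := (@Normc.normc R).
Local Notation Re := (@complex.Re R).
Local Notation Im := (@complex.Im R).

Lemma normc_sqrt z : normc z = Num.sqrt (Re z ^+ 2 + Im z ^+ 2).
Proof. by case: z. Qed.

Lemma normr_normc z : `|z| = (normc z)%:C.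
Proof. by rewrite normc_def normc_sqrt. Qed.

Lemma normc_ge0 z : 0 <= normc z.
Proof. by rewrite normc_sqrt sqrtr_ge0. Qed.

Lemma normRe_le z : `|Re z| <= normc z.
Proof. by rewrite normc_sqrt -sqrtr_sqr ler_wsqrtr// lerDl sqr_ge0. Qed.

Lemma normIm_le z : `|Im z| <= normc z.
Proof. by rewrite normc_sqrt -sqrtr_sqr ler_wsqrtr// lerDr sqr_ge0. Qed.

Lemma normc_le_ReIm z : normc z <= `|Re z| + `|Im z|.
Proof.
rewrite normc_sqrt -[leRHS]ger0_norm ?addr_ge0// -sqrtr_sqr ler_wsqrtr//.
rewrite sqrrD !real_normK ?num_real// -addrA lerD2l lerDr.
by rewrite mulrn_wge0// mulr_ge0.
Qed.

Lemma normc_sqr z : normc z ^+ 2 = Re z ^+ 2 + Im z ^+ 2.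
Proof. by rewrite normc_sqrt sqr_sqrtr// addr_ge0// sqr_ge0. Qed.

Lemma normcB_ge z w : normc z - normc w <= normc (z - w).
Proof. by rewrite lerBlDr -[X in X <= _](congr1 normc (subrK w z)) le_normcD. Qed.

Lemma normc_lipschitz z w : `|normc z - normc w| <= normc (z - w).
Proof.
have := normcB_ge z w; have := normcB_ge w z.
have -> : normc (w - z) = normc (z - w) by rewrite -opprB normcN.
by move=> h1 h2; rewrite ler_norml h2 andbT; lra.
Qed.

Lemma normcBC z w : normc (z - w) = normc (w - z).
Proof. by rewrite -opprB normcN. Qed.

Lemma normc_real x : normc x%:C = `|x|.
Proof. by rewrite normc_sqrt/= expr0n/= addr0 sqrtr_sqr. Qed.

Lemma normcX z n : normc (z ^+ n) = normc z ^+ n.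
Proof.
elim: n => [|n IH]; first by rewrite !expr0 Normc.normc1.
by rewrite !exprS Normc.normcM IH.
Qed.

Lemma normc_eq0 z : (normc z == 0) = (z == 0).
Proof.
by apply/eqP/eqP => [/Normc.eq0_normc//|->]; rewrite Normc.normc0.
Qed.

Lemma normc_gt0 z : (0 < normc z) = (z != 0).
Proof. by rewrite lt_def normc_ge0 andbT normc_eq0. Qed.

Lemma complexReIm z : z = Re z +i* Im z. Proof. by case: z. Qed.

Lemma cReD z w : Re (z + w) = Re z + Re w. Proof. by case: z; case: w. Qed.
Lemma cImD z w : Im (z + w) = Im z + Im w. Proof. by case: z; case: w. Qed.
Lemma cReN z : Re (- z) = - Re z. Proof. by case: z. Qed.
Lemma cImN z : Im (- z) = - Im z. Proof. by case: z. Qed.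
Lemma cReB z w : Re (z - w) = Re z - Re w. Proof. by case: z; case: w. Qed.
Lemma cImB z w : Im (z - w) = Im z - Im w. Proof. by case: z; case: w. Qed.
Lemma cReM z w : Re (z * w) = Re z * Re w - Im z * Im w.
Proof. by case: z; case: w. Qed.
Lemma cImM z w : Im (z * w) = Re z * Im w + Im z * Re w.
Proof. by case: z => a b; case: w => c d. Qed.

End ComplexModulus.

(** * Bisection for additive functions of rectangles *)

Section Bisection.
Context {R : realType}.

(* Goursat's bisection: keep the quarter that carries at least a quarter of |J|. *)
Lemma additive_rect_eq0 (J : R -> R -> R -> R -> R) (a b c d : R) :
  a <= b -> c <= d ->
  (forall a' m b' c' d', a <= a' -> a' <= m -> m <= b' -> b' <= b ->
    c <= c' -> c' <= d' -> d' <= d -> J a' b' c' d' = J a' m c' d' + J m b' c' d') ->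
  (forall a' b' c' m d', a <= a' -> a' <= b' -> b' <= b ->
    c <= c' -> c' <= m -> m <= d' -> d' <= d -> J a' b' c' d' = J a' b' c' m + J a' b' m d') ->
  (forall x y, a <= x <= b -> c <= y <= d -> forall e, 0 < e ->
    exists2 r : R, 0 < r & forall a' b' c' d', a <= a' -> a' <= x <= b' -> b' <= b ->
      c <= c' -> c' <= y <= d' -> d' <= d -> b' - a' < r -> d' - c' < r ->
      `|J a' b' c' d'| <= e * ((b' - a') + (d' - c')) ^+ 2) ->
  J a b c d = 0.
Proof.
move=> ab cd JH JV Jsmall; apply/eqP; apply/negPn/negP => Jneq0.
have J0 : 0 < `|J a b c d| by rewrite normr_gt0.
pose jq (q : (R * R) * (R * R)) := `|J q.1.1 q.1.2 q.2.1 q.2.2|.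
pose ok (q : (R * R) * (R * R)) := [/\ a <= q.1.1, q.1.1 <= q.1.2 & q.1.2 <= b] /\
  [/\ c <= q.2.1, q.2.1 <= q.2.2 & q.2.2 <= d].
pose half (i k : R * R) := [/\ i.1 <= k.1, k.2 <= i.2 & k.2 - k.1 = (i.2 - i.1) / 2].
have step q : exists q', ok q -> [/\ ok q', half q.1 q'.1, half q.2 q'.2 & jq q / 4 <= jq q'].
  (* The step must be total for [choice]; outside the admissible rectangles any witness will do. *)
  have [okq|nok] := pselect (ok q); last by exists q.
  case: q okq => -[a' b'] [c' d'] [[/= aa' ab' bb'] [/= cc' cd' dd']].
  pose m := (a' + b') / 2; pose n := (c' + d') / 2.
  have [am mb] : a' <= m /\ m <= b' by split; rewrite /m; lra.
  have [cn nd] : c' <= n /\ n <= d' by split; rewrite /n; lra.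
  have e : J a' b' c' d' = (J a' m c' n + J a' m n d') + (J m b' c' n + J m b' n d').
    have mb2 : m <= b by exact: le_trans mb bb'.
    have am2 : a <= m by exact: le_trans aa' am.
    by rewrite (JH a' m b')// (JV a' m c' n)// (JV m b' c' n).
  have : jq ((a', m), (c', n)) >= jq ((a', b'), (c', d')) / 4 \/
         jq ((a', m), (n, d')) >= jq ((a', b'), (c', d')) / 4 \/
         jq ((m, b'), (c', n)) >= jq ((a', b'), (c', d')) / 4 \/
         jq ((m, b'), (n, d')) >= jq ((a', b'), (c', d')) / 4.
    rewrite /jq/= e.
    set A := J _ _ _ _; set B := J _ _ _ _; set C := J _ _ _ _; set D := J _ _ _ _.
    have := ler_normD (A + B) (C + D).
    have := ler_normD A B; have := ler_normD C D.
    set X := `|A + B + _|.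
    have [hA|hA] := leP (X / 4) `|A|; first by left.
    have [hB|hB] := leP (X / 4) `|B|; first by right; left.
    have [hC|hC] := leP (X / 4) `|C|; first by right; right; left.
    by right; right; right; lra.
  have e2 (x y : R) : (x + y) / 2 - x = (y - x) / 2 by lra.
  have e3 (x y : R) : y - (x + y) / 2 = (y - x) / 2 by lra.
  have mb2 : m <= b by exact: le_trans mb bb'.
  have am2 : a <= m by exact: le_trans aa' am.
  have nd2 : n <= d by exact: le_trans nd dd'.
  have cn2 : c <= n by exact: le_trans cc' cn.
  case=> [h|[h|[h|h]]].
  - exists ((a', m), (c', n)) => _; split => //; split => //=; exact: e2.
  - exists ((a', m), (n, d')) => _; split => //; split => //=; [exact: e2|exact: e3].
  - exists ((m, b'), (c', n)) => _; split => //; split => //=; [exact: e3|exact: e2].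
  - exists ((m, b'), (n, d')) => _; split => //; split => //=; exact: e3.
have [f fP] := choice step.
pose q n := iter n f ((a, b), (c, d)).
have okn n : ok (q n).
  by elim: n => [|n IH]; [by split; split => /=; rewrite ?lexx|have [] := fP _ IH].
have stepn n : [/\ half (q n).1 (q n.+1).1, half (q n).2 (q n.+1).2 & jq (q n) / 4 <= jq (q n.+1)].
  by have [_ ? ? ?] := fP _ (okn n).
have jn n : `|J a b c d| / 4 ^+ n <= jq (q n).
  elim: n => [|n IH]; first by rewrite expr0 divr1.
  have [_ _] := stepn n; apply: le_trans.
  by rewrite exprSr invfM mulrA ler_pM2r// invr_gt0.
have nested (p : nat -> R * R) : (forall n, half (p n) (p n.+1)) -> (p 0).1 <= (p 0).2 ->
    exists x, forall n, (p n).1 <= x <= (p n).2 /\ (p n).2 - (p n).1 = ((p 0).2 - (p 0).1) / 2 ^+ n.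
  move=> ph p0.
  have len n : (p n).2 - (p n).1 = ((p 0).2 - (p 0).1) / 2 ^+ n.
    elim: n => [|n IH]; first by rewrite expr0 divr1.
    by have [_ _ ->] := ph n; rewrite IH exprSr invfM mulrA.
  have le12 n : (p n).1 <= (p n).2.
    by rewrite -subr_ge0 len divr_ge0// ?subr_ge0// exprn_ge0.
  have mon1 n k : (p n).1 <= (p (n + k)%N).1.
    elim: k => [|k IH]; first by rewrite addn0.
    by rewrite addnS (le_trans IH)//; have [] := ph (n + k)%N.
  have mon2 n k : (p (n + k)%N).2 <= (p n).2.
    elim: k => [|k IH]; first by rewrite addn0.
    by rewrite addnS (le_trans _ IH)//; have [] := ph (n + k)%N.
  have cross n k : (p n).1 <= (p k).2.
    have [nk|/ltnW kn] := leqP n k.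
      by rewrite -(subnKC nk) (le_trans (mon1 _ (k - n)%N)).
    by rewrite -(subnKC kn) (le_trans (le12 _))// mon2.
  pose A := range (fun n => (p n).1).
  have hsA : has_sup A.
    split; first by exists (p 0).1, 0.
    by exists (p 0).2 => _ [n _ <-]; exact: cross.
  exists (sup A) => n; split => //; apply/andP; split.
    by apply: ub_le_sup; [case: hsA|exists n].
  by apply: ge_sup; [case: hsA|move=> _ [k _ <-]; exact: cross].
have [x xP] := nested (fun n => (q n).1) (fun n => let: And3 h _ _ := stepn n in h) ab.
have [y yP] := nested (fun n => (q n).2) (fun n => let: And3 _ h _ := stepn n in h) cd.
pose L := (b - a) + (d - c).
have L0 : 0 <= L by rewrite /L; lra.
(* After n halvings the hypothesis reads |J| / 4^n <= e (L / 2^n)^2, that is |J| <= e L^2. This [e]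
   makes it fail, also when L = 0. *)
have e0 : 0 < `|J a b c d| / (2 * (L ^+ 2 + 1)).
  by rewrite divr_gt0// mulr_gt0// ltr_wpDl// sqr_ge0.
have [r r0 rP] := Jsmall x y (proj1 (xP 0)) (proj1 (yP 0)) _ e0.
have [n Ln] : exists n, L / 2 ^+ n < r.
  have rL : 0 < r / (L + 1) by rewrite divr_gt0// ltr_wpDl.
  have [n _ /(_ n (leqnn n)) /= h] := near_infty_natSinv_expn_lt (PosNum rL); exists n.
  move: h; rewrite ltr_pdivlMr ?ltr_wpDl// mul1r; apply: le_lt_trans.
  by rewrite mulrC ler_wpM2l// ?lerDl// invr_ge0 exprn_ge0.
have pow0 : 0 < 2 ^+ n :> R by rewrite exprn_gt0.
have [xn lxn] := xP n; have [yn lyn] := yP n.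
have [[h1 h2 h3] [h4 h5 h6]] := okn n.
rewrite /= in lxn lyn.
have lt1 : (q n).1.2 - (q n).1.1 < r.
  by rewrite lxn; apply: le_lt_trans Ln; rewrite ler_pM2r ?invr_gt0// /L; lra.
have lt2 : (q n).2.2 - (q n).2.1 < r.
  by rewrite lyn; apply: le_lt_trans Ln; rewrite ler_pM2r ?invr_gt0// /L; lra.
have := rP _ _ _ _ h1 xn h3 h4 yn h6 lt1 lt2.
rewrite lxn lyn -mulrDl -/L => /(le_trans (jn n)).
rewrite exprMn exprVn -exprM mulnC exprM -(_ : 4 = 2 ^+ 2 :> R); last by rewrite -natrX.
rewrite mulrA ler_pM2r ?invr_gt0 ?exprn_gt0// => h.
have : `|J a b c d| / (2 * (L ^+ 2 + 1)) * L ^+ 2 < `|J a b c d|.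
  rewrite -mulrA gtr_pMr// mulrC ltr_pdivrMr ?mul1r.
    by have := sqr_ge0 L; lra.
  by have := sqr_ge0 L; lra.
by rewrite ltNge h.
Qed.

End Bisection.

Section ComplexDerivative.
Context {R : realType}.
Implicit Types (f g : R[i] -> R[i]) (z w : R[i]).
Local Notation normc := (@Normc.normc R).
Local Notation Re := (@complex.Re R).
Local Notation Im := (@complex.Im R).

Definition holo_at g w := derivable (g : R[i]^o -> R[i]^o) w 1.

(** Clearing the quotient includes h = 0 and leaves a linear error with real constants, the form
    needed under an integral. *)
Lemma holo_atP g w : holo_at g w -> exists l : R[i], forall e : R, 0 < e ->
  exists2 r : R, 0 < r & forall h, normc h < r ->
    normc (g (w + h) - g w - l * h) <= e * normc h.
Proof.
move=> /cvg_ex[/= l gl]; exists l => e e0.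
have e0' : 0 < e%:C :> R[i] by rewrite ltcR.
have /= := @cvgr_dist_le _ _ _ _ _ _ _ gl _ e0'.
move=> /(_ _)/nbhs_ballP[r /= r0 rP].
(* The norm of [R[i]] takes its values in [R[i]], so the radius of the ball is a positive complex
   number, hence real. *)
have rE : r = (Re r)%:C by rewrite [LHS]complexReIm (ger0_Im (ltW r0)).
exists (Re r) => [|h hr]; first by rewrite rE ltcR in r0.
have [->|h0] := eqVneq h 0.
  by rewrite addr0 subrr mulr0 subrr Normc.normc0 mulr0.
have := rP h; rewrite /ball /= sub0r normrN normr_normc rE ltcR => /(_ hr h0).
rewrite normr_normc lecR => hle.
have -> : g (w + h) - g w - l * h = - (l - h^-1 * (g (h * 1 + w) - g w)) * h.
  by rewrite mulr1 (addrC h); field.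
by rewrite Normc.normcM normcN ler_wpM2r// normc_ge0.
Qed.

Lemma holo_at_lipschitz g w : holo_at g w -> exists M : R, exists2 r : R, 0 < r &
  forall h, normc h < r -> normc (g (w + h) - g w) <= M * normc h.
Proof.
move=> /holo_atP[l /(_ 1 ltr01)[r r0 rP]]; exists (1 + normc l), r => // h hr.
have := rP h hr; have := normcB_ge (g (w + h) - g w) (l * h).
rewrite mulrDl Normc.normcM; lra.
Qed.

Lemma holo_at_cont g w : holo_at g w -> forall e : R, 0 < e ->
  exists2 r : R, 0 < r & forall h, normc h < r -> normc (g (w + h) - g w) <= e.
Proof.
move=> /holo_at_lipschitz[M [r r0 rP]] e e0.
have M0 : 0 < `|M| + 1 by rewrite ltr_wpDl.
exists (Num.min r (e / (`|M| + 1))).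
  by rewrite lt_min r0 divr_gt0.
move=> h; rewrite lt_min => /andP[hr hM].
apply: le_trans (rP h hr) _.
apply: (@le_trans _ _ ((`|M| + 1) * normc h)).
  by rewrite ler_wpM2r ?normc_ge0// (le_trans (ler_norm M))// lerDl.
by rewrite ltW// mulrC -ltr_pdivlMr.
Qed.

(** Serves all sides of a rectangle at once: [u] will be a horizontal or vertical line and [P] the
    real part, the imaginary part or the modulus. *)
Lemma holo_at_continuous_line g (u : R -> R[i]) (P : R[i] -> R) t :
  (forall v w, `|P v - P w| <= normc (v - w)) ->
  (forall s, normc (u s - u t) = `|s - t|) -> holo_at g (u t) ->
  {for t, continuous (fun s => P (g (u s)))}.
Proof.
move=> Plip uiso /holo_at_cont gc; apply/cvgrPdist_le => e e0.
have [r r0 rP] := gc e e0.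
near=> s.
apply: le_trans (Plip _ _) _; rewrite normcBC.
have -> : u s = u t + (u s - u t) by rewrite addrC subrK.
apply: rP; rewrite uiso distrC; near: s.
by apply/nbhs_ballP; exists r.
Unshelve. all: by end_near. Qed.

End ComplexDerivative.

Section SegmentIntegral.
Context {R : realType}.
Local Notation mu := (@lebesgue_measure R).
Implicit Types (h k : R -> R) (a b : R).

Definition seg_int h a b : R := \int[mu]_(x in `[a, b]) h x.

(** Continuity is two-sided even at the endpoints. The integrands below have it because they come
    from functions complex differentiable at every point of a side. *)
Definition continuous_on h a b := {in `[a, b], continuous h}.

Lemma continuous_on_integrable h a b : continuous_on h a b ->
  mu.-integrable `[a, b] (EFin \o h).
Proof.
move=> hc; apply: continuous_compact_integrable; first exact: segment_compact.
apply: continuous_in_subspaceT => x xab; apply: hc.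
by rewrite inE in xab.
Qed.

Lemma seg_int_split h a m b : a <= m -> m <= b -> continuous_on h a b ->
  seg_int h a b = seg_int h a m + seg_int h m b.
Proof.
move=> am mb hc; have hi := continuous_on_integrable hc.
apply/eqP; rewrite addrC -subr_eq /seg_int; apply/eqP.
rewrite Rintegral_itvB// ?Rintegral_itv_obnd_cbnd// ?bnd_simp//.
apply: integrableS hi => // x /=; rewrite !in_itv/= => /andP[mx ->].
by rewrite (le_trans am (ltW mx)).
Qed.

Lemma seg_int_cst a b (k : R) : a <= b -> seg_int (fun=> k) a b = k * (b - a).
Proof.
move=> ab; rewrite /seg_int Rintegral_cst//= lebesgue_measure_itv/= lte_fin.
by move: ab; rewrite le_eqVlt => /predU1P[->|->]//=; rewrite ltxx subrr.
Qed.

Lemma seg_int_le h k a b : continuous_on h a b -> continuous_on k a b ->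
  {in `[a, b], forall x, h x <= k x} -> seg_int h a b <= seg_int k a b.
Proof.
move=> hc kc hk; apply: le_Rintegral => //; try exact: continuous_on_integrable.
Qed.

Lemma seg_intD h k a b : continuous_on h a b -> continuous_on k a b ->
  seg_int (fun x => h x + k x) a b = seg_int h a b + seg_int k a b.
Proof.
by move=> hc kc; rewrite /seg_int RintegralD//; exact: continuous_on_integrable.
Qed.

Lemma seg_intB h k a b : continuous_on h a b -> continuous_on k a b ->
  seg_int (fun x => h x - k x) a b = seg_int h a b - seg_int k a b.
Proof.
by move=> hc kc; rewrite /seg_int RintegralB//; exact: continuous_on_integrable.
Qed.

Lemma seg_int_norm h a b : continuous_on h a b ->
  `|seg_int h a b| <= seg_int (fun x => `|h x|) a b.
Proof.
by move=> hc; apply: le_normr_Rintegral => //; exact: continuous_on_integrable.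
Qed.

Lemma seg_int_dist h k a b (e : R) : a <= b -> continuous_on h a b -> continuous_on k a b ->
  {in `[a, b], forall x, `|h x - k x| <= e} ->
  `|seg_int h a b - seg_int k a b| <= e * (b - a).
Proof.
move=> ab hc kc hk; rewrite -seg_intB// -seg_int_cst//.
have hkc : continuous_on (fun x => h x - k x) a b.
  by move=> x xab; apply: continuousB; [exact: hc|exact: kc].
apply: le_trans (seg_int_norm hkc) _; apply: seg_int_le => //.
- by move=> x xab; apply: (continuous_comp (hkc x xab)); exact: norm_continuous.
- by move=> x xab; exact: cst_continuous.
Qed.

(* Contour integrals over rectangles and Goursat's theorem *)
End SegmentIntegral.

Section RectangleIntegral.
Context {R : realType}.
Implicit Types (f g : R[i] -> R[i]) (z w : R[i]) (a b c d : R).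
Local Notation normc := (@Normc.normc R).
Local Notation Re := (@complex.Re R).
Local Notation Im := (@complex.Im R).

(* The real part of the counterclockwise contour integral of [g] along the
   boundary of [a, b] x [c, d]. *)
Definition rect_int g a b c d : R :=
  seg_int (fun x => Re (g (x +i* c)) - Re (g (x +i* d))) a b -
  seg_int (fun y => Im (g (b +i* y)) - Im (g (a +i* y))) c d.

Definition holo_rect g a b c d :=
  forall x y, a <= x <= b -> c <= y <= d -> holo_at g (x +i* y).

Definition rect_sides a b c d : set R[i] := [set w |
  [/\ a <= Re w <= b, c <= Im w <= d &
      [|| Re w == a, Re w == b, Im w == c | Im w == d]]].

(** Asking for differentiability on the boundary alone lets splitting and estimates apply to Cauchy
    kernels with a pole inside. *)
Definition holo_sides g a b c d := forall w, rect_sides a b c d w -> holo_at g w.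

Lemma holo_rect_sides g a b c d : holo_rect g a b c d -> holo_sides g a b c d.
Proof. by move=> gh [x y] [/= xab ycd _]; exact: gh. Qed.

Lemma horizontal_continuous g y a b :
  (forall x, a <= x <= b -> holo_at g (x +i* y)) ->
  continuous_on (fun x => Re (g (x +i* y))) a b.
Proof.
move=> gh x xab; apply: (@holo_at_continuous_line _ g (fun x => x +i* y)).
- by move=> v w; rewrite -cReB normRe_le.
- by move=> s; rewrite normc_sqrt/= subrr expr0n/= addr0 sqrtr_sqr.
- by apply: gh; rewrite in_itv in xab.
Qed.

Lemma vertical_continuous g x a b :
  (forall y, a <= y <= b -> holo_at g (x +i* y)) ->
  continuous_on (fun y => Im (g (x +i* y))) a b.
Proof.
move=> gh y yab; apply: (@holo_at_continuous_line _ g (fun y => x +i* y)).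
- by move=> v w; rewrite -cImB normIm_le.
- by move=> s; rewrite normc_sqrt/= subrr expr0n/= add0r sqrtr_sqr.
- by apply: gh; rewrite in_itv in yab.
Qed.

Lemma continuous_onB (h k : R -> R) a b : continuous_on h a b ->
  continuous_on k a b -> continuous_on (fun x => h x - k x) a b.
Proof. by move=> hc kc x xab; apply: continuousB; [exact: hc|exact: kc]. Qed.

(** The common side at abscissa [m] is traversed once in each direction and cancels. *)
Lemma rect_int_splitH g a m b c d : a <= m -> m <= b -> c <= d ->
  holo_sides g a m c d -> holo_sides g m b c d -> 
  rect_int g a b c d = rect_int g a m c d + rect_int g m b c d.
Proof.
move=> am mb cd h1 h2.
have hor y : y = c \/ y = d -> forall x, a <= x <= b -> holo_at g (x +i* y).
  move=> ycd x /andP[ax xb]; have [xm|mx] := leP x m.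
    by apply: h1; split; rewrite /= ?ax ?xm//; case: ycd => ->; rewrite ?lexx ?eqxx ?orbT//= cd.
  by apply: h2; split; rewrite /= ?(ltW mx) ?xb//; case: ycd => ->; rewrite ?lexx ?eqxx ?orbT//= cd.
have va : continuous_on (fun y => Im (g (a +i* y))) c d.
  by apply: vertical_continuous => y ycd; apply: h1; split => //=; rewrite ?eqxx// lexx am.
have vm : continuous_on (fun y => Im (g (m +i* y))) c d.
  by apply: vertical_continuous => y ycd; apply: h2; split => //=; rewrite ?eqxx// lexx mb.
have vb : continuous_on (fun y => Im (g (b +i* y))) c d.
  by apply: vertical_continuous => y ycd; apply: h2; split => //=; rewrite ?eqxx ?orbT// lexx mb.
rewrite /rect_int (@seg_int_split _ _ a m b)//; last first.
  by apply: continuous_onB; apply: horizontal_continuous; apply: hor; [left|right].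
rewrite (seg_intB vb va) (seg_intB vm va) (seg_intB vb vm); ring.
Qed.

Lemma rect_int_splitV g a b c m d : a <= b -> c <= m -> m <= d ->
  holo_sides g a b c m -> holo_sides g a b m d ->
  rect_int g a b c d = rect_int g a b c m + rect_int g a b m d.
Proof.
move=> ab cm md h1 h2.
have ver x : x = a \/ x = b -> forall y, c <= y <= d -> holo_at g (x +i* y).
  move=> xab y /andP[cy yd]; have [ym|my] := leP y m.
    by apply: h1; split; rewrite /= ?cy ?ym//; case: xab => ->; rewrite ?lexx ?eqxx ?orbT//= ab.
  by apply: h2; split; rewrite /= ?(ltW my) ?yd//; case: xab => ->; rewrite ?lexx ?eqxx ?orbT//= ab.
have hc : continuous_on (fun x => Re (g (x +i* c))) a b.
  by apply: horizontal_continuous => x xab; apply: h1; split => //=; rewrite ?eqxx ?orbT// lexx cm.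
have hm : continuous_on (fun x => Re (g (x +i* m))) a b.
  by apply: horizontal_continuous => x xab; apply: h2; split => //=; rewrite ?eqxx ?orbT// lexx md.
have hd : continuous_on (fun x => Re (g (x +i* d))) a b.
  by apply: horizontal_continuous => x xab; apply: h2; split => //=; rewrite ?eqxx ?orbT// lexx md.
rewrite /rect_int (@seg_int_split _ (fun y => Im _ - _) c m d)//; last first.
  by apply: continuous_onB; apply: vertical_continuous; apply: ver; [right|left].
rewrite (seg_intB hc hd) (seg_intB hc hm) (seg_intB hm hd); ring.
Qed.

Section Sides.
Variables (g : R[i] -> R[i]) (a b c d : R).
Hypotheses (ab : a <= b) (cd : c <= d) (gh : holo_sides g a b c d).

Lemma side_continuous :
  [/\ continuous_on (fun x => Re (g (x +i* c))) a b,
      continuous_on (fun x => Re (g (x +i* d))) a b,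
      continuous_on (fun y => Im (g (a +i* y))) c d &
      continuous_on (fun y => Im (g (b +i* y))) c d].
Proof.
split.
- by apply: horizontal_continuous => x xab; apply: gh; split => //=; rewrite ?eqxx ?orbT// lexx cd.
- by apply: horizontal_continuous => x xab; apply: gh; split => //=; rewrite ?eqxx ?orbT// lexx cd.
- by apply: vertical_continuous => y ycd; apply: gh; split => //=; rewrite ?eqxx ?orbT// lexx ab.
- by apply: vertical_continuous => y ycd; apply: gh; split => //=; rewrite ?eqxx ?orbT// lexx ab.
Qed.

End Sides.

(** The factor 2 appears because opposite sides share one integrand, and each of them contributes an
    error [e]. *)
Lemma rect_int_dist g f a b c d (e : R) : a <= b -> c <= d ->
  holo_sides g a b c d -> holo_sides f a b c d ->
  (forall w, rect_sides a b c d w -> normc (g w - f w) <= e) ->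
  `|rect_int g a b c d - rect_int f a b c d| <= 2 * e * ((b - a) + (d - c)).
Proof.
move=> ab cd gh fh gf.
have [g1 g2 g3 g4] := side_continuous ab cd gh.
have [f1 f2 f3 f4] := side_continuous ab cd fh.
have /= hor : `|seg_int (fun x => Re (g (x +i* c)) - Re (g (x +i* d))) a b -
    seg_int (fun x => Re (f (x +i* c)) - Re (f (x +i* d))) a b| <= 2 * e * (b - a).
  apply: seg_int_dist => //; try exact: continuous_onB.
  move=> x; rewrite in_itv /= => xab.
  have A : rect_sides a b c d (x +i* c) by split; rewrite /= ?eqxx ?orbT ?lexx.
  have B : rect_sides a b c d (x +i* d) by split; rewrite /= ?eqxx ?orbT ?lexx ?cd.
  have := le_trans (normRe_le _) (gf _ A); have := le_trans (normRe_le _) (gf _ B).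
  rewrite !cReB => hB hA.
  rewrite (_ : _ - _ - _ = (Re (g (x +i* c)) - Re (f (x +i* c))) -
     (Re (g (x +i* d)) - Re (f (x +i* d)))); last by ring.
  apply: le_trans (ler_normB _ _) _; lra.
have /= ver : `|seg_int (fun y => Im (g (b +i* y)) - Im (g (a +i* y))) c d -
    seg_int (fun y => Im (f (b +i* y)) - Im (f (a +i* y))) c d| <= 2 * e * (d - c).
  apply: seg_int_dist => //; try exact: continuous_onB.
  move=> y; rewrite in_itv /= => ycd.
  have A : rect_sides a b c d (a +i* y) by split; rewrite /= ?eqxx ?orbT ?lexx.
  have B : rect_sides a b c d (b +i* y) by split; rewrite /= ?eqxx ?orbT ?lexx ?ab.
  have := le_trans (normIm_le _) (gf _ A); have := le_trans (normIm_le _) (gf _ B).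
  rewrite !cImB => hB hA.
  rewrite (_ : _ - _ - _ = (Im (g (b +i* y)) - Im (f (b +i* y))) -
     (Im (g (a +i* y)) - Im (f (a +i* y)))); last by ring.
  apply: le_trans (ler_normB _ _) _; lra.
rewrite /rect_int.
set X := seg_int _ _ _ in hor *; set Y := seg_int _ _ _ in hor *.
set X' := seg_int _ _ _ in ver *; set Y' := seg_int _ _ _ in ver *.
rewrite (_ : _ - _ - _ = (X - Y) - (X' - Y')); last by ring.
apply: le_trans (ler_normB _ _) _; rewrite mulrDr; exact: lerD.
Qed.

(** The difference of an affine function between opposite sides is constant, and the two pairs of
    sides give the same product of side lengths. *)
Lemma rect_int_affine (al l w0 : R[i]) a b c d : a <= b -> c <= d ->
  rect_int (fun w => al + l * (w - w0)) a b c d = 0.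
Proof.
move=> ab cd; rewrite /rect_int.
rewrite (_ : (fun x => _) = fun=> Im l * (d - c)); last first.
  by apply/funext => x; rewrite !(cReD, cReM, cImD, cImM, cReN, cImN)/=; ring.
rewrite [X in _ - seg_int X _ _](_ : _ = fun=> Im l * (b - a)); last first.
  by apply/funext => y; rewrite !(cReD, cReM, cImD, cImM, cReN, cImN)/=; ring.
by rewrite !seg_int_cst//; ring.
Qed.

Lemma holo_at_affine (al l w0 w : R[i]) : holo_at (fun w => al + l * (w - w0)) w.
Proof.
by apply: derivableD; [exact: derivable_cst|apply: derivableM; [exact: derivable_cst|
   apply: derivableB; [exact: derivable_id|exact: derivable_cst]]].
Qed.

(** Near each point g differs from its affine approximation by o(distance), and the affine part
    integrates to 0, so small rectangles carry o(size^2). *)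
Lemma goursat g a b c d : a <= b -> c <= d -> holo_rect g a b c d ->
  rect_int g a b c d = 0.
Proof.
move=> ab cd gh.
have sub a' b' c' d' : a <= a' -> b' <= b -> c <= c' -> d' <= d ->
    holo_sides g a' b' c' d'.
  move=> aa bb cc dd; apply: holo_rect_sides => x y /andP[ax xb] /andP[cy yd].
  by apply: gh; rewrite ?(le_trans aa ax) ?(le_trans xb bb) ?(le_trans cc cy) ?(le_trans yd dd).
apply: (additive_rect_eq0 (J := rect_int g) ab cd).
- move=> a' m b' c' d' aa' am mb bb cc cd' dd; apply: rect_int_splitH => //; apply: sub => //.
    exact: le_trans mb bb.
  exact: le_trans aa' am.
- move=> a' b' c' m d' aa' a'b' bb cc cm md dd; apply: rect_int_splitV => //; apply: sub => //.
    exact: le_trans md dd.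
  exact: le_trans cc cm.
move=> x y xab ycd e e0.
have [l gl] := holo_atP (gh x y xab ycd).
have e2 : 0 < e / 2 by rewrite divr_gt0.
(* With both side lengths below r / 2, width plus height, which bounds the distance to the point, is
   below r. The choice e / 2 cancels the factor 2 of [rect_int_dist]. *)
have [r r0 rP] := gl _ e2; exists (r / 2); first by rewrite divr_gt0.
move=> a' b' c' d' aa' /andP[a'x xb'] bb' cc' /andP[c'y yd'] dd' lab lcd.
pose f w := g (x +i* y) + l * (w - (x +i* y)).
have a'b' := le_trans a'x xb'; have c'd' := le_trans c'y yd'.
have := @rect_int_dist g f a' b' c' d' (e / 2 * ((b' - a') + (d' - c'))) a'b' c'd' (sub _ _ _ _ aa' bb' cc' dd').
rewrite rect_int_affine// subr0 => H; apply: le_trans (H _ _) _.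
- by move=> w _; exact: holo_at_affine.
- move=> [u v] [/= /andP[au ub] /andP[cv vd] _].
  have hn : normc ((u +i* v) - (x +i* y)) <= (b' - a') + (d' - c').
    apply: le_trans (normc_le_ReIm _) _; rewrite /=.
    by rewrite lerD// ler_norml; apply/andP; split; lra.
  have := rP ((u +i* v) - (x +i* y)).
  rewrite addrCA subrr addr0 /f opprD addrA => h; apply: le_trans (h _) _.
    by apply: le_lt_trans hn _; lra.
  by rewrite ler_wpM2l// ltW.
- by rewrite (_ : 2 * _ * _ = e * ((b' - a') + (d' - c')) ^+ 2)//; field.
Qed.

End RectangleIntegral.

(** * Cauchy's integral formula for rectangles *)

Section CauchyFormula.
Context {R : realType}.
Implicit Types (f g : R[i] -> R[i]) (z w : R[i]) (a b c d x y e : R).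
Local Notation normc := (@Normc.normc R).
Local Notation Re := (@complex.Re R).
Local Notation Im := (@complex.Im R).

Lemma cReV z : Re z^-1 = Re z / (Re z ^+ 2 + Im z ^+ 2).
Proof. by case: z. Qed.

Lemma cImV z : Im z^-1 = - Im z / (Re z ^+ 2 + Im z ^+ 2).
Proof. by case: z => u v /=; rewrite mulNr. Qed.

(** The factor -i turns the residue value 2 pi i f(z) into 2 pi f(z), whose real part is the one
    that [rect_int] sees. *)
Definition cauchy_kernel f z : R[i] -> R[i] := fun w => - 'i * f w / (w - z).

Lemma holo_cauchy_kernel f z w : holo_at f w -> w != z ->
  holo_at (cauchy_kernel f z) w.
Proof.
move=> fw wz; apply: derivableM; last first.
  apply: derivableV; first by rewrite subr_eq0.
  by apply: derivableB; [exact: derivable_id|exact: derivable_cst].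
by apply: derivableM; [exact: derivable_cst|exact: fw].
Qed.

Lemma cReNiM z : Re (- 'i * z) = Im z.
Proof. by rewrite cReM/= oppr0 mul0r sub0r mulN1r opprK. Qed.

(** A primitive is 2 k atan((t - x) / e), and atan 1 - atan(-1) = pi / 2. *)
Lemma seg_int_poisson x e (k : R) : 0 < e ->
  seg_int (fun t => 2 * k * e / ((t - x) ^+ 2 + e ^+ 2)) (x - e) (x + e) = k * pi.
Proof.
move=> e0; have e_neq0 : e != 0 by rewrite gt_eqF.
have den t : 0 < (t - x) ^+ 2 + e ^+ 2 by rewrite ltr_wpDl ?sqr_ge0// exprn_gt0.
pose F t := 2 * k * atan ((t - x) / e).
have dF (t : R) : is_derive t (1 : R) F (2 * k * e / ((t - x) ^+ 2 + e ^+ 2)).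
  have d1 : is_derive t (1 : R) (fun t => (t - x) / e) e^-1.
    have -> : (fun t => (t - x) / e) = e^-1 *: (id \- cst x).
      by apply/funext => s /=; rewrite mulrC.
    by apply: is_derive_eq; rewrite subr0 /GRing.scale/= mulr1.
  have d2 := @is_derive1_comp _ (@atan R) (fun t => (t - x) / e) t _ _ (is_derive1_atan _) d1.
  have -> : F = (2 * k) *: (atan \o (fun t => (t - x) / e)) by [].
  apply: is_derive_eq; rewrite /GRing.scale/= -mulrA; congr (_ * _).
  by field; rewrite e_neq0/=; have := den t; rewrite addrC => /gt_eqF ->.
have cont : continuous (fun t => 2 * k * e / ((t - x) ^+ 2 + e ^+ 2)).
  move=> t; apply: cvgM; first exact: cvg_cst.
  apply: cvgV; first by rewrite gt_eqF.
  apply: cvgD; last exact: cvg_cst.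
  by apply: (@continuous_comp _ _ _ (fun t => t - x) (fun s => s ^+ 2));
     [apply: cvgB; [exact: cvg_id|exact: cvg_cst]|exact: exprn_continuous].
have cF : continuous F.
  move=> t; apply: differentiable_continuous; apply/derivable1_diffP.
  by have [] := dF t.
rewrite /seg_int /Rintegral (@continuous_FTC2 _ _ F)//.
- rewrite /F/= [x + e]addrC [x - e]addrC !addrK mulNr divff//.
  by rewrite atanN atan1; field.
- lra.
- exact: continuous_subspaceT.
- split => [t _|  |]; first by have [] := dF t.
    by apply: cvg_at_right_filter; exact: cF.
  by apply: cvg_at_left_filter; exact: cF.
- by move=> t _; rewrite derive1E; apply: derive_val.
Qed.

(** On a square centred at the pole the terms with Im al are equal on opposite sides and cancel.
    Each pair of sides leaves a Poisson kernel with integral pi Re al. *)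
Lemma rect_int_cauchy_kernel_cst (al : R[i]) x y e : 0 < e ->
  rect_int (cauchy_kernel (fun=> al) (x +i* y)) (x - e) (x + e) (y - e) (y + e) =
  2 * pi * Re al.
Proof.
move=> e0; have e_neq0 : e != 0 by rewrite gt_eqF.
have den t : t ^+ 2 + e ^+ 2 != 0 by rewrite gt_eqF// ltr_wpDl ?sqr_ge0// exprn_gt0.
have den' t : e ^+ 2 + t ^+ 2 != 0 by rewrite addrC.
rewrite /rect_int (_ : (fun t => _) =
    (fun t => 2 * Re al * e / ((t - x) ^+ 2 + e ^+ 2))); last first.
  apply/funext => t; rewrite /cauchy_kernel !(cReM, cReV, cImV, cImM, cReB, cImB)/=.
  by field; exact: den.
rewrite [X in _ - seg_int X _ _](_ : _ =
    (fun t => 2 * (- Re al) * e / ((t - y) ^+ 2 + e ^+ 2))); last first.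
  apply/funext => t; rewrite /cauchy_kernel !(cReM, cReV, cImV, cImM, cReB, cImB)/=.
  by field; exact: den.
by rewrite !seg_int_poisson//; ring.
Qed.

(** By Goursat on the four surrounding rectangles the contour shrinks to a small square around z.
    There f may be replaced by f(z), since (f w - f z) / (w - z) stays bounded while the perimeter
    tends to 0. *)
Lemma cauchy_formula f a b c d z : entire f ->
  a < Re z < b -> c < Im z < d ->
  rect_int (cauchy_kernel f z) a b c d = 2 * pi * Re (f z).
Proof.
case: z => x y fe /= /andP[ax xb] /andP[cy yd].
set z := x +i* y; pose g := cauchy_kernel f z.
have gh w : w != z -> holo_at g w by move=> wz; apply: holo_cauchy_kernel => //; exact: fe.
have shrink e : 0 < e -> e <= x - a -> e <= b - x -> e <= y - c -> e <= d - y ->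
    rect_int g a b c d = rect_int g (x - e) (x + e) (y - e) (y + e).
  move=> e0 e1 e2 e3 e4.
  have xl : a <= x - e by lra.
  have xm : x - e <= x + e by lra.
  have xr : x + e <= b by lra.
  have xb' : x - e <= b by lra.
  have yl : c <= y - e by lra.
  have ym : y - e <= y + e by lra.
  have yr : y + e <= d by lra.
  have yd' : y - e <= d by lra.
  have cd : c <= d by lra.
  have nz u v : u <> x \/ v <> y -> holo_at g (u +i* v).
    by move=> uv; apply: gh; apply/eqP => -[] ux vy; case: uv.
  have sides a' b' c' d' : (a' != x) -> (b' != x) -> (c' != y) -> (d' != y) ->
      holo_sides g a' b' c' d'.
    move=> /eqP na /eqP nb /eqP nc /eqP nd [u v] [/= _ _ /or4P[]/eqP E]; apply: nz; rewrite E; by [left|right].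
  have xe1 : x - e != x by rewrite lt_eqF//; lra.
  have xe2 : x + e != x by rewrite gt_eqF//; lra.
  have ye1 : y - e != y by rewrite lt_eqF//; lra.
  have ye2 : y + e != y by rewrite gt_eqF//; lra.
  have na : a != x by rewrite lt_eqF.
  have nb : b != x by rewrite gt_eqF.
  have nc : c != y by rewrite lt_eqF.
  have nd : d != y by rewrite gt_eqF.
  rewrite (@rect_int_splitH _ g a (x - e) b c d)//; [|exact: sides|exact: sides].
  rewrite (@rect_int_splitH _ g (x - e) (x + e) b c d)//; [|exact: sides|exact: sides].
  rewrite (@rect_int_splitV _ g (x - e) (x + e) c (y - e) d)//; [|exact: sides|exact: sides].
  rewrite (@rect_int_splitV _ g (x - e) (x + e) (y - e) (y + e) d)//; [|exact: sides|exact: sides].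
  rewrite (goursat xl cd) ?(goursat xr cd) ?(goursat xm yl) ?(goursat xm yr) ?add0r ?addr0//.
  - by move=> u v _ /andP[ue _]; apply: nz; right; lra.
  - by move=> u v _ /andP[_ ue]; apply: nz; right; lra.
  - by move=> u v /andP[ue _] _; apply: nz; left; lra.
  - by move=> u v /andP[_ ue] _; apply: nz; left; lra.
have [M [r r0 rP]] := holo_at_lipschitz (fe z).
(* Points of the square lie within 2e of z, where the Lipschitz bound holds. The constant is 8 |M| e
   = 2 |M| (2e + 2e), from [rect_int_dist]. *)
have close e : 0 < e -> 2 * e < r -> e <= x - a -> e <= b - x -> e <= y - c -> e <= d - y ->
    `|rect_int g a b c d - 2 * pi * Re (f z)| <= 8 * `|M| * e.
  move=> e0 er e1 e2 e3 e4; rewrite (shrink e)// -(rect_int_cauchy_kernel_cst (f z) x y e0).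
  apply: le_trans (@rect_int_dist _ _ _ _ _ _ _ `|M| _ _ _ _ _) _; [lra|lra| | | |].
  - move=> [u v] [/= _ _ uv]; apply: gh; apply/eqP => -[] ux vy.
    by case/or4P: uv => /eqP; lra.
  - move=> [u v] [/= _ _ uv]; apply: holo_cauchy_kernel; first exact: derivable_cst.
    by apply/eqP => -[] ux vy; case/or4P: uv => /eqP; lra.
  - move=> [u v] [/= /andP[u1 u2] /andP[v1 v2] uv].
    have wz : (u +i* v) - z != 0.
      by rewrite subr_eq0; apply/eqP => -[] ux vy; case/or4P: uv => /eqP; lra.
    have hn : normc ((u +i* v) - z) < r.
      apply: le_lt_trans (normc_le_ReIm _) _; rewrite /=.
      have : `|u - x| <= e by rewrite ler_norml; apply/andP; split; lra.
      have : `|v - y| <= e by rewrite ler_norml; apply/andP; split; lra.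
      lra.
    have := rP _ hn; rewrite addrCA subrr addr0 => h.
    rewrite /g /cauchy_kernel -/z -mulrBl -mulrBr !Normc.normcM normcN Normc.normcV.
    have -> : normc 'i = 1 by rewrite normc_sqrt/= expr0n/= expr1n add0r sqrtr1.
    rewrite mul1r ler_pdivrMr ?normc_gt0//; apply: le_trans h _.
    by rewrite ler_wpM2r ?normc_ge0// ler_norm.
  - by rewrite le_eqVlt; apply/orP; left; apply/eqP; ring.
apply/eqP; rewrite -subr_eq0 -normr_eq0 eq_le normr_ge0 andbT.
apply/ler_addgt0Pr => k k0; rewrite add0r.
pose e := Num.min (k / (8 * (`|M| + 1))) (Num.min (r / 3) (Num.min (Num.min (x - a) (b - x)) (Num.min (y - c) (d - y)))).
have M1 : 0 < 8 * (`|M| + 1) by rewrite mulr_gt0// ltr_wpDl.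
have e0 : 0 < e by rewrite /e !lt_min !subr_gt0 ax xb cy yd !divr_gt0.
have : e <= e by [].
rewrite {2}/e !le_min => /andP[ek /andP[er /andP[/andP[h1 h2] /andP[h3 h4]]]].
apply: le_trans (close e e0 _ h1 h2 h3 h4) _; first by lra.
move: ek; rewrite ler_pdivlMr//; nra.
Qed.

End CauchyFormula.

Section ContourEstimates.
Context {R : realType}.
Implicit Types (f g : R[i] -> R[i]) (z w : R[i]) (a b c d x y e : R).
Local Notation normc := (@Normc.normc R).
Local Notation Re := (@complex.Re R).
Local Notation Im := (@complex.Im R).

Lemma horizontal_norm_continuous g y a b :
  (forall x, a <= x <= b -> holo_at g (x +i* y)) ->
  continuous_on (fun x => normc (g (x +i* y))) a b.
Proof.
move=> gh x xab; apply: (@holo_at_continuous_line _ g (fun x => x +i* y)).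
- exact: normc_lipschitz.
- by move=> s; rewrite normc_sqrt/= subrr expr0n/= addr0 sqrtr_sqr.
- by apply: gh; rewrite in_itv in xab.
Qed.

Lemma vertical_norm_continuous g x a b :
  (forall y, a <= y <= b -> holo_at g (x +i* y)) ->
  continuous_on (fun y => normc (g (x +i* y))) a b.
Proof.
move=> gh y yab; apply: (@holo_at_continuous_line _ g (fun y => x +i* y)).
- exact: normc_lipschitz.
- by move=> s; rewrite normc_sqrt/= subrr expr0n/= add0r sqrtr_sqr.
- by apply: gh; rewrite in_itv in yab.
Qed.

Lemma rect_intD g f a b c d : a <= b -> c <= d ->
  holo_sides g a b c d -> holo_sides f a b c d ->
  rect_int (fun w => g w + f w) a b c d = rect_int g a b c d + rect_int f a b c d.
Proof.
move=> ab cd gh fh.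
have [g1 g2 g3 g4] := side_continuous ab cd gh.
have [f1 f2 f3 f4] := side_continuous ab cd fh.
rewrite /rect_int.
have -> : (fun t => Re (g (t +i* c) + f (t +i* c)) - Re (g (t +i* d) + f (t +i* d))) =
  (fun t => (Re (g (t +i* c)) - Re (g (t +i* d))) + (Re (f (t +i* c)) - Re (f (t +i* d)))).
  by apply/funext => t; rewrite !cReD; ring.
have -> : (fun t => Im (g (b +i* t) + f (b +i* t)) - Im (g (a +i* t) + f (a +i* t))) =
  (fun t => (Im (g (b +i* t)) - Im (g (a +i* t))) + (Im (f (b +i* t)) - Im (f (a +i* t)))).
  by apply/funext => t; rewrite !cImD; ring.
rewrite (seg_intD (continuous_onB g1 g2) (continuous_onB f1 f2)).
by rewrite (seg_intD (continuous_onB g4 g3) (continuous_onB f4 f3)); ring.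
Qed.

(** The integral of |f| over the boundary with respect to arc length. *)
Definition side_norms f a b c d : R :=
  seg_int (fun x => normc (f (x +i* c))) a b + seg_int (fun x => normc (f (x +i* d))) a b +
  (seg_int (fun y => normc (f (a +i* y))) c d + seg_int (fun y => normc (f (b +i* y))) c d).

Lemma continuous_onM (k : R) (h : R -> R) a b : continuous_on h a b ->
  continuous_on (fun x => k * h x) a b.
Proof. by move=> hc x xab; apply: cvgM; [exact: cvg_cst|exact: hc]. Qed.

Lemma continuous_onD (h k : R -> R) a b : continuous_on h a b ->
  continuous_on k a b -> continuous_on (fun x => h x + k x) a b.
Proof. by move=> hc kc x xab; apply: continuousD; [exact: hc|exact: kc]. Qed.

Lemma seg_intZ (k : R) (h : R -> R) a b : continuous_on h a b ->
  seg_int (fun x => k * h x) a b = k * seg_int h a b.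
Proof. by move=> hc; rewrite /seg_int RintegralZl//; exact: continuous_on_integrable. Qed.

Lemma rect_int_le g f a b c d (k : R) : a <= b -> c <= d -> 
  holo_sides g a b c d -> holo_sides f a b c d ->
  (forall w, rect_sides a b c d w -> normc (g w) <= k * normc (f w)) ->
  `|rect_int g a b c d| <= k * side_norms f a b c d.
Proof.
move=> ab cd gh fh gf.
have [g1 g2 g3 g4] := side_continuous ab cd gh.
have C1 : continuous_on (fun x => normc (f (x +i* c))) a b.
  by apply: horizontal_norm_continuous => x xab; apply: fh; split => //=; rewrite ?eqxx ?orbT// lexx cd.
have C2 : continuous_on (fun x => normc (f (x +i* d))) a b.
  by apply: horizontal_norm_continuous => x xab; apply: fh; split => //=; rewrite ?eqxx ?orbT// lexx cd.
have C3 : continuous_on (fun y => normc (f (a +i* y))) c d.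
  by apply: vertical_norm_continuous => y ycd; apply: fh; split => //=; rewrite ?eqxx ?orbT// lexx ab.
have C4 : continuous_on (fun y => normc (f (b +i* y))) c d.
  by apply: vertical_norm_continuous => y ycd; apply: fh; split => //=; rewrite ?eqxx ?orbT// lexx ab.
have normC h u v : continuous_on h u v -> continuous_on (fun x => `|h x|) u v.
  by move=> hc x xab; apply: (continuous_comp (hc x xab)); exact: norm_continuous.
have hor : `|seg_int (fun x => Re (g (x +i* c)) - Re (g (x +i* d))) a b| <=
    k * (seg_int (fun x => normc (f (x +i* c))) a b + seg_int (fun x => normc (f (x +i* d))) a b).
  rewrite -seg_intD// -seg_intZ; last exact: continuous_onD.
  apply: le_trans (seg_int_norm _) _; first exact: continuous_onB.
  apply: seg_int_le; first by apply: normC; exact: continuous_onB.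
    by apply: continuous_onM; exact: continuous_onD.
  move=> x; rewrite in_itv /= => xab; rewrite mulrDr; apply: le_trans (ler_normB _ _) _.
  apply: lerD; apply: le_trans (normRe_le _) _; apply: gf.
    by split => //=; rewrite ?eqxx ?orbT// lexx cd.
  by split => //=; rewrite ?eqxx ?orbT// lexx cd.
have ver : `|seg_int (fun y => Im (g (b +i* y)) - Im (g (a +i* y))) c d| <=
    k * (seg_int (fun y => normc (f (a +i* y))) c d + seg_int (fun y => normc (f (b +i* y))) c d).
  rewrite addrC -seg_intD// -seg_intZ; last exact: continuous_onD.
  apply: le_trans (seg_int_norm _) _; first exact: continuous_onB.
  apply: seg_int_le; first by apply: normC; exact: continuous_onB.
    by apply: continuous_onM; exact: continuous_onD.
  move=> x; rewrite in_itv /= => xab; rewrite mulrDr; apply: le_trans (ler_normB _ _) _.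
  apply: lerD; apply: le_trans (normIm_le _) _; apply: gf.
    by split => //=; rewrite ?eqxx ?orbT// lexx ab.
  by split => //=; rewrite ?eqxx ?orbT// lexx ab.
rewrite /rect_int /side_norms mulrDr; apply: le_trans (ler_normB _ _) _; exact: lerD.
Qed.

Lemma entireZ (k : R[i]) f : entire f -> entire (fun w => k * f w).
Proof. by move=> fe w; apply: derivableM; [exact: derivable_cst|exact: fe]. Qed.

(** Passes from real parts, all that [rect_int] provides, to moduli: the real part of -i z is Im
    z. *)
Lemma normc_le_rotations z (e : R) : 
  `|Re z| <= e -> `|Re (- 'i * z)| <= e -> normc z <= 2 * e.
Proof.
rewrite cReNiM => h1 h2; apply: le_trans (normc_le_ReIm _) _; lra.
Qed.

(* The Cauchy kernels of a second divided difference at [0], [1], [z] decay like [|w|^-3]. *)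
Lemma liouville_affine f (C r0 : R) : entire f ->
  (forall w, r0 <= normc w -> normc (f w) <= normc w + C) ->
  forall z, f z = f 0 + z * (f 1 - f 0).
Proof.
move=> fe fC z.
apply/eqP; rewrite -subr_eq0 -normc_eq0 eq_le normc_ge0 andbT.
set D := _ - _.
have Dle L : 2 * (normc z + 2) <= L -> r0 <= L -> `|C| <= L -> forall k : R[i], normc k = 1 ->
    `|Re (k * D)| <= 192 * (normc z * normc (z - 1)) / L.
  move=> Lz Lr LC k k1.
  have z0 := normc_ge0 z.
  have L0 : 0 < L by lra.
  (* The weights 1, -(1 - z), -z at z, 0, 1 reproduce D, and they combine the three simple fractions
     into z (z - 1) / (w (w - 1) (w - z)). *)
  pose g1 := cauchy_kernel (fun w => k * f w) z.
  pose g2 := cauchy_kernel (fun w => - (k * (1 - z)) * f w) 0.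
  pose g3 := cauchy_kernel (fun w => - (k * z) * f w) 1.
  have in_sq v : normc v <= normc z + 1 -> - L < Re v < L /\ - L < Im v < L.
    move=> hv; have := normRe_le v; have := normIm_le v.
    by rewrite !ler_norml => /andP[? ?] /andP[? ?]; split; apply/andP; split; lra.
  have sz : - L < Re z < L /\ - L < Im z < L by apply: in_sq; lra.
  have s0 : - L < Re (0 : R[i]) < L /\ - L < Im (0 : R[i]) < L.
    by apply: in_sq; rewrite Normc.normc0; lra.
  have s1 : - L < Re (1 : R[i]) < L /\ - L < Im (1 : R[i]) < L.
    by apply: in_sq; rewrite Normc.normc1; lra.
  have sideL w : rect_sides (-L) L (-L) L w -> L <= normc w <= 2 * L.
    move=> [/andP[h1 h2] /andP[h3 h4] h5].
    have := normRe_le w; have := normIm_le w; rewrite !ler_norml => /andP[h6 h7] /andP[h8 h9].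
    apply/andP; split; first by case/or4P: h5 => /eqP; lra.
    apply: le_trans (normc_le_ReIm _) _.
    have : `|Re w| <= L by rewrite ler_norml h1.
    have : `|Im w| <= L by rewrite ler_norml h3.
    lra.
  have side_away v w : normc v <= normc z + 1 -> rect_sides (-L) L (-L) L w -> L / 2 <= normc (w - v).
    move=> hv /sideL/andP[h _]; have := normcB_ge w v; lra.
  have side_neq v w : normc v <= normc z + 1 -> rect_sides (-L) L (-L) L w -> w != v.
    move=> hv /(side_away _ _ hv); rewrite -subr_eq0 -normc_gt0; lra.
  have hsides (k' : R[i]) v : normc v <= normc z + 1 -> holo_sides (cauchy_kernel (fun w => k' * f w) v) (-L) L (-L) L.
    move=> hv w ws; apply: holo_cauchy_kernel; first exact: entireZ.
    exact: side_neq ws.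
  have nz : normc z <= normc z + 1 by lra.
  have n0 : normc (0 : R[i]) <= normc z + 1 by rewrite Normc.normc0; lra.
  have n1 : normc (1 : R[i]) <= normc z + 1 by rewrite Normc.normc1; lra.
  have LL : - L <= L by lra.
  have hg1 : holo_sides g1 (-L) L (-L) L by exact: hsides.
  have hg2 : holo_sides g2 (-L) L (-L) L by exact: hsides.
  have hg3 : holo_sides g3 (-L) L (-L) L by exact: hsides.
  have h12 : holo_sides (fun w => g1 w + g2 w) (-L) L (-L) L.
    by move=> w ws; apply: derivableD; [exact: hg1|exact: hg2].
  have h123 : holo_sides (fun w => g1 w + g2 w + g3 w) (-L) L (-L) L.
    by move=> w ws; apply: derivableD; [exact: h12|exact: hg3].
  have sum : rect_int (fun w => (g1 w + g2 w) + g3 w) (-L) L (-L) L = 2 * pi * Re (k * D).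
    rewrite (rect_intD LL LL h12 hg3) (rect_intD LL LL hg1 hg2).
    rewrite (cauchy_formula (@entireZ k f fe) sz.1 sz.2).
    rewrite (cauchy_formula (@entireZ (- (k * (1 - z))) f fe) s0.1 s0.2).
    rewrite (cauchy_formula (@entireZ (- (k * z)) f fe) s1.1 s1.2).
    rewrite -!mulrDr -!cReD; congr (_ * Re _); rewrite /D; ring.
  (* On the sides |f| <= 3L and the three distances are at least L / 2, so the integrand is at most
     24 |z (z - 1)| / L^2. The comparison function is 0, written as an affine function so that its
     integral is known. *)
  have bound : `|rect_int (fun w => (g1 w + g2 w) + g3 w) (-L) L (-L) L - rect_int (fun w => 0 + 0 * (w - 0)) (-L) L (-L) L|
      <= 2 * (24 * (normc z * normc (z - 1)) / L ^+ 2) * ((L - - L) + (L - - L)).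
    apply: (rect_int_dist LL LL h123).
    - by move=> w _; exact: holo_at_affine.
    - move=> w ws; rewrite mul0r addr0 subr0.
      have w0 : w - 0 != 0 by rewrite subr_eq0; exact: side_neq ws.
      have w1 : w - 1 != 0 by rewrite subr_eq0; exact: side_neq ws.
      have wz : w - z != 0 by rewrite subr_eq0; exact: side_neq ws.
      have -> : g1 w + g2 w + g3 w = - 'i * k * f w * (z * (z - 1)) / ((w - 0) * (w - 1) * (w - z)).
        by rewrite /g1 /g2 /g3 /cauchy_kernel; field; rewrite wz w1; rewrite subr0 in w0; rewrite w0.
      rewrite !Normc.normcM Normc.normcV !Normc.normcM normcN k1.
      have -> : normc 'i = 1 by rewrite normc_sqrt/= expr0n/= expr1n add0r sqrtr1.
      rewrite !mul1r.
      have d0 := side_away _ _ n0 ws; have d1 := side_away _ _ n1 ws; have dz := side_away _ _ nz ws.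
      have /andP[wL wL2] := sideL _ ws.
      have fw : normc (f w) <= 3 * L.
        apply: le_trans (fC w (le_trans Lr wL)) _; have := ler_norm C; lra.
      have L2 : 0 < L / 2 by lra.
      have den : (L / 2) ^+ 3 <= normc (w - 0) * normc (w - 1) * normc (w - z).
        have L2' := ltW L2.
        rewrite exprSr expr2; apply: ler_pM => //; first exact: mulr_ge0.
        exact: ler_pM.
      have zz : 0 <= normc z * normc (z - 1) by rewrite mulr_ge0 ?normc_ge0.
      rewrite ler_pdivrMr; last by apply: lt_le_trans den; rewrite exprn_gt0.
      apply: (@le_trans _ _ (3 * L * (normc z * normc (z - 1)))); first by rewrite ler_wpM2r.
      apply: (@le_trans _ _ (24 * (normc z * normc (z - 1)) / L ^+ 2 * (L / 2) ^+ 3)).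
        by rewrite le_eqVlt; apply/orP; left; apply/eqP; field; rewrite gt_eqF.
      by rewrite ler_wpM2l// divr_ge0 ?exprn_ge0 ?(ltW L0)// mulr_ge0.
  move: bound; rewrite rect_int_affine// subr0 sum !normrM (ger0_norm (pi_ge0 R)) ger0_norm// => bound.
  have pi1 : 2 <= (pi : R) by exact: pi_ge2.
  apply: (@le_trans _ _ (2 * pi * `|Re (k * D)|)).
    by rewrite ler_peMl//; lra.
  apply: le_trans bound _; rewrite le_eqVlt; apply/orP; left; apply/eqP; field; exact: lt0r_neq0.
apply/ler_addgt0Pr => e e0; rewrite add0r.
set K := normc z * normc (z - 1) in Dle.
have K0 : 0 <= K by rewrite mulr_ge0 ?normc_ge0.
(* Since 384 = 2 * 192, each real part is at most e / 2, and [normc_le_rotations] doubles this. *)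
pose L := Num.max (Num.max (2 * (normc z + 2)) r0) (Num.max `|C| (384 * K / e + 1)).
have : L <= L by [].
rewrite {1}/L !ge_max => /andP[/andP[h1 h2] /andP[h3 h4]].
have L0 : 0 < L by have := normc_ge0 z; lra.
have Le : 192 * K / L <= e / 2.
  rewrite ler_pdivrMr//.
  have : 384 * K / e <= L by lra.
  by rewrite ler_pdivrMr//; lra.
have -> : e = 2 * (e / 2) by field.
apply: normc_le_rotations.
  by have := Dle L h1 h2 h3 1 (Normc.normc1 R); rewrite mul1r; move/le_trans; apply.
have i1 : normc (- 'i : R[i]) = 1 by rewrite normcN normc_sqrt/= expr0n/= expr1n add0r sqrtr1.
exact: le_trans (Dle L h1 h2 h3 _ i1) Le.
Qed.

End ContourEstimates.

(** * Pointwise estimates in Fock spaces *)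

Section CaratheodoryMeasurability.
Context {R : realType}.

(** Rounding the first variable down to multiples of 1 / (n + 1) gives functions whose preimages are
    countable unions of measurable rectangles. By continuity in x they converge to F. *)
Lemma measurable_fun_caratheodory (F : R * R -> R) :
  (forall y, continuous (fun x => F (x, y))) ->
  (forall x, measurable_fun setT (fun y => F (x, y))) ->
  measurable_fun setT F.
Proof.
move=> Fc Fm.
pose q (n : nat) (x : R) : R := (Num.floor (n.+1%:R * x))%:~R / n.+1%:R.
apply: (@measurable_fun_cvg _ _ _ setT (fun n w => F (q n w.1, w.2)) F).
- move=> n _ B mB; rewrite setTI.
  have -> : (fun w => F (q n w.1, w.2)) @^-1` B =
      \bigcup_(k : int) ([set x | Num.floor (n.+1%:R * x) = k] `*`
        ((fun y => F (k%:~R / n.+1%:R, y)) @^-1` B)).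
    apply/seteqP; split => [[x y] Bxy|[x y] [k _ [/= xk Bky]]].
      by exists (Num.floor (n.+1%:R * x)).
    by rewrite /q /= xk.
  apply: countable_bigcupT_measurable => [|k]; first exact: countableP.
  apply: measurableX.
    have -> : [set x : R | Num.floor (n.+1%:R * x) = k] =
       `[k%:~R / n.+1%:R, (k + 1)%:~R / n.+1%:R[%classic.
      have n0 : 0 < n.+1%:R :> R by rewrite ltr0n.
      apply/seteqP; split => x /=; rewrite in_itv/= ler_pdivrMr// ltr_pdivlMr// [x * _]mulrC.
        by move=> <-; exact: floor_itv.
      by move=> /floor_def.
    exact: measurable_itv.
  by have := Fm (k%:~R / n.+1%:R) measurableT B mB; rewrite setTI.
- move=> [x y] _ /=.
  apply: (@cvg_comp _ _ _ (fun n => q n x) (fun t => F (t, y)) \oo (nbhs x)); last exact: Fc.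
  apply/cvgrPdist_le => e e0.
  near=> n.
  have n0 : 0 < n.+1%:R :> R by rewrite ltr0n.
  have /andP[h1 h2] : (Num.floor (n.+1%:R * x))%:~R <= n.+1%:R * x < (Num.floor (n.+1%:R * x) + 1)%:~R.
    exact: floor_itv.
  have -> : x - q n x = (n.+1%:R * x - (Num.floor (n.+1%:R * x))%:~R) / n.+1%:R.
    by rewrite /q; field; rewrite gt_eqF.
  rewrite intrD in h2.
  rewrite ger0_norm; last by rewrite divr_ge0 ?subr_ge0// ltW.
  apply: (@le_trans _ _ n.+1%:R^-1).
    by rewrite ler_pdivrMr// mulVf ?gt_eqF// lerBlDr addrC ltW.
  by apply: ltW; near: n; exact: (near_infty_natSinv_lt (PosNum e0)).
Unshelve. all: by end_near. Qed.

End CaratheodoryMeasurability.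

Section LineSelection.
Context {R : realType}.
Local Notation mu := (@lebesgue_measure R).

(** If G exceeded 2 / (v - u) on the whole of [u, v], its integral would be at least 2. Applied to
    the partial integrals of Tonelli's theorem. *)
Lemma small_partial_integral (G : R -> \bar R) (u v : R) : u < v ->
  measurable_fun setT G -> (forall t, 0 <= G t)%E ->
  (\int[mu]_t G t <= 1)%E ->
  exists2 t, u <= t <= v & (G t <= (2 / (v - u))%:E)%E.
Proof.
move=> uv mG G0 G1; apply: contrapT => none.
have vu : 0 < v - u by rewrite subr_gt0.
have : (\int[mu]_(t in `[u, v]) (2 / (v - u))%:E <= 1)%E.
  apply: le_trans G1.
  apply: (@le_trans _ _ (\int[mu]_(t in `[u, v]) G t)%E).
    apply: ge0_le_integral => //.
    - by move=> t _; rewrite lee_fin divr_ge0// ltW.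
    - exact: measurable_funTS.
    - move=> t /=; rewrite in_itv/= => tuv; rewrite leNgt; apply/negP => Gt.
      by apply: none; exists t => //; exact: ltW.
  exact: ge0_subset_integral.
rewrite integral_cst//= lebesgue_measure_itv/= lte_fin uv -EFinD -EFinM lee_fin.
by rewrite divfK ?gt_eqF// lern1.
Qed.

Variable H : R * R -> R.
Hypotheses (mH : measurable_fun setT H) (H0 : forall w, 0 <= H w).
Hypothesis H1 : (\int[mu \x mu]_w (H w)%:E <= 1)%E.

Let mHE : measurable_fun setT (fun w => (H w)%:E).
Proof. exact/measurable_EFinP. Qed.

Lemma good_horizontal (u v : R) : u < v -> exists2 c : R, u <= c <= v &
  measurable_fun setT (fun x => H (x, c)) /\
  (\int[mu]_x (H (x, c))%:E <= (2 / (v - u))%:E)%E.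
Proof.
move=> uv.
have /= [//|//| |c cuv cle] := @small_partial_integral (fubini_G mu (fun w => (H w)%:E)) u v uv.
- exact: measurable_fun_fubini_tonelli_G.
- by move=> t; apply: integral_ge0 => x _; rewrite lee_fin.
- by rewrite -fubini_tonelli2// => w; rewrite lee_fin.
exists c => //; split => //.
by apply: measurableT_comp mH _; exact: measurable_pair2.
Qed.

Lemma good_vertical (u v : R) : u < v -> exists2 c : R, u <= c <= v &
  measurable_fun setT (fun y => H (c, y)) /\
  (\int[mu]_y (H (c, y))%:E <= (2 / (v - u))%:E)%E.
Proof.
move=> uv.
have /= [//|//| |c cuv cle] := @small_partial_integral (fubini_F mu (fun w => (H w)%:E)) u v uv.
- exact: measurable_fun_fubini_tonelli_F.
- by move=> t; apply: integral_ge0 => x _; rewrite lee_fin.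
- by rewrite -fubini_tonelli1// => w; rewrite lee_fin.
exists c => //; split => //.
by apply: measurableT_comp mH _; exact: measurable_pair1.
Qed.

End LineSelection.

Section LineIntegralBound.
Context {R : realType}.
Local Notation mu := (@lebesgue_measure R).

Lemma seg_int_le_integral (h H : R -> R) (a b M K : R) : a <= b ->
  continuous_on h a b -> (forall t, 0 <= h t) -> measurable_fun setT H ->
  (forall t, 0 <= H t) -> (\int[mu]_t (H t)%:E <= K%:E)%E -> 0 <= M ->
  {in `[a, b], forall t, h t <= M + M * H t} ->
  seg_int h a b <= M * (b - a) + M * K.
Proof.
move=> ab hc h0 mH H0 HK M0 hH.
have hi := continuous_on_integrable hc.
rewrite -lee_fin /seg_int /Rintegral fineK; last exact: integrable_fin_num.
have mHE : measurable_fun (`[a, b] : set R) (fun t => (H t)%:E).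
  by apply/measurable_EFinP; exact: measurable_funTS.
have mMHE : measurable_fun (`[a, b] : set R) (fun t => (M%:E * (H t)%:E)%E).
  by apply: emeasurable_funM => //; exact: measurable_cst.
apply: (@le_trans _ _ (\int[mu]_(t in `[a, b]) (M%:E + M%:E * (H t)%:E))%E).
  apply: ge0_le_integral => //.
  - by move=> t _; rewrite lee_fin.
  - by case/integrableP : hi.
  - by apply: emeasurable_funD => //; exact: measurable_cst.
rewrite ge0_integralD//; last by move=> t _; rewrite -EFinM lee_fin mulr_ge0.
rewrite ge0_integralZl//; last by move=> t _; rewrite lee_fin.
rewrite EFinD; apply: leeD.
  rewrite integral_cst//= lebesgue_measure_itv/= lte_fin.
  move: ab; rewrite le_eqVlt => /predU1P[->|->].
    by rewrite ltxx mule0 subrr mulr0.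
  by rewrite -EFinD -EFinM.
rewrite EFinM; apply: lee_wpmul2l; first by rewrite lee_fin.
apply: le_trans HK; apply: ge0_subset_integral => //.
  exact/measurable_EFinP.
by move=> t _; rewrite lee_fin.
Qed.

End LineIntegralBound.

(** * Pointwise and Lipschitz bounds on the unit ball *)

Section LocalEstimates.
Context {R : realType}.
Variables (phi : R -> R) (p : R).
Hypotheses (p1 : 1 <= p) (phi_cont : continuous (fun r : R => phi `|r|)).
Hypothesis phi_mono : forall r s : R, 0 <= r -> r <= s -> phi r <= phi s.
Implicit Types (f g : R[i] -> R[i]) (z w : R[i]).
Local Notation mu := (@lebesgue_measure R).
Local Notation normc := (@Normc.normc R).
Local Notation Re := (@complex.Re R).
Local Notation Im := (@complex.Im R).

Definition fock_density f (w : R * R) : R :=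
  normc (f (w.1 +i* w.2)) `^ p * expR (- (p * radial_ext phi (w.1 +i* w.2))).

Lemma fock_integralE f : fock_integral phi p f = (\int[mu \x mu]_w (fock_density f w)%:E)%E.
Proof. by []. Qed.

Lemma fock_density_ge0 f (w : R * R) : 0 <= fock_density f w.
Proof. by rewrite mulr_ge0 ?powR_ge0 ?expR_ge0. Qed.

Lemma entire_normc_horizontal f y : entire f -> continuous (fun x => normc (f (x +i* y))).
Proof.
move=> fe x; apply: (@horizontal_norm_continuous _ f y x x) => [t _|]; first exact: fe.
by rewrite in_itv/= lexx.
Qed.

Lemma entire_normc_vertical f x : entire f -> continuous (fun y => normc (f (x +i* y))).
Proof.
move=> fe y; apply: (@vertical_norm_continuous _ f x y y) => [t _|]; first exact: fe.
by rewrite in_itv/= lexx.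
Qed.

Lemma entire_id : entire (fun w : R[i] => w).
Proof. by move=> w; exact: derivable_id. Qed.

Lemma measurable_entire_normc f : entire f ->
  measurable_fun setT (fun w : R * R => normc (f (w.1 +i* w.2))).
Proof.
move=> fe; apply: measurable_fun_caratheodory => [y|x] /=.
  exact: entire_normc_horizontal.
by apply: continuous_measurable_fun; exact: entire_normc_vertical.
Qed.

Lemma measurable_weight :
  measurable_fun setT (fun w : R * R => radial_ext phi (w.1 +i* w.2)).
Proof.
have -> : (fun w : R * R => radial_ext phi (w.1 +i* w.2)) =
    (fun r : R => phi `|r|) \o (fun w : R * R => normc (w.1 +i* w.2)).
  by apply/funext => w /=; rewrite /radial_ext ger0_norm// normc_ge0.
apply: measurableT_comp; first exact: continuous_measurable_fun.
exact: (measurable_entire_normc entire_id).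
Qed.

Lemma measurable_fock_density f : entire f -> measurable_fun setT (fock_density f).
Proof.
move=> fe; apply: measurable_funM.
  apply: (@measurableT_comp _ _ _ _ _ _ (fun x : R => x `^ p)); first exact: measurable_powR.
  exact: measurable_entire_normc.
apply: measurableT_comp; first exact: measurable_expR.
apply: measurableT_comp; first exact: oppr_measurable.
by apply: measurable_funM; [exact: measurable_cst|exact: measurable_weight].
Qed.

Lemma powR_expR (u q : R) : expR u `^ q = expR (q * u).
Proof. by rewrite /powR gt_eqF ?expR_gt0// expRK. Qed.

(** Makes the p-th power linear: with M = exp(phi r), either t <= M, or t / M <= (t / M)^p because p
    >= 1, and M^-p <= exp(- p phi |w|) by monotonicity. *)
Lemma pointwise_le_density f (w : R * R) (r : R) : normc (w.1 +i* w.2) <= r ->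
  normc (f (w.1 +i* w.2)) <= expR (phi r) + expR (phi r) * fock_density f w.
Proof.
move=> wr; set M := expR _; set t := normc _.
have M0 : 0 < M by rewrite expR_gt0.
have [tM|/ltW Mt] := leP t M.
  by apply: le_trans tM _; rewrite lerDl; apply: mulr_ge0; [exact: ltW|exact: fock_density_ge0].
rewrite -[leLHS]add0r lerD ?(ltW M0)//.
have t0 : 0 <= t by exact: normc_ge0.
rewrite mulrC -ler_pdivrMr//.
apply: (@le_trans _ _ ((t / M) `^ p)).
  by apply: le1r_powR => //; rewrite ler_pdivlMr// mul1r.
rewrite powRM ?invr_ge0 ?(ltW M0)// /fock_density -/t ler_wpM2l ?powR_ge0//.
rewrite /M -expRN powR_expR ler_expR mulrN lerN2 ler_wpM2l ?(le_trans ler01)//.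
by apply: phi_mono => //; exact: normc_ge0.
Qed.

(** Each side is selected in a strip of width e / 2, so the density has integral at most 4 / e along
    it. The strips stay e / 2 away from z, which keeps the Cauchy kernels bounded. Four sides of
    length at most 2e give 4 (2e + 4 / e) = 8 (e + 2 / e). *)
Lemma small_side_norms f z (e : R) : entire f -> (fock_integral phi p f <= 1)%E ->
  0 < e -> exists a b c d,
  [/\ Re z - e <= a <= Re z - e / 2, Re z + e / 2 <= b <= Re z + e,
      Im z - e <= c <= Im z - e / 2, Im z + e / 2 <= d <= Im z + e &
  side_norms f a b c d <= 8 * (e + 2 / e) * expR (phi (normc z + 2 * e))].
Proof.
case: z => x y fe f1 e0 /=; set z := x +i* y.
have mD := measurable_fock_density fe.
have D0 := fock_density_ge0 f.
have [a /andP[a1 a2] [ma Ia]] := @good_vertical _ _ mD D0 f1 (x - e) (x - e / 2) ltac:(lra).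
have [b /andP[b1 b2] [mb Ib]] := @good_vertical _ _ mD D0 f1 (x + e / 2) (x + e) ltac:(lra).
have [c /andP[c1 c2] [mc Ic]] := @good_horizontal _ _ mD D0 f1 (y - e) (y - e / 2) ltac:(lra).
have [d /andP[d1 d2] [md Id]] := @good_horizontal _ _ mD D0 f1 (y + e / 2) (y + e) ltac:(lra).
exists a, b, c, d; rewrite a1 a2 b1 b2 c1 c2 d1 d2; split => //.
set M := expR _.
have M0 : 0 <= M by exact: expR_ge0.
have E1 : 2 / (x - e / 2 - (x - e)) = 4 / e by field; rewrite gt_eqF//=; lra.
have E2 : 2 / (x + e - (x + e / 2)) = 4 / e by field; rewrite gt_eqF//=; lra.
have E3 : 2 / (y - e / 2 - (y - e)) = 4 / e by field; rewrite gt_eqF//=; lra.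
have E4 : 2 / (y + e - (y + e / 2)) = 4 / e by field; rewrite gt_eqF//=; lra.
rewrite E1 in Ia; rewrite E2 in Ib; rewrite E3 in Ic; rewrite E4 in Id.
have inz u v : x - e <= u <= x + e -> y - e <= v <= y + e -> normc (u +i* v) <= normc z + 2 * e.
  move=> /andP[u1 u2] /andP[v1 v2].
  have -> : u +i* v = z + ((u - x) +i* (v - y)).
    by rewrite /z; congr (_ +i* _); rewrite addrC subrK.
  apply: le_trans (le_normcD _ _) _; rewrite lerD2l; apply: le_trans (normc_le_ReIm _) _; rewrite /=.
  have : `|u - x| <= e by rewrite ler_norml; apply/andP; split; lra.
  have : `|v - y| <= e by rewrite ler_norml; apply/andP; split; lra.
  lra.
have B1 : seg_int (fun x => normc (f (x +i* c))) a b <= M * (b - a) + M * (4 / e).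
  apply: seg_int_le_integral mc _ Ic _ _ => //; [lra| | |].
  - by move=> t _; exact: entire_normc_horizontal.
  - by move=> t; exact: normc_ge0.
  - move=> t; rewrite in_itv /= => /andP[t1 t2].
    by apply: (@pointwise_le_density f (t, c)); apply: (inz t c); apply/andP; split; lra.
have B2 : seg_int (fun x => normc (f (x +i* d))) a b <= M * (b - a) + M * (4 / e).
  apply: seg_int_le_integral md _ Id _ _ => //; [lra| | |].
  - by move=> t _; exact: entire_normc_horizontal.
  - by move=> t; exact: normc_ge0.
  - move=> t; rewrite in_itv /= => /andP[t1 t2].
    by apply: (@pointwise_le_density f (t, d)); apply: (inz t d); apply/andP; split; lra.
have B3 : seg_int (fun y => normc (f (a +i* y))) c d <= M * (d - c) + M * (4 / e).
  apply: seg_int_le_integral ma _ Ia _ _ => //; [lra| | |].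
  - by move=> t _; exact: entire_normc_vertical.
  - by move=> t; exact: normc_ge0.
  - move=> t; rewrite in_itv /= => /andP[t1 t2].
    by apply: (@pointwise_le_density f (a, t)); apply: (inz a t); apply/andP; split; lra.
have B4 : seg_int (fun y => normc (f (b +i* y))) c d <= M * (d - c) + M * (4 / e).
  apply: seg_int_le_integral mb _ Ib _ _ => //; [lra| | |].
  - by move=> t _; exact: entire_normc_vertical.
  - by move=> t; exact: normc_ge0.
  - move=> t; rewrite in_itv /= => /andP[t1 t2].
    by apply: (@pointwise_le_density f (b, t)); apply: (inz b t); apply/andP; split; lra.
have ba : M * (b - a) <= M * (2 * e) by rewrite ler_wpM2l//; lra.
have dc : M * (d - c) <= M * (2 * e) by rewrite ler_wpM2l//; lra.
rewrite /side_norms (_ : 8 * _ * _ = 4 * (M * (2 * e) + M * (4 / e))); last by field; rewrite gt_eqF.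
lra.
Qed.

End LocalEstimates.

Section PointEstimates.
Context {R : realType}.
Variables (phi : R -> R) (p : R).
Hypotheses (p1 : 1 <= p) (phi_cont : continuous (fun r : R => phi `|r|)).
Hypothesis phi_mono : forall r s : R, 0 <= r -> r <= s -> phi r <= phi s.
Implicit Types (f g : R[i] -> R[i]) (z w : R[i]).
Local Notation normc := (@Normc.normc R).
Local Notation Re := (@complex.Re R).
Local Notation Im := (@complex.Im R).

Lemma normc_i : normc 'i = 1.
Proof. by rewrite normc_sqrt/= expr0n/= expr1n add0r sqrtr1. Qed.

(** The value is one Cauchy integral, with kernel at most 4 / e. The increment is a difference of
    two, with kernel (v - z) / ((w - v) (w - z)) and bound 16 |v - z| / e^2. Adding both constants
    gives one [C] for both estimates. *)
Lemma fock_point_le (e : R) : 0 < e -> exists2 C : R, 0 < C &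
  forall f z, entire f -> (fock_integral phi p f <= 1)%E ->
    normc (f z) <= C * expR (phi (normc z + 2 * e)) /\
    forall v, normc (v - z) <= e / 4 ->
      normc (f v - f z) <= C * normc (v - z) * expR (phi (normc z + 2 * e)).
Proof.
move=> e0; set S := 8 * (e + 2 / e).
have S0 : 0 < S by rewrite mulr_gt0// addr_gt0// divr_gt0.
exists (2 * (16 / e ^+ 2 + 4 / e) * S).
  by rewrite mulr_gt0// mulr_gt0// addr_gt0 ?divr_gt0// exprn_gt0.
move=> f z fe f1.
have [a [b [c [d [az bz cz dz]]]]] := small_side_norms p1 phi_cont phi_mono z fe f1 e0.
set M := expR _; set N := side_norms _ _ _ _ _; rewrite -/S => NS.
case/andP: az => a1 a2; case/andP: bz => b1 b2; case/andP: cz => c1 c2; case/andP: dz => d1 d2.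
have ab : a <= b by lra.
have cd : c <= d by lra.
have e4 : 0 < e / 4 by rewrite divr_gt0.
(* The sides are at distance at least e / 2 from z, so a displacement of e / 4 leaves room e / 4. *)
have away v w : normc (v - z) <= e / 4 -> rect_sides a b c d w -> e / 4 <= normc (w - v).
  move=> vz [/andP[h1 h2] /andP[h3 h4] h5].
  suff : e / 2 <= normc (w - z).
    have -> : w - v = (w - z) - (v - z) by ring.
    have := normcB_ge (w - z) (v - z); lra.
  have := normRe_le (w - z); have := normIm_le (w - z).
  rewrite cReB cImB !ler_norml => /andP[h6 h7] /andP[h8 h9].
  by case/or4P: h5 => /eqP; lra.
have inside v : normc (v - z) <= e / 4 -> a < Re v < b /\ c < Im v < d.
  move=> vz; have := normRe_le (v - z); have := normIm_le (v - z).
  rewrite cReB cImB !ler_norml => /andP[h6 h7] /andP[h8 h9].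
  by split; apply/andP; split; lra.
have ker_holo (k : R[i]) v : normc (v - z) <= e / 4 ->
    holo_sides (cauchy_kernel (fun w => k * f w) v) a b c d.
  move=> vz w ws; apply: holo_cauchy_kernel; first exact: (@entireZ _ k f fe).
  by rewrite -subr_eq0 -normc_gt0; apply: lt_le_trans (away _ _ vz ws).
have f_holo : holo_sides f a b c d by move=> w _; exact: fe.
have pi4 : 4 <= 2 * (pi : R) by have := pi_ge2 R; lra.
have pi_div (x K : R) : `|2 * pi * x| <= K -> `|x| <= K.
  by apply: le_trans; rewrite normrM ger0_norm ?mulr_ge0 ?pi_ge0// ler_peMl//; lra.
have zz : normc (z - z) <= e / 4 by rewrite subrr Normc.normc0 ltW.
have N0 : 0 <= N by rewrite !addr_ge0//; apply: Rintegral_ge0 => t _; exact: normc_ge0.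
have M0 : 0 <= M by exact: expR_ge0.
have point (k : R[i]) : normc k = 1 -> `|Re (k * f z)| <= 4 / e * N.
  move=> k1; apply: pi_div; have [h1 h2] := inside z zz.
  rewrite -(cauchy_formula (@entireZ _ k f fe) h1 h2).
  apply: (rect_int_le ab cd (ker_holo k z zz) f_holo) => w ws.
  rewrite /cauchy_kernel !Normc.normcM Normc.normcV normcN normc_i k1 !mul1r mulrC.
  rewrite ler_wpM2r ?normc_ge0//.
  by rewrite -[4 / e]invf_div lef_pV2 ?posrE//; [exact: away|apply: lt_le_trans (away _ _ zz ws)].
split.
  apply: (@le_trans _ _ (2 * (4 / e * N))).
    by apply: normc_le_rotations; [rewrite -[f z]mul1r; apply: point; exact: Normc.normc1|
      apply: point; rewrite normcN normc_i].
  have -> : 2 * (16 / e ^+ 2 + 4 / e) * S * M =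
     2 * (16 / e ^+ 2 * (S * M)) + 2 * (4 / e * (S * M)) by ring.
  rewrite -[leLHS]add0r; apply: lerD.
    apply: mulr_ge0 => //; apply: mulr_ge0; last by apply: mulr_ge0 => //; exact: ltW.
    by rewrite divr_ge0// exprn_ge0// ltW.
  by rewrite ler_wpM2l// ler_wpM2l// divr_ge0// ltW.
move=> v vz.
have diff (k : R[i]) : normc k = 1 -> `|Re (k * (f v - f z))| <= 16 / e ^+ 2 * normc (v - z) * N.
  move=> k1; apply: pi_div; have [h1 h2] := inside z zz; have [h3 h4] := inside v vz.
  have g1 := ker_holo k v vz; have g2 := ker_holo (- k) z zz.
  have -> : k * (f v - f z) = k * f v + - k * f z by ring.
  rewrite cReD mulrDr -(cauchy_formula (@entireZ _ k f fe) h3 h4) -(cauchy_formula (@entireZ _ (- k) f fe) h1 h2).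
  rewrite -(rect_intD ab cd g1 g2).
  apply: (rect_int_le ab cd _ f_holo) => [w ws|w ws].
    by apply: derivableD; [exact: g1|exact: g2].
  have dv := away _ _ vz ws; have dz := away _ _ zz ws.
  have wv : w - v != 0 by rewrite -normc_gt0; apply: lt_le_trans dv.
  have wz : w - z != 0 by rewrite -normc_gt0; apply: lt_le_trans dz.
  have -> : cauchy_kernel (fun w => k * f w) v w + cauchy_kernel (fun w => - k * f w) z w =
      - 'i * k * (v - z) / ((w - v) * (w - z)) * f w.
    by rewrite /cauchy_kernel; field; rewrite wv wz.
  rewrite Normc.normcM ler_wpM2r ?normc_ge0//.
  rewrite !Normc.normcM Normc.normcV Normc.normcM normcN normc_i k1 !mul1r.
  rewrite mulrC ler_wpM2r ?normc_ge0//.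
  have -> : 16 / e ^+ 2 = ((e / 4) * (e / 4))^-1 by field; rewrite gt_eqF.
  have le4 := ltW e4.
  rewrite lef_pV2 ?posrE ?mulr_gt0//; [exact: ler_pM|exact: lt_le_trans dv|exact: lt_le_trans dz].
apply: (@le_trans _ _ (2 * (16 / e ^+ 2 * normc (v - z) * N))).
  by apply: normc_le_rotations; [rewrite -[f v - f z]mul1r; apply: diff; exact: Normc.normc1|
    apply: diff; rewrite normcN normc_i].
have -> : 2 * (16 / e ^+ 2 + 4 / e) * S * normc (v - z) * M =
   2 * (16 / e ^+ 2 * normc (v - z) * (S * M)) + 2 * (4 / e * normc (v - z) * (S * M)) by ring.
rewrite -[leLHS]addr0; apply: lerD.
  rewrite ler_wpM2l// ler_wpM2l//; apply: mulr_ge0; last exact: normc_ge0.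
  by rewrite divr_ge0// exprn_ge0// ltW.
apply: mulr_ge0 => //; apply: mulr_ge0; last by apply: mulr_ge0 => //; exact: ltW.
by apply: mulr_ge0; [rewrite divr_ge0// ltW|exact: normc_ge0].
Qed.

End PointEstimates.

(** * Admissible weights *)

Section RealDerivatives.
Context {R : realType}.
Implicit Types (f g : R -> R) (r s l : R).

Lemma is_derive_difference_quotient f r l :
  (forall e, 0 < e -> exists2 d : R, 0 < d & forall s, s != r -> `|s - r| < d ->
     `|(f s - f r) / (s - r) - l| <= e) -> is_derive r (1 : R) f l.
Proof.
move=> fl.
have cl : h^-1 *: (f (h *: (1 : R) + r) - f r) @[h --> 0^'] --> l.
  apply/cvgrPdist_le => e e0; have [d d0 dP] := fl e e0.
  near=> h.
  have h0 : h != 0 by near: h; exact: nbhs_dnbhs_neq.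
  have := dP (h + r); rewrite addrK /GRing.scale/= mulr1 distrC mulrC; apply.
    by rewrite -subr_eq0 addrK.
  near: h; apply: dnbhs0_lt => //.
by split; [apply/cvg_ex; exists l|exact: cvg_lim].
Unshelve. all: by end_near. Qed.

Lemma has_deriv_ge0P f r l : 0 <= r -> has_deriv_ge0 f r l ->
  forall e, 0 < e -> exists2 d : R, 0 < d & forall s, 0 <= s -> s != r -> `|s - r| < d ->
    `|(f s - f r) / (s - r) - l| <= e.
Proof.
move=> r0 /cvgrPdist_le fl e e0.
have := fl e e0; rewrite near_withinE => /nbhs_ballP[d /= d0 dP]; exists d => // s s0 sr sd.
by rewrite distrC; apply: dP => //; rewrite /ball/= distrC.
Qed.

Lemma has_deriv_ge0_is_derive f r l : 0 < r -> has_deriv_ge0 f r l ->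
  is_derive r (1 : R) f l.
Proof.
move=> r0 /(has_deriv_ge0P (ltW r0)) fl; apply: is_derive_difference_quotient => e e0.
have [d d0 dP] := fl e e0; exists (Num.min d r); first by rewrite lt_min d0.
move=> s sr; rewrite lt_min => /andP[sd]; rewrite ltr_norml => /andP[h _].
by apply: dP => //; lra.
Qed.

(** Extracts from a possibly one-sided derivative what is needed at the origin, where no two-sided
    derivative is at hand. *)
Lemma has_deriv_ge0_lipschitz f r l : 0 <= r -> has_deriv_ge0 f r l ->
  exists2 B : R, 0 <= B & exists2 d : R, 0 < d & forall s, 0 <= s -> `|s - r| < d ->
    `|f s - f r| <= B * `|s - r|.
Proof.
move=> r0 /(has_deriv_ge0P r0)/(_ 1 ltr01)[d d0 dP]; exists (1 + `|l|); first exact: addr_ge0.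
exists d => // s s0 sd.
have [->|sr] := eqVneq s r; first by rewrite !subrr normr0 mulr0.
have := dP s s0 sr sd.
rewrite -ler_pdivrMr ?normr_gt0 ?subr_eq0// -normf_div => h.
have := ler_normD ((f s - f r) / (s - r) - l) l; rewrite subrK; lra.
Qed.

Lemma nondecreasing_derive g (g' : R -> R) (a b : R) : a <= b ->
  (forall x, a <= x <= b -> is_derive x (1 : R) g (g' x)) ->
  (forall x, a <= x <= b -> 0 <= g' x) -> g a <= g b.
Proof.
move=> ab dg g0.
have [x||c cab E] := @MVT_segment _ g g' a b ab.
- by rewrite in_itv/= => /andP[/ltW ax /ltW xb]; apply: dg; rewrite ax xb.
- apply: continuous_in_subspaceT => x; rewrite inE/= in_itv/= => xab.
  apply: differentiable_continuous; apply/derivable1_diffP.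
  by have [] := dg x xab.
- by rewrite -subr_ge0 E mulr_ge0 ?subr_ge0//; apply: g0; rewrite in_itv in cab.
Qed.

End RealDerivatives.

(** * Monotonicity, logarithmic convexity and growth of the weight *)

Section WeightAnalysis.
Context {R : realType}.
Variable phi : R -> R.
Variables f1 f2 : R -> R.
Hypothesis phi1 : forall r : R, 0 <= r -> has_deriv_ge0 phi r (f1 r).
Hypothesis phi2 : forall r : R, 0 <= r -> has_deriv_ge0 f1 r (f2 r).

Let dphi (r : R) : 0 < r -> is_derive r (1 : R) phi (f1 r).
Proof. by move=> r0; exact: has_deriv_ge0_is_derive (phi1 (ltW r0)). Qed.

Let df1 (r : R) : 0 < r -> is_derive r (1 : R) f1 (f2 r).
Proof. by move=> r0; exact: has_deriv_ge0_is_derive (phi2 (ltW r0)). Qed.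

Lemma weight_continuous : continuous (fun r : R => phi `|r|).
Proof.
move=> r; have [B B0 [d d0 dP]] := has_deriv_ge0_lipschitz (normr_ge0 r) (phi1 (normr_ge0 r)).
apply/cvgrPdist_le => e e0.
near=> s.
have : `|s - r| < Num.min d (e / (B + 1)).
  by rewrite distrC; near: s; apply/nbhs_ballP; exists (Num.min d (e / (B + 1))) => //=;
    rewrite lt_min d0 divr_gt0// ltr_wpDl.
rewrite lt_min => /andP[sd se].
have ab := ler_dist_dist s r.
rewrite distrC; apply: le_trans (dP _ (normr_ge0 s) (le_lt_trans ab sd)) _.
apply: (@le_trans _ _ (B * `|s - r|)); first exact: ler_wpM2l.
move: se; rewrite ltr_pdivlMr ?ltr_wpDl// mulrDr mulr1 => /ltW; apply: le_trans.
by rewrite mulrC lerDl.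
Unshelve. all: by end_near. Qed.

Lemma laplacian_radial (r : R) : 0 < r ->
  laplacian (radial_ext phi) r%:C = f2 r + f1 r / r.
Proof.
move=> r0; rewrite /laplacian/=; congr (_ + _).
  rewrite derive1E -(@derive_val _ _ _ _ _ _ _ (df1 r0)).
  apply: near_eq_derive; near=> a.
  have a0 : 0 < a by near: a; exact: lt_nbhsr.
  rewrite derive1E -(@derive_val _ _ _ _ _ _ _ (dphi a0)).
  apply: near_eq_derive; near=> b.
  have b0 : 0 < b by near: b; exact: lt_nbhsr.
  by rewrite /radial_ext normc_real gtr0_norm.
pose rho (y : R) := Num.sqrt (r ^+ 2 + y ^+ 2).
have pos y : 0 < r ^+ 2 + y ^+ 2 by rewrite ltr_wpDr ?sqr_ge0 ?exprn_gt0.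
have rho0 y : 0 < rho y by rewrite sqrtr_gt0.
have drho (y : R) : is_derive y (1 : R) rho (y / rho y).
  have d1 : is_derive y (1 : R) (fun t => r ^+ 2 + t ^+ 2) (2 * y).
    have -> : (fun t : R => r ^+ 2 + t ^+ 2) = cst (r ^+ 2) \+ (fun t => t ^+ 2) by [].
    by apply: is_derive_eq; rewrite /GRing.scale/=; ring.
  have d2 := @is_derive1_comp _ (@Num.sqrt R) (fun t => r ^+ 2 + t ^+ 2) y _ _ (is_derive1_sqrt (pos y)) d1.
  have -> : y / rho y = (2 * rho y)^-1 * (2 * y) by field; rewrite gt_eqF.
  exact: d2.
(* The first derivative has the form y G(y), so its derivative at 0 is G(0) = phi'(r) / r, by
   continuity of G at 0. *)
have -> : derive1 (fun y => radial_ext phi (r +i* y)) = fun y => y * (f1 (rho y) / rho y).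
  apply/funext => y; rewrite derive1E.
  have -> : (fun y => radial_ext phi (r +i* y)) = phi \o rho by [].
  have d2 := @is_derive1_comp _ phi rho y _ _ (dphi (rho0 y)) (drho y).
  by rewrite derive_val; ring.
have rhor : rho 0 = r by rewrite /rho expr0n/= addr0 sqrtr_sqr gtr0_norm.
have cG : {for 0, continuous (fun y => f1 (rho y) / rho y)}.
  have crho : {for 0, continuous rho}.
    by apply: differentiable_continuous; apply/derivable1_diffP; have [] := drho 0.
  apply: cvgM; last first.
    by apply: cvgV => //; rewrite gt_eqF.
  apply: (@continuous_comp _ _ _ rho f1) => //.
  apply: differentiable_continuous; apply/derivable1_diffP.
  by have [] := df1 (rho0 0).
rewrite derive1E; apply: (@derive_val _ _ _ 0 (1 : R)).
rewrite -{1 2}rhor; apply: is_derive_difference_quotient => e e0.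
have := cG; move=> /cvgrPdist_le/(_ e e0)/nbhs_ballP[d /= d0 dP]; exists d => // s s0 sd.
rewrite mul0r !subr0 mulrAC divff// mul1r distrC; apply: dP.
by rewrite /ball/= distrC.
Unshelve. all: by end_near. Qed.

Hypothesis lap_gt0 : forall z, z != 0 -> 0 < laplacian (radial_ext phi) z.
Variable r1 : R.
Hypotheses (r1_gt0 : 0 < r1)
  (lap_ge1 : forall r : R, r1 <= r -> 1 <= laplacian (radial_ext phi) r%:C).

Let N (r : R) := r * f1 r.

Let dN (r : R) : 0 < r -> is_derive r (1 : R) N (r * (f2 r + f1 r / r)).
Proof.
move=> r0; have h := df1 r0.
have -> : N = (id * f1)%R by [].
apply: is_derive_eq; rewrite /GRing.scale/= mulr1; field; exact: lt0r_neq0.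
Qed.

(** [N] is the derivative of phi with respect to ln r, and N' is r times the Laplacian; this is the
    convexity in ln r. *)
Let N_le (r s : R) : 0 < r -> r <= s -> N r <= N s.
Proof.
move=> r0 rs; apply: (@nondecreasing_derive _ N (fun x => x * (f2 x + f1 x / x))) => // x /andP[rx _].
  by apply: dN; exact: lt_le_trans rx.
have x0 := lt_le_trans r0 rx.
rewrite mulr_ge0 ?(ltW x0)// -laplacian_radial//; apply/ltW/lap_gt0.
by rewrite -normc_gt0 normc_real normr_gt0 gt_eqF.
Qed.

(** phi' is bounded near 0, so N s = s phi'(s) tends to 0 there. A negative value N r would bound N
    s away from 0 for all smaller s. *)
Let N_ge0 (r : R) : 0 < r -> 0 <= N r.
Proof.
move=> r0; rewrite leNgt; apply/negP => Nr.
have [B B0 [d d0 dP]] := has_deriv_ge0_lipschitz (lexx 0) (phi2 (lexx 0)).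
pose K := `|f1 0| + B * d + 1.
have K0 : 0 < K by rewrite ltr_wpDl// addr_ge0// mulr_ge0// ltW.
pose s := Num.min r (Num.min (d / 2) (- N r / (2 * K))).
have s0 : 0 < s by rewrite !lt_min r0 !divr_gt0 ?oppr_gt0// mulr_gt0.
have : s <= s by [].
rewrite {2}/s !le_min => /andP[sr /andP[sd sN]].
have sd' : s < d by lra.
have := dP s (ltW s0); rewrite subr0 gtr0_norm// => /(_ sd') h.
have f1s : - K <= f1 s.
  have : B * s <= B * d by rewrite ler_wpM2l// ltW.
  move: h; rewrite ler_norml => /andP[h _].
  have := ler_norm (- f1 0); rewrite normrN /K; lra.
have h1 : - (K * s) <= N s by rewrite /N; nra.
have h2 := N_le s0 sr.
move: sN; rewrite ler_pdivlMr ?mulr_gt0// => sN.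
nra.
Qed.

(** N >= 0 gives phi' >= 0 off the origin; the one-sided derivative at 0 supplies the continuity
    needed to reach r = 0. *)
Lemma weight_mono (r s : R) : 0 <= r -> r <= s -> phi r <= phi s.
Proof.
have pos (a b : R) : 0 < a -> a <= b -> phi a <= phi b.
  move=> a0 ab; apply: (@nondecreasing_derive _ phi f1) => // x /andP[ax _].
    by apply: dphi; exact: lt_le_trans ax.
  have x0 := lt_le_trans a0 ax.
  by have := N_ge0 x0; rewrite pmulr_rge0.
rewrite le_eqVlt => /predU1P[<-|r0]; last exact: pos.
rewrite le_eqVlt => /predU1P[<-//|s0].
rewrite leNgt; apply/negP => h.
have [B B0 [d d0 dP]] := has_deriv_ge0_lipschitz (lexx 0) (phi1 (lexx 0)).
have B1 : 0 < B + 1 by rewrite ltr_wpDl.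
pose t := Num.min s (Num.min (d / 2) ((phi 0 - phi s) / (2 * (B + 1)))).
have t0 : 0 < t by rewrite !lt_min s0 !divr_gt0 ?subr_gt0// mulr_gt0.
have : t <= t by [].
rewrite {2}/t !le_min => /andP[ts /andP[td tN]].
have td' : t < d by lra.
have := dP t (ltW t0); rewrite subr0 gtr0_norm// => /(_ td').
rewrite ler_norml => /andP[h1 _].
have h2 := pos t s t0 ts.
move: tN; rewrite ler_pdivlMr ?mulr_gt0// => tN.
nra.
Qed.

(** A convex function of ln r lies above its tangent at ln s: phi - N(s) ln has derivative (N x - N
    s) / x, which changes sign at s. *)
Lemma weight_tangent (r s : R) : 0 < r -> 0 < s ->
  phi s + s * f1 s * (ln r - ln s) <= phi r.
Proof.
move=> r0 s0.
(* Taking k = 1 to the right of s and k = -1 to the left makes the function nondecreasing in both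
   cases. *)
have dg k (x : R) : 0 < x -> is_derive x (1 : R) (fun x => k *: (phi x - N s * ln x)) (k * ((N x - N s) / x)).
  move=> x0; have h := dphi x0; have h' := is_derive1_ln x0.
  have -> : (fun x => k *: (phi x - N s * ln x)) = k *: (phi - N s *: (@ln R)) by [].
  apply: is_derive_eq; rewrite /GRing.scale/= /N; field; exact: lt0r_neq0.
suff : phi s - N s * ln s <= phi r - N s * ln r by rewrite /N; lra.
have [sr|/ltW rs] := leP s r.
  have := @nondecreasing_derive _ _ _ s r sr (fun x xsr => dg 1 x (lt_le_trans s0 (proj1 (andP xsr)))).
  rewrite /GRing.scale/= !mul1r; apply => x /andP[sx _].
  have x0 := lt_le_trans s0 sx.
  by rewrite mul1r divr_ge0 ?subr_ge0 ?(ltW x0)//; exact: N_le.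
have := @nondecreasing_derive _ _ _ r s rs (fun x xsr => dg (-1) x (lt_le_trans r0 (proj1 (andP xsr)))).
rewrite /GRing.scale/= !mulN1r lerN2; apply => x /andP[rx xs].
have x0 := lt_le_trans r0 rx.
by rewrite mulN1r -mulNr opprB divr_ge0 ?subr_ge0 ?(ltW x0)//; exact: N_le.
Qed.

(** Beyond r1 the derivative of N is at least r, so N r >= (r^2 - r1^2) / 2, and r1 <= r / 2. *)
Lemma weight_quadratic (r : R) : 2 * r1 <= r -> r ^+ 2 / 4 <= r * f1 r.
Proof.
move=> rr.
have r1r : r1 <= r by have := r1_gt0; lra.
have dg (x : R) : r1 <= x <= r -> is_derive x (1 : R) (fun x => N x - x ^+ 2 / 2) (x * (f2 x + f1 x / x) - x).
  move=> /andP[r1x _]; have x0 := lt_le_trans r1_gt0 r1x; have h := dN x0.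
  have -> : (fun x => N x - x ^+ 2 / 2) = N - 2^-1 *: (fun x => x ^+ 2).
    by apply/funext => t; rewrite /GRing.scale/= mulrC.
  apply: is_derive_eq; rewrite /GRing.scale/=; field; exact: lt0r_neq0.
have := @nondecreasing_derive _ _ _ r1 r r1r dg.
have N1 := N_ge0 r1_gt0.
have h : N r1 - r1 ^+ 2 / 2 <= N r - r ^+ 2 / 2 -> r ^+ 2 / 4 <= r * f1 r.
  have : 4 * r1 ^+ 2 <= r ^+ 2 by have := r1_gt0; nra.
  have := sqr_ge0 r; rewrite -/(N r); lra.
move=> H; apply: h; apply: H => x /andP[r1x _].
have x0 := lt_le_trans r1_gt0 r1x.
by rewrite subr_ge0 -laplacian_radial// ler_peMr ?(ltW x0)//; exact: lap_ge1.
Qed.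

Lemma weight_increment (r s : R) : 2 * r1 <= r -> r <= s ->
  r / 4 * (s - r) <= phi s - phi r.
Proof.
move=> rr rs; have r0 : 0 < r by have := r1_gt0; lra.
have dg (x : R) : r <= x <= s -> is_derive x (1 : R) (fun x => phi x - r / 4 * x) (f1 x - r / 4).
  move=> /andP[rx _]; have x0 := lt_le_trans r0 rx; have h := dphi x0.
  have -> : (fun x => phi x - r / 4 * x) = phi - (r / 4) *: id by [].
  by apply: is_derive_eq; rewrite /GRing.scale/= mulr1.
have := @nondecreasing_derive _ _ _ r s rs dg.
suff nn (x : R) : r <= x <= s -> 0 <= f1 x - r / 4 by move/(_ nn); lra.
move=> /andP[rx _]; have x0 := lt_le_trans r0 rx.
have := weight_quadratic (le_trans rr rx).
rewrite expr2 -mulrA ler_pM2l// subr_ge0; lra.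
Qed.

End WeightAnalysis.

Section AdmissibleWeights.
Context {R : realType}.
Implicit Type phi : R -> R.

(* [N r] is r * phi'(r). *)
Lemma admissible_weight_facts phi : admissible_weight phi ->
  [/\ continuous (fun r : R => phi `|r|),
      forall r s : R, 0 <= r -> r <= s -> phi r <= phi s &
      exists N : R -> R,
        (forall r s : R, 0 < r -> 0 < s -> phi s + N s * (ln r - ln s) <= phi r) /\
        exists2 R1 : R, 0 < R1 &
          (forall s : R, R1 <= s -> s ^+ 2 / 4 <= N s) /\
          (forall r s : R, R1 <= r -> r <= s -> r / 4 * (s - r) <= phi s - phi r)].
Proof.
move=> [_ [f1 [f2 [h1 h2 _]]] lap_gt0 [tau [[tau0 _ _] [c c0 cP] _ [tau_cvg _] _]]].
have [r1 r10 r1P] : exists2 r1 : R, 0 < r1 & forall r, r1 <= r -> 1 <= laplacian (radial_ext phi) r%:C.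
  (* Once tau <= 1 / c, comparability gives L^(-1/2) <= c tau <= 1 for the Laplacian L, hence L >=
     1. *)
  have c1 : 0 < c^-1 by rewrite invr_gt0.
  move: tau_cvg => /cvgrPdist_le/(_ c^-1 c1)[a [_ aP]].
  exists (Num.max 1 (a + 1)); first by rewrite lt_max ltr01.
  move=> r; rewrite ge_max => /andP[r1 ar].
  have ar' : a < r by lra.
  have := aP r ar'; rewrite sub0r normrN /profile gtr0_norm// => tc.
  have r0 : 0 < r by lra.
  have L0 : 0 < laplacian (radial_ext phi) r%:C.
    by apply: lap_gt0; rewrite -normc_gt0 normc_real normr_gt0 gt_eqF.
  set L := laplacian _ _ in L0 *.
  have z1 : 1 <= Normc.normc r%:C by rewrite normc_real gtr0_norm.
  have [_] := cP r%:C z1.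
  rewrite -/L => hL.
  have : L `^ (- 2^-1) <= 1.
    apply: le_trans hL _; rewrite -(@mulfV _ c) ?gt_eqF//.
    by rewrite ler_wpM2l// ltW.
  rewrite powRN powR12_sqrt ?(ltW L0)// invf_le1 ?sqrtr_gt0// => h.
  by move: h; rewrite -{1}[1]sqrtr1 ler_sqrt// ltW.
split.
- exact: weight_continuous h1.
- exact: (weight_mono h1 h2 lap_gt0).
exists (fun r => r * f1 r); split; first exact: (weight_tangent h1 h2 lap_gt0).
exists (2 * r1); first by rewrite mulr_gt0.
split; first exact: (weight_quadratic h1 h2 lap_gt0 r10 r1P).
exact: (weight_increment h1 h2 lap_gt0 r10 r1P).
Qed.

End AdmissibleWeights.

(** * Bounded composition operators *)

Section PlaneIntegral.
Context {R : realType}.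
Local Notation mu := (@lebesgue_measure R).

Let a (x : R) : R := (1 + x ^+ 2)^-1.

Let a_ge0 x : 0 <= a x.
Proof. by rewrite invr_ge0 addr_ge0// sqr_ge0. Qed.

Let a_cont : continuous a.
Proof. exact: continuous_oneDsqrV. Qed.

Lemma integral_oneDsqrV : (\int[mu]_x (a x)%:E = (pi : R)%:E)%E.
Proof.
rewrite ge0_symfun_integralT//=.
- rewrite (_ : [set x | _] = `[0, +oo[%classic); last first.
    by apply/seteqP; split => x/=; rewrite in_itv/= andbT.
  by rewrite integral0y_oneDsqr -EFinM mulrCA divff// mulr1.
- by move=> x/=; rewrite /a sqrrN.
Qed.

(** (1 + x^2 + y^2)^2 >= (1 + x^2) (1 + y^2), and the product of the reciprocals has integral pi^2
    by Tonelli. *)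
Lemma plane_integral_le (h : R * R -> R) (K : R) : measurable_fun setT h ->
  (forall w, 0 <= h w) ->
  (forall w, h w * (1 + Normc.normc (w.1 +i* w.2) ^+ 2) ^+ 2 <= K) ->
  (\int[mu \x mu]_w (h w)%:E <= (K * pi ^+ 2)%:E)%E.
Proof.
move=> mh h0 hK.
have ma : measurable_fun setT a by exact: continuous_measurable_fun.
have K0 : 0 <= K.
  apply: le_trans (hK (0, 0)); apply: mulr_ge0; first exact: h0.
  exact: exprn_ge0 (addr_ge0 ler01 (sqr_ge0 _)).
have m1 : measurable_fun setT (fun w : R * R => a w.1).
  exact: measurableT_comp ma measurable_fst.
have m2 : measurable_fun setT (fun w : R * R => a w.2).
  exact: measurableT_comp ma measurable_snd.
apply: (@le_trans _ _ (\int[mu \x mu]_w (K * (a w.1 * a w.2))%:E)%E).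
  apply: ge0_le_integral => //.
  - by move=> w _; rewrite lee_fin.
  - exact/measurable_EFinP.
  - by apply/measurable_EFinP; apply: measurable_funM => //; exact: measurable_funM.
  - move=> [x y] _; rewrite lee_fin/=.
    have p1 : 0 < 1 + x ^+ 2 by rewrite ltr_pwDl// sqr_ge0.
    have p2 : 0 < 1 + y ^+ 2 by rewrite ltr_pwDl// sqr_ge0.
    rewrite /a -invfM ler_pdivlMr ?mulr_gt0//; apply: le_trans (hK (x, y)).
    rewrite ler_wpM2l// normc_sqr/=.
    have := sqr_ge0 x; have := sqr_ge0 y; nra.
rewrite fubini_tonelli1; last 2 first.
- by apply/measurable_EFinP; apply: measurable_funM => //; exact: measurable_funM.
- by move=> w; rewrite lee_fin !mulr_ge0.
rewrite /fubini_F/=.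
under eq_integral => x _.
  under eq_integral => y _ do rewrite mulrA EFinM.
  rewrite ge0_integralZl//; last 3 first.
  - exact/measurable_EFinP.
  - by move=> y _; rewrite lee_fin.
  - by rewrite lee_fin mulr_ge0.
  rewrite integral_oneDsqrV -EFinM mulrAC EFinM.
  over.
rewrite ge0_integralZl//; last 3 first.
- exact/measurable_EFinP.
- by move=> y _; rewrite lee_fin.
- by rewrite lee_fin mulr_ge0 ?pi_ge0.
by rewrite integral_oneDsqrV -EFinM expr2 mulrA.
Qed.

End PlaneIntegral.

Section FockNorm.
Context {R : realType}.
Variables (phi : R -> R) (p : R).
Hypotheses (p1 : 1 <= p) (phi_cont : continuous (fun r : R => phi `|r|)).
Implicit Types (f g : R[i] -> R[i]) (z w : R[i]).
Local Notation mu := (@lebesgue_measure R).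
Local Notation normc := (@Normc.normc R).

Let p0 : 0 < p. Proof. exact: lt_le_trans p1. Qed.

Lemma fock_integral_ge0 f : (0 <= fock_integral phi p f)%E.
Proof. by apply: integral_ge0 => w _; rewrite lee_fin; exact: fock_density_ge0. Qed.

Lemma fock_norm_le f (K : R) : 0 <= K ->
  (fock_norm phi p f <= K%:E)%E = (fock_integral phi p f <= (K `^ p)%:E)%E.
Proof.
move=> K0; apply/idP/idP => h.
  have : (fock_norm phi p f `^ p <= K%:E `^ p)%E.
    by apply: gt0_ler_poweR => //; [exact: ltW|rewrite in_itv/= poweR_ge0 leey|rewrite in_itv/= lee_fin K0 leey].
  by rewrite /fock_norm -poweRrM mulVf ?gt_eqF// poweRe1 ?fock_integral_ge0// poweR_EFin.
have : (fock_integral phi p f `^ p^-1 <= (K `^ p)%:E `^ p^-1)%E.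
  apply: gt0_ler_poweR => //; [by rewrite invr_ge0 ltW|by rewrite in_itv/= fock_integral_ge0 leey|].
  by rewrite in_itv/= lee_fin powR_ge0 leey.
by rewrite poweR_EFin -powRrM divff ?gt_eqF// powRr1.
Qed.

Lemma fock_densityZ (k : R[i]) f (w : R * R) :
  fock_density phi p (fun z => k * f z) w = normc k `^ p * fock_density phi p f w.
Proof. by rewrite /fock_density Normc.normcM powRM ?normc_ge0// mulrA. Qed.

Lemma fock_integralZ (k : R[i]) f : entire f ->
  fock_integral phi p (fun z => k * f z) = ((normc k `^ p)%:E * fock_integral phi p f)%E.
Proof.
move=> fe; rewrite !fock_integralE.
under eq_integral do rewrite fock_densityZ EFinM.
rewrite ge0_integralZl//.
- by apply/measurable_EFinP; exact: measurable_fock_density.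
- by move=> w _; rewrite lee_fin fock_density_ge0.
- by rewrite lee_fin powR_ge0.
Qed.

(** Turns weighted sup bounds into bounds of the integral: as p >= 1, the p-th power of (1 +
    |z|^2)^-2 is at most (1 + |z|^2)^-2, which is integrable. *)
Lemma fock_integral_le_sup f (C : R) : entire f -> 0 <= C ->
  (forall z, normc (f z) * expR (- phi (normc z)) * (1 + normc z ^+ 2) ^+ 2 <= C) ->
  (fock_integral phi p f <= (C `^ p * pi ^+ 2)%:E)%E.
Proof.
move=> fe C0 fC; rewrite fock_integralE; apply: plane_integral_le.
- exact: measurable_fock_density.
- exact: fock_density_ge0.
move=> [x y]; set z := x +i* y.
have -> : fock_density phi p f (x, y) = (normc (f z) * expR (- phi (normc z))) `^ p.
  rewrite powRM ?normc_ge0 ?expR_ge0// powR_expR /fock_density/= -/z /radial_ext.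
  by rewrite mulrN.
set q := 1 + _ ^+ 2.
have q1 : 1 <= q by rewrite lerDl sqr_ge0.
have q21 : 1 <= q ^+ 2 by rewrite exprn_ege1.
have q20 : 0 < q ^+ 2 by exact: lt_le_trans q21.
rewrite -ler_pdivlMr//; apply: (@le_trans _ _ ((C / q ^+ 2) `^ p)).
  apply: ge0_ler_powR; [exact: ltW| | |by rewrite ler_pdivlMr].
    by rewrite nnegrE mulr_ge0 ?normc_ge0 ?expR_ge0.
  by rewrite nnegrE divr_ge0// ltW.
rewrite powRM ?invr_ge0 ?(ltW q20)// ler_wpM2l ?powR_ge0//.
by apply: ge1r_powR => //; rewrite invr_gt0 q20 invf_le1.
Qed.

Lemma fock_spaceZ (k : R[i]) f : fock_space phi p f -> fock_space phi p (fun z => k * f z).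
Proof.
move=> [fe ff]; split; first exact: entireZ.
by rewrite fock_integralZ// lte_mul_pinfty// ?lee_fin ?powR_ge0.
Qed.

(** Both terms are replaced by the larger one. This crude inequality stands in for Minkowski's. *)
Lemma powR_add_le (x y : R) : 0 <= x -> 0 <= y ->
  (x + y) `^ p <= 2 `^ p * (x `^ p + y `^ p).
Proof.
have aux (u v : R) : 0 <= u -> u <= v -> (u + v) `^ p <= 2 `^ p * (u `^ p + v `^ p).
  move=> u0 uv; have v0 := le_trans u0 uv.
  apply: (@le_trans _ _ ((2 * v) `^ p)).
    by apply: ge0_ler_powR; rewrite ?nnegrE ?(ltW p0) ?addr_ge0 ?mulr_ge0//; lra.
  by rewrite powRM// ler_wpM2l ?powR_ge0// lerDr powR_ge0.
move=> x0 y0; have [xy|/ltW yx] := leP x y; first exact: aux.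
by rewrite addrC [X in _ * X]addrC; exact: aux.
Qed.

Lemma fock_densityD_le f g h (w : R * R) : (forall z, normc (h z) <= normc (f z) + normc (g z)) ->
  fock_density phi p h w <= 2 `^ p * (fock_density phi p f w + fock_density phi p g w).
Proof.
move=> hle; rewrite /fock_density -mulrDl mulrA ler_wpM2r ?expR_ge0//.
apply: le_trans (powR_add_le (normc_ge0 _) (normc_ge0 _)).
by apply: ge0_ler_powR; rewrite ?nnegrE ?(ltW p0) ?addr_ge0 ?normc_ge0.
Qed.

Lemma fock_integralD_le f g h : entire f -> entire g -> entire h ->
  (forall z, normc (h z) <= normc (f z) + normc (g z)) ->
  (fock_integral phi p h <= (2 `^ p)%:E * (fock_integral phi p f + fock_integral phi p g))%E.
Proof.
move=> fe ge he hle; rewrite !fock_integralE.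
have mf := measurable_fock_density p phi_cont fe.
have mg := measurable_fock_density p phi_cont ge.
have mh := measurable_fock_density p phi_cont he.
have mfE := (measurable_EFinP _ _).2 mf; have mgE := (measurable_EFinP _ _).2 mg.
have mhE := (measurable_EFinP _ _).2 mh.
have ge0 k (w : R * R) : (0 <= (fock_density phi p k w)%:E)%E by rewrite lee_fin fock_density_ge0.
rewrite -ge0_integralD//.
rewrite -ge0_integralZl//; last 2 first.
- exact: emeasurable_funD.
- by move=> w _; exact: adde_ge0.
apply: ge0_le_integral => //.
- by apply: emeasurable_funM; [exact: measurable_cst|exact: emeasurable_funD].
- by move=> w _; rewrite -EFinD -EFinM lee_fin; exact: fock_densityD_le.
Qed.

End FockNorm.

(** * Testing on monomials: bounded symbols are affine *)

Section Classification.
Context {R : realType}.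
Variables (phi : R -> R) (p : R) (N : R -> R) (R1 : R).
Hypotheses (p1 : 1 <= p) (phi_ge0 : forall r : R, 0 <= r -> 0 <= phi r).
Hypotheses (phi_cont : continuous (fun r : R => phi `|r|)).
Hypothesis phi_mono : forall r s : R, 0 <= r -> r <= s -> phi r <= phi s.
Hypothesis tangent : forall r s : R, 0 < r -> 0 < s -> phi s + N s * (ln r - ln s) <= phi r.
Hypothesis N_quad : forall s : R, R1 <= s -> s ^+ 2 / 4 <= N s.
Hypothesis phi_inc : forall r s : R, R1 <= r -> r <= s -> r / 4 * (s - r) <= phi s - phi r.
Implicit Types (f g psi : R[i] -> R[i]) (z w : R[i]).
Local Notation normc := (@Normc.normc R).

Let p0 : 0 < p. Proof. exact: lt_le_trans p1. Qed.

Definition monomial n : R[i] -> R[i] := fun z => z ^+ n.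

Lemma entire_monomial n : entire (monomial n).
Proof.
elim: n => [|n IH] z; first exact: derivable_cst.
have -> : monomial n.+1 = (fun w => w * monomial n w) by apply/funext => w; rewrite /monomial exprS.
by apply: derivableM; [exact: derivable_id|exact: IH].
Qed.

Lemma expR_ln_natM (r : R) (m : nat) : 0 < r -> expR (m%:R * ln r) = r ^+ m.
Proof. by move=> r0; rewrite expRM_natl lnK// posrE. Qed.

Lemma one_plus_sqr_le (r : R) : 1 <= r -> (1 + r ^+ 2) ^+ 2 <= 4 * r ^+ 4.
Proof.
move=> r1; have h : 1 <= r ^+ 2 by rewrite exprn_ege1.
by rewrite (_ : r ^+ 4 = (r ^+ 2) ^+ 2) -?exprM//; nra.
Qed.

(** For r >= 1 the factor (1 + r^2)^2 is absorbed by raising the degree by 4. For r <= 1 the left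
    side is at most 4, and k >= exp(- phi 1) by the case r = 1. *)
Lemma monomial_weight_le (n : nat) (s k : R) : 1 <= s ->
  (forall r : R, 1 <= r -> r ^+ (n + 4) * expR (- phi r) <= k) ->
  forall r : R, 0 <= r -> r ^+ n * expR (- phi r) * (1 + r ^+ 2) ^+ 2 <= 4 * expR (phi 1) * k.
Proof.
move=> s1 hk r r0.
have e1 : 1 <= expR (phi 1) by rewrite -expR0 ler_expR phi_ge0.
have k0 : 0 <= k by apply: le_trans (hk 1 (lexx 1)); rewrite expr1n mul1r expR_ge0.
have [r1|/ltW r1] := leP 1 r.
  have h := hk r r1.
  apply: (@le_trans _ _ (4 * k)).
    apply: (@le_trans _ _ (r ^+ n * expR (- phi r) * (4 * r ^+ 4))).
      by rewrite ler_wpM2l ?one_plus_sqr_le// mulr_ge0 ?expR_ge0// exprn_ge0.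
    rewrite exprD in h; nra.
  nra.
have q : expR (- phi 1) <= k by apply: le_trans (hk 1 (lexx 1)); rewrite expr1n mul1r.
have k1 : 1 <= expR (phi 1) * k.
  by rewrite -[leLHS](expRxMexpNx_1 (phi 1)) ler_wpM2l// expR_ge0.
apply: (@le_trans _ _ (1 * 1 * 4)); last by lra.
have r2 : r ^+ 2 <= 1 by rewrite exprn_ile1.
have r20 : 0 <= r ^+ 2 by rewrite sqr_ge0.
apply: ler_pM.
- by rewrite mulr_ge0 ?expR_ge0 ?exprn_ge0.
- by rewrite sqr_ge0.
- apply: ler_pM; rewrite ?expR_ge0 ?exprn_ge0 ?exprn_ile1//.
  by rewrite -expR0 ler_expR oppr_le0 phi_ge0.
- nra.
Qed.

Lemma monomial_decay n : exists2 C : R, 0 <= C &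
  forall r : R, 0 <= r -> r ^+ n * expR (- phi r) * (1 + r ^+ 2) ^+ 2 <= C.
Proof.
(* From s >= 1 and s >= 4 (n + 4) follows N s >= s^2 / 4 >= n + 4, so the tangent at s dominates (n
   + 4) ln r for r >= 1. *)
pose s : R := Num.max R1 (Num.max 1 (4 * (n + 4)%:R)).
have : s <= s by [].
rewrite {1}/s !ge_max => /andP[sR /andP[s1 sn]].
have s0 : 0 < s by lra.
have nN : (n + 4)%:R <= N s.
  apply: le_trans (N_quad sR); rewrite ler_pdivlMr// expr2 mulrC; nra.
exists (4 * expR (phi 1) * expR (N s * ln s - phi s)).
  by rewrite !mulr_ge0 ?expR_ge0.
apply: (monomial_weight_le s1) => r r1.
have r0 : 0 < r by lra.
rewrite -expR_ln_natM// -expRD ler_expR.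
have := tangent r0 s0; have := ln_ge0 r1; nra.
Qed.

(** n + 4 is the integer part of N s. The tangent at s bounds r^(n+4) exp(- phi r) by exp(- phi s)
    s^(N s), and rounding N s up costs the fifth extra power of s; s >= 4 ensures N s >= 4. *)
Lemma monomial_sharp_decay (s : R) : R1 <= s -> 4 <= s -> exists n : nat,
  forall r : R, 0 <= r -> r ^+ n * expR (- phi r) * (1 + r ^+ 2) ^+ 2 <=
    4 * expR (phi 1) * (expR (- phi s) * s ^+ (n + 5)).
Proof.
move=> sR s4; have s1 : 1 <= s by lra.
have s0 : 0 < s by lra.
have Ns : 4 <= N s by apply: le_trans (N_quad sR); nra.
have /andP[m1 m2] := truncn_itv (le_trans (ler0n _ 4) Ns).
set m := Num.truncn (N s) in m1 m2.
have m4 : (4 <= m)%N by rewrite -ltnS -(ltr_nat R); exact: le_lt_trans m2.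
exists (m - 4)%N; apply: (monomial_weight_le s1) => r r1.
have r0 : 0 < r by lra.
rewrite subnK// (_ : m - 4 + 5 = m.+1)%N; last by rewrite addnS subnK.
rewrite -!expR_ln_natM// -!expRD ler_expR.
have := tangent r0 s0; have := ln_ge0 r1; have := ln_ge0 s1.
rewrite -natr1 in m2 *; nra.
Qed.

Lemma fock_space_monomial n : fock_space phi p (monomial n).
Proof.
split; first exact: entire_monomial.
have [C C0 hC] := monomial_decay n.
apply: le_lt_trans (fock_integral_le_sup p1 phi_cont (@entire_monomial n) C0 _) _.
  by move=> z; rewrite /monomial normcX; apply: hC; exact: normc_ge0.
exact: ltry.
Qed.

Lemma ln_le_linear (k x : R) : 0 < k -> 0 < x -> ln x <= x / k + ln k.
Proof.
move=> k0 x0.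
have -> : ln x = ln (x / k) + ln k.
  by rewrite -lnM ?posrE ?divr_gt0// divfK// gt_eqF.
rewrite lerD2r; have xk : 0 < x / k by rewrite divr_gt0.
have -> : x / k = 1 + (x / k - 1) by lra.
by apply: le_trans (le_ln1Dx _) _; lra.
Qed.

Section BoundedComposition.
Variable psi : R[i] -> R[i].
Hypothesis hpsi : bounded_composition phi p psi.

(** With s = |psi z| and n from [monomial_sharp_decay], the image of z^n has modulus s^n at z, while
    its norm is at most a constant times exp(- phi s) s^(n+5). The point estimate bounds one by the
    other, and s^n cancels. *)
Lemma bounded_composition_weight (d : R) : 0 < d -> exists B : R, forall z,
  R1 <= normc (psi z) -> 4 <= normc (psi z) ->
  phi (normc (psi z)) <= B + 5 * ln (normc (psi z)) + phi (normc z + 2 * d).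
Proof.
move=> d0; have [psie [[Tspace _] [M TM]]] := hpsi.
have [C C0 hC] := fock_point_le p1 phi_cont phi_mono d0.
pose M' := `|M| + 1; have M'0 : 0 < M' by rewrite ltr_wpDl.
(* The factor by which [fock_integral_le_sup] enlarges a sup bound when the p-th root is taken. *)
pose kap : R := (pi ^+ 2) `^ p^-1.
have kap0 : 0 < kap by rewrite powR_gt0// exprn_gt0// pi_gt0.
pose K := M' * (4 * expR (phi 1)) * kap * C.
have K0 : 0 < K by rewrite !mulr_gt0// expR_gt0.
exists (ln K) => z; set s := normc (psi z) => sR s4.
have s0 : 0 < s by lra.
have [n hn] := monomial_sharp_decay sR s4.
pose D := 4 * expR (phi 1) * (expR (- phi s) * s ^+ (n + 5)).
have D0 : 0 < D by rewrite !mulr_gt0 ?expR_gt0// exprn_gt0.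
have mono_int : (fock_integral phi p (monomial n) <= (D `^ p * pi ^+ 2)%:E)%E.
  apply: (fock_integral_le_sup p1 phi_cont (@entire_monomial n) (ltW D0)) => w.
  by rewrite /monomial normcX; apply: hn; exact: normc_ge0.
have Dk : (D * kap) `^ p = D `^ p * pi ^+ 2.
  by rewrite powRM ?(ltW D0) ?(ltW kap0)// -powRrM mulVf ?gt_eqF// powRr1 ?sqr_ge0.
have mono_norm : (fock_norm phi p (monomial n) <= (D * kap)%:E)%E.
  by rewrite fock_norm_le ?Dk// mulr_ge0 ?(ltW D0) ?(ltW kap0).
pose L := M' * (D * kap).
have L0 : 0 < L by rewrite mulr_gt0// mulr_gt0.
have img_norm : (fock_norm phi p (composition_operator psi (monomial n)) <= L%:E)%E.
  apply: le_trans (TM _ (fock_space_monomial n)) _.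
  apply: (@le_trans _ _ (M'%:E * fock_norm phi p (monomial n))%E).
    apply: lee_wpmul2r; first exact: poweR_ge0.
    by rewrite lee_fin /M' (le_trans (ler_norm M))// lerDl.
  by rewrite /L EFinM; apply: lee_wpmul2l => //; rewrite lee_fin ltW.
have [imge imgf] := Tspace _ (fock_space_monomial n).
rewrite fock_norm_le ?(ltW L0)// in img_norm.
have g1 : (fock_integral phi p (fun w => (L^-1)%:C * composition_operator psi (monomial n) w)%R <= 1)%E.
  rewrite fock_integralZ//.
  apply: (@le_trans _ _ ((normc (L^-1)%:C `^ p)%:E * (L `^ p)%:E)%E).
    by apply: lee_wpmul2l => //; rewrite lee_fin powR_ge0.
  rewrite -EFinM normc_real ger0_norm ?invr_ge0 ?(ltW L0)// -powRM ?invr_ge0 ?(ltW L0)//.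
  by rewrite mulVf ?gt_eqF// powR1.
have [hz _] := hC _ z (@entireZ _ _ _ imge) g1.
move: hz; rewrite /composition_operator/= /monomial Normc.normcM normcX -/s normc_real.
rewrite ger0_norm ?invr_ge0 ?(ltW L0)// mulrC ler_pdivrMr// => hz.
have : expR (phi s) <= K * s ^+ 5 * expR (phi (normc z + 2 * d)).
  rewrite -(ler_pM2r (exprn_gt0 n s0)).
  apply: (@le_trans _ _ (expR (phi s) * (C * expR (phi (normc z + 2 * d)) * L))).
    by rewrite ler_wpM2l ?expR_ge0.
  have E := expRxMexpNx_1 (phi s).
  rewrite /L /D /K exprD le_eqVlt; apply/orP; left; apply/eqP.
  rewrite -[RHS]mulr1 -E; ring.
have s50 : 0 < s ^+ 5 by rewrite exprn_gt0.
have Ks0 : 0 < K * s ^+ 5 by rewrite mulr_gt0.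
rewrite -[leRHS]lnK ?posrE ?mulr_gt0 ?expR_gt0// ler_expR.
rewrite [X in _ <= X]lnM ?posrE ?expR_gt0// expRK lnM ?posrE// lnXn// => h.
by move: h; rewrite -(mulr_natl (ln s) 5).
Qed.

(** Suppose s > rho = |z| + 3d. From rho to s the weight gains at least s - rho, more than 5 (ln s -
    ln rho). From |z| + 2d to rho it gains at least d |z| / 4, more than B + 5 ln rho for large
    |z|. *)
Lemma bounded_composition_growth (d : R) : 0 < d -> exists r0 : R, forall z,
  r0 <= normc z -> normc (psi z) <= normc z + 3 * d.
Proof.
move=> d0; have [B hB] := bounded_composition_weight d0.
(* With this [k], 5 ln rho <= rho d / 8 + 5 ln k, whose leading term is half of the gain d |z| / 4;
   r0 makes the other half exceed the remaining constants. *)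
pose k := 40 / d; have k0 : 0 < k by rewrite divr_gt0.
pose r0 := Num.max (Num.max R1 5) (8 / d * (B + 5 * ln k + d ^+ 2 / 4) + 1).
exists r0 => z; rewrite /r0 !ge_max => /andP[/andP[zR z5] zB].
rewrite leNgt; apply/negP; set s := normc (psi z); set rho := normc z + 3 * d => srho.
have rho0 : 0 < rho by rewrite /rho; lra.
have s0 : 0 < s by exact: lt_trans srho.
have hs : phi s <= B + 5 * ln s + phi (normc z + 2 * d) by apply: hB; rewrite -/s; rewrite /rho in srho; lra.
have inc1 : rho / 4 * (s - rho) <= phi s - phi rho by apply: phi_inc; rewrite /rho in srho *; lra.
have inc2 : (normc z + 2 * d) / 4 * (rho - (normc z + 2 * d)) <= phi rho - phi (normc z + 2 * d).
  by apply: phi_inc; rewrite /rho; lra.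
have lns : ln s <= ln rho + (s - rho) / 5.
  have := ln_le_linear rho0 s0 => h1.
  have : ln s <= (s / rho - 1) + ln rho.
    rewrite -[in leLHS](divfK (lt0r_neq0 rho0) s) lnM ?posrE ?divr_gt0// lerD2r.
    have xk : 0 < s / rho by rewrite divr_gt0.
    have -> : ln (s / rho) = ln (1 + (s / rho - 1)) by congr ln; lra.
    by apply: le_ln1Dx; lra.
  have : s / rho - 1 <= (s - rho) / 5.
    have -> : s / rho - 1 = (s - rho) / rho by rewrite mulrBl divff// gt_eqF.
    rewrite ler_pM2l ?subr_gt0// lef_pV2 ?posrE//; rewrite /rho; lra.
  lra.
have lnr := ln_le_linear k0 rho0.
have rk : rho / k = rho * d / 40 by rewrite /k; field; rewrite gt_eqF.
rewrite rk in lnr.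
have zB' : B + 5 * ln k + d ^+ 2 / 4 < normc z * d / 8.
  have : 8 / d * (B + 5 * ln k + d ^+ 2 / 4) < normc z by lra.
  by rewrite mulrAC ltr_pdivrMr//; lra.
have : s - rho <= rho / 4 * (s - rho) by rewrite ler_peMl ?subr_ge0 ?(ltW srho)//; rewrite /rho; lra.
move: inc2; have -> : rho - (normc z + 2 * d) = d by rewrite /rho; ring.
move=> inc2 h.
have : rho * d = normc z * d + 3 * d ^+ 2 by rewrite /rho; ring.
have : (normc z + 2 * d) / 4 * d = normc z * d / 4 + d ^+ 2 / 2 by field.
have := sqr_ge0 d.
lra.
Qed.

Lemma bounded_composition_affine : exists a b : R[i],
  [/\ psi = (fun z => a * z + b), normc a <= 1 & normc a = 1 -> b = 0].
Proof.
have psie : entire psi by case: hpsi.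
pose b := psi 0; pose a := psi 1 - psi 0.
have psiE : psi = (fun z => a * z + b).
  have [r0 hr0] := bounded_composition_growth ltr01.
  apply/funext => z.
  by rewrite (liouville_affine psie (C := 3) (r0 := r0))
    => [|w /hr0]; rewrite ?mulr1// addrC mulrC.
exists a, b; split => //.
  rewrite leNgt; apply/negP => a1.
  have [r0 hr0] := bounded_composition_growth ltr01.
  (* Then |a| t - |b| >= t + 4, against the growth bound t + 3. *)
  pose t := Num.max (Num.max r0 0) ((4 + normc b) / (normc a - 1)).
  have : t <= t by [].
  rewrite {1}/t !ge_max => /andP[/andP[tr t0] ta].
  have := hr0 t%:C; rewrite normc_real ger0_norm// => /(_ tr).
  rewrite psiE => h.
  have := normcB_ge (a * t%:C) (- b); rewrite opprK normcN Normc.normcM normc_real ger0_norm// => h2.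
  by move: ta; rewrite ler_pdivrMr ?subr_gt0//; lra.
move=> a1; apply/eqP; rewrite -normc_eq0 eq_le normc_ge0 andbT.
apply/ler_addgt0Pr => e e0; rewrite add0r.
have e3 : 0 < e / 3 by rewrite divr_gt0.
have [r0 hr0] := bounded_composition_growth e3.
have [b0|b0] := eqVneq b 0; first by rewrite b0 Normc.normc0 ltW.
have nb0 : 0 < normc b by rewrite normc_gt0.
have a0 : a != 0 by rewrite -normc_gt0 a1.
pose t := Num.max r0 1.
have : t <= t by [].
rewrite {1}/t !ge_max => /andP[tr t1].
(* Chosen so that |z| = t and a z is a positive multiple of b; then |a z + b| = t + |b|, and the
   growth bound t + 3 (e / 3) forces |b| <= e. *)
pose z := t%:C * (b / (normc b)%:C) / a.
have nz : normc z = t.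
  rewrite /z !Normc.normcM !Normc.normcV a1 !normc_real (ger0_norm (normc_ge0 b)).
  by rewrite divff ?gt_eqF// invr1 !mulr1 ger0_norm//; lra.
have := hr0 z; rewrite nz => /(_ tr); rewrite psiE.
have nbC : (normc b)%:C != 0 by rewrite -normc_gt0 normc_real normr_gt0 gt_eqF.
have -> : a * z + b = (t + normc b)%:C * (b / (normc b)%:C).
  rewrite /z rmorphD/=; field; by rewrite a0 nbC.
rewrite !Normc.normcM Normc.normcV !normc_real (ger0_norm (normc_ge0 b)) divff ?gt_eqF// mulr1.
rewrite ger0_norm; lra.
Qed.

End BoundedComposition.

End Classification.

(** * Translates of contractions *)

Section Perturbation.
Context {R : realType}.
Variables (phi : R -> R) (p : R) (R1 : R).
Hypotheses (p1 : 1 <= p) (phi_ge0 : forall r : R, 0 <= r -> 0 <= phi r).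
Hypotheses (phi_cont : continuous (fun r : R => phi `|r|)).
Hypothesis phi_mono : forall r s : R, 0 <= r -> r <= s -> phi r <= phi s.
Hypothesis phi_inc : forall r s : R, R1 <= r -> r <= s -> r / 4 * (s - r) <= phi s - phi r.
Implicit Types (f g psi : R[i] -> R[i]) (z w : R[i]).
Local Notation normc := (@Normc.normc R).

Let p0 : 0 < p. Proof. exact: lt_le_trans p1. Qed.

Lemma entire_comp f g : entire f -> entire g -> entire (f \o g).
Proof.
move=> fe ge z; apply/derivable1_diffP.
apply: (@differentiable_comp _ _ _ _ (g : R[i]^o -> R[i]^o) (f : R[i]^o -> R[i]^o)).
  exact/derivable1_diffP/ge.
exact/derivable1_diffP/fe.
Qed.

Lemma entire_affine (a b : R[i]) : entire (fun z => a * z + b).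
Proof.
by move=> z; apply: derivableD; [apply: derivableM; [exact: derivable_cst|exact: derivable_id]|
  exact: derivable_cst].
Qed.

Lemma bounded_composition_of_unit_ball psi (M : R) : entire psi -> 0 <= M ->
  (forall f, entire f -> (fock_integral phi p f <= 1)%E ->
     (fock_norm phi p (composition_operator psi f) <= M%:E)%E) ->
  bounded_composition phi p psi.
Proof.
move=> psie M0 hM.
(* Scaling by any positive upper bound [eta] of the norm avoids dividing by a norm that may be 0;
   [eta] decreases to the norm at the end. *)
have key f (eta : R) : entire f -> 0 < eta -> (fock_norm phi p f <= eta%:E)%E ->
    (fock_norm phi p (composition_operator psi f) <= (M * eta)%:E)%E.
  move=> fe eta0; have eta0' := ltW eta0; rewrite (@fock_norm_le _ phi p p1 f eta eta0') => feta.
  have := hM (fun z => (eta^-1)%:C * f z) (@entireZ _ _ _ fe).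
  have n0 : 0 <= eta^-1 by rewrite invr_ge0.
  rewrite fock_integralZ// normc_real ger0_norm// => hg.
  have : (fock_norm phi p (composition_operator psi (fun z => ((eta^-1)%:C * f z)%R)) <= M%:E)%E.
    apply: hg; apply: (@le_trans _ _ ((eta^-1 `^ p)%:E * (eta `^ p)%:E)%E).
      by apply: lee_wpmul2l => //; rewrite lee_fin powR_ge0.
    by rewrite -EFinM -powRM// mulVf ?gt_eqF// powR1.
  rewrite (@fock_norm_le _ phi p p1 _ M M0).
  rewrite (@fock_norm_le _ phi p p1 _ (M * eta) (mulr_ge0 M0 eta0')).
  have ge : entire (composition_operator psi f) by exact: (entire_comp fe psie).
  rewrite [X in fock_integral _ _ X](_ : _ =
     (fun z => (eta^-1)%:C * (composition_operator psi f) z))//.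
  rewrite (@fock_integralZ _ _ _ phi_cont _ _ ge).
  rewrite normc_real ger0_norm// => h.
  rewrite -[leLHS]mul1e.
  have <- : ((eta `^ p)%:E * (eta^-1 `^ p)%:E = 1 :> \bar R)%E.
    by rewrite -EFinM -powRM// divff ?gt_eqF// powR1.
  rewrite -muleA powRM// mulrC EFinM; apply: lee_wpmul2l => //.
  by rewrite lee_fin powR_ge0.
have fin f : fock_space phi p f -> exists2 nu : R, 0 <= nu & fock_norm phi p f = nu%:E.
  move=> [_ ffin]; have : fock_norm phi p f \is a fin_num.
    by rewrite ge0_fin_numE ?poweR_ge0// poweR_lty.
  by move=> /fineK <-; exists (fine (fock_norm phi p f)) => //; rewrite fine_ge0// poweR_ge0.
split; first exact: psie.
split.
  split; last by move=> k f g _ _.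
  move=> f fs; have [fe _] := fs; split; first exact: (entire_comp fe psie).
  have [nu nu0 nuE] := fin f fs.
  have nu1 : 0 < nu + 1 by rewrite ltr_wpDl.
  have : (fock_norm phi p (composition_operator psi f) <= (M * (nu + 1))%:E)%E.
    by apply: key => //; rewrite nuE lee_fin lerDl.
  rewrite (@fock_norm_le _ _ _ p1 _ _ (mulr_ge0 M0 (ltW nu1))) => /le_lt_trans; apply.
  exact: ltry.
exists M => f fs; have [nu nu0 nuE] := fin f fs.
rewrite nuE -EFinM; apply/lee_addgt0Pr => e e0.
have M1 : 0 < M + 1 by rewrite ltr_wpDl.
apply: (@le_trans _ _ (M * (nu + e / (M + 1)))%:E).
  by apply: key; [case: fs|rewrite ltr_wpDl// divr_gt0|rewrite nuE lee_fin lerDl divr_ge0// ltW].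
rewrite -EFinD lee_fin mulrDr lerD2l mulrA ler_pdivrMr// mulrC ler_wpM2l ?(ltW e0)//.
by rewrite lerDl.
Qed.

(** Beyond the fixed point r0 of r -> q r + B' the weight gains at least (r - q r - B') / 4, linear
    in r, and this exponential beats the polynomial factor. Enlarging B to B' >= max(R1, 1) secures
    the slope 1 / 4. Below r0 everything is bounded. *)
Lemma sub_contraction_decay (q B : R) : 0 <= q -> q < 1 -> 0 <= B -> exists2 K : R, 0 <= K &
  forall r : R, 0 <= r -> expR (phi (q * r + B)) * expR (- phi r) * (1 + r ^+ 2) ^+ 2 <= K.
Proof.
move=> q0 q1 B0.
pose B' := Num.max B (Num.max R1 1).
have : B' <= B' by [].
rewrite {1}/B' !ge_max => /andP[BB /andP[BR B1]].
have q1' : 0 < 1 - q by rewrite subr_gt0.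
pose r0 := B' / (1 - q).
have r00 : 0 <= r0 by rewrite divr_ge0// ?(ltW q1')//; lra.
have r0E : q * r0 + B' = r0 by rewrite /r0; field; rewrite gt_eqF.
pose k := (1 - q) / 4; have k0 : 0 < k by rewrite divr_gt0.
pose L := Num.max 1 (4 / k).
have : L <= L by [].
rewrite {1}/L ge_max => /andP[L1 Lk].
have L0 : 0 <= L by lra.
exists (expR (phi r0) * (1 + r0 ^+ 2) ^+ 2 + expR (B' / 4) * L ^+ 4).
  by rewrite addr_ge0// mulr_ge0 ?expR_ge0 ?sqr_ge0 ?exprn_ge0.
move=> r rge0.
have qrB : 0 <= q * r + B by rewrite addr_ge0// mulr_ge0.
have step : expR (phi (q * r + B)) <= expR (phi (q * r + B')).
  by rewrite ler_expR; apply: phi_mono => //; rewrite lerD2l.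
have sq0 : 0 <= (1 + r ^+ 2) ^+ 2 by rewrite sqr_ge0.
apply: (@le_trans _ _ (expR (phi (q * r + B') - phi r) * (1 + r ^+ 2) ^+ 2)).
  by rewrite expRD ler_wpM2r// ler_wpM2r ?expR_ge0.
have [rr0|r0r] := ltP r r0.
  rewrite -[leLHS]addr0; apply: lerD; last by rewrite mulr_ge0 ?expR_ge0// exprn_ge0.
  apply: ler_pM; rewrite ?expR_ge0//.
    rewrite ler_expR -r0E; apply: (@le_trans _ _ (phi (q * r + B'))).
      by have := phi_ge0 rge0; lra.
    apply: phi_mono; first by rewrite addr_ge0 ?mulr_ge0//; lra.
    by rewrite lerD2r ler_wpM2l// ltW.
  by rewrite lerXn2r ?nnegrE ?addr_ge0 ?sqr_ge0// lerD2l lerXn2r ?nnegrE// ltW.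
rewrite -[leLHS]add0r; apply: lerD; first by rewrite mulr_ge0 ?expR_ge0// sqr_ge0.
have qr : q * r + B' <= r.
  by move: r0r; rewrite /r0 ler_pdivrMr//; lra.
have inc : k * r - B' / 4 <= phi r - phi (q * r + B').
  have h1 : R1 <= q * r + B' by apply: le_trans BR _; rewrite lerDr mulr_ge0.
  apply: le_trans (phi_inc h1 qr).
  have h2 : 1 <= q * r + B' by apply: le_trans B1 _; rewrite lerDr mulr_ge0.
  rewrite /k (_ : _ - _ = 1 / 4 * (r - (q * r + B'))); last by field.
  by rewrite ler_wpM2r ?subr_ge0// ler_wpM2r.
apply: (@le_trans _ _ (expR (B' / 4) * (expR (- (k * r)) * (1 + r ^+ 2) ^+ 2))).
  by rewrite mulrA -expRD ler_wpM2r// ler_expR; lra.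
rewrite ler_wpM2l ?expR_ge0//.
have kr : 0 <= k * r by rewrite mulr_ge0// ltW.
have e4 : (1 + k * r / 4) ^+ 4 <= expR (k * r).
  have -> : k * r = 4%:R * (k * r / 4) by field.
  rewrite expRM_natl lerXn2r ?nnegrE ?expR_ge0//; last first.
    by have := expR_ge1Dx (k * r / 4); rewrite (_ : 4%:R * (k * r / 4) / 4 = k * r / 4)//; field.
  by rewrite addr_ge0// divr_ge0// mulr_ge0// divr_ge0.
have h4 : (1 + r ^+ 2) ^+ 2 <= (L * (1 + k * r / 4)) ^+ 4.
  apply: (@le_trans _ _ ((1 + r) ^+ 4)).
    rewrite (_ : (1 + r) ^+ 4 = ((1 + r) ^+ 2) ^+ 2); last by rewrite -exprM.
    rewrite lerXn2r ?nnegrE ?addr_ge0 ?sqr_ge0//; nra.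
  rewrite lerXn2r ?nnegrE ?addr_ge0 ?mulr_ge0//.
    by rewrite addr_ge0// divr_ge0.
  have : r <= L * (k * r / 4).
    move: Lk; rewrite ler_pdivrMr// => Lk; nra.
  lra.
rewrite expRN mulrC ler_pdivrMr ?expR_gt0//.
apply: le_trans h4 _; rewrite exprMn ler_wpM2l// exprn_ge0//.
Qed.

Lemma fock_norm_le_sup f (C : R) : entire f -> 0 <= C ->
  (forall z, normc (f z) * expR (- phi (normc z)) * (1 + normc z ^+ 2) ^+ 2 <= C) ->
  (fock_norm phi p f <= (C * (pi ^+ 2) `^ p^-1)%:E)%E.
Proof.
move=> fe C0 fC; rewrite (@fock_norm_le _ _ _ p1 _ _ (mulr_ge0 C0 (powR_ge0 _ _))).
rewrite powRM ?powR_ge0// -powRrM mulVf ?gt_eqF// powRr1 ?sqr_ge0//.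
exact: fock_integral_le_sup.
Qed.

Lemma contraction_not_isolated (a b : R[i]) : normc a < 1 ->
  ~ isolated_composition phi p (fun z => a * z + b).
Proof.
move=> a1 [c c0 hc].
have [C C0 hC] := fock_point_le p1 phi_cont phi_mono ltr01.
have a0 := normc_ge0 a; have b0 := normc_ge0 b.
(* The 3 is the shift 2e of [fock_point_le] with e = 1, plus 1 for the translation by t. *)
have [K K0 hK] := @sub_contraction_decay (normc a) (normc b + 3) a0 a1 ltac:(lra).
pose kap : R := (pi ^+ 2) `^ p^-1.
have kap0 : 0 <= kap by exact: powR_ge0.
(* 1 / 4 is the radius of the Lipschitz estimate for e = 1; the other bound makes the norm of the
   difference, at most C t K kap, smaller than c. *)
pose t := Num.min (1 / 4) (c / (2 * (C * K * kap + 1))).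
have CKk : 0 < C * K * kap + 1 by rewrite ltr_wpDl// !mulr_ge0// ltW.
have t0 : 0 < t by rewrite lt_min !divr_gt0// mulr_gt0.
have : t <= t by [].
rewrite {2}/t le_min => /andP[t4 tc].
pose psi1 z := (a * z + b) + t%:C.
have psi1e : entire psi1.
  by move=> z; apply: derivableD; [exact: entire_affine|exact: derivable_cst].
have image_le z (k : R) : k <= 1 -> normc (a * z + b) + k + 2 * 1 <= normc a * normc z + (normc b + 3).
  by move=> k1; have := le_normcD (a * z) b; rewrite Normc.normcM; lra.
have weight_le z (u k : R) : 0 <= u -> u <= normc a * normc z + (normc b + 3) -> 0 <= k -> 
    C * k * expR (phi u) * expR (- phi (normc z)) * (1 + normc z ^+ 2) ^+ 2 <= C * k * K.
  move=> u0 ule k0; rewrite -!mulrA ler_wpM2l ?(ltW C0)// ler_wpM2l//.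
  apply: le_trans (hK _ (normc_ge0 z)); rewrite -mulrA; apply: ler_wpM2r.
    by rewrite mulr_ge0 ?expR_ge0 ?sqr_ge0.
  by rewrite ler_expR; apply: phi_mono.
have bnd1 : bounded_composition phi p psi1.
  apply: (@bounded_composition_of_unit_ball _ (C * 1 * K * kap)) => //.
    by rewrite !mulr_ge0// ltW.
  move=> f fe f1; apply: fock_norm_le_sup.
  - exact: entire_comp.
  - by rewrite !mulr_ge0// ltW.
  move=> z; have [h _] := hC f (psi1 z) fe f1.
  have n0 : 0 <= normc (psi1 z) + 2 * 1 by rewrite addr_ge0 ?normc_ge0.
  apply: le_trans (weight_le z _ 1 n0 _ ler01).
    by rewrite mulr1 ler_wpM2r ?sqr_ge0// ler_wpM2r ?expR_ge0.
  have : normc (psi1 z) <= normc (a * z + b) + t.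
    by apply: le_trans (le_normcD _ _) _; rewrite normc_real gtr0_norm.
  have := image_le z t; lra.
have neq : psi1 <> (fun z => a * z + b).
  move=> /(congr1 (fun h => h 0)); rewrite /psi1 => /eqP; rewrite -subr_eq0 addrAC subrr add0r.
  by rewrite -normc_eq0 normc_real normr_eq0 gt_eqF.
have := hc psi1 bnd1 neq; apply/negP; rewrite -ltNge.
apply: (@le_lt_trans _ _ (C * t * K * kap)%:E).
  apply: ub_ereal_sup => _ [f [[fe fspace] f1] <-].
  have fi1 : (fock_integral phi p f <= 1)%E.
    by move: f1; rewrite (@fock_norm_le _ _ _ p1 f 1)// powR1.
  apply: fock_norm_le_sup.
  - move=> z; apply: derivableB.
      exact: (entire_comp fe (@entire_affine a b)).
    exact: (entire_comp fe psi1e).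
  - by rewrite !mulr_ge0// ltW.
  move=> z; have [_ h] := hC f (a * z + b) fe fi1.
  have n0 : 0 <= normc (a * z + b) + 2 * 1 by rewrite addr_ge0 ?normc_ge0.
  apply: le_trans (weight_le z _ t n0 _ (ltW t0)); last by have := image_le z 0 ler01; lra.
  rewrite ler_wpM2r ?sqr_ge0// ler_wpM2r ?expR_ge0//.
  have nt : normc (psi1 z - (a * z + b)) = t.
    by rewrite /psi1 addrAC subrr add0r normc_real gtr0_norm.
  by have := h (psi1 z); rewrite nt => /(_ t4); rewrite /op_sub/= normcBC.
rewrite lte_fin; move: tc; rewrite ler_pdivlMr ?mulr_gt0//.
have -> : C * t * K * kap = t * (C * K * kap) by ring.
have := mulr_ge0 (mulr_ge0 (ltW C0) K0) kap0; nra.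
Qed.

End Perturbation.

(** * Lower bounds for essential norms *)

Section CompactPerturbation.
Context {R : realType}.
Variables (phi : R -> R) (p : R).
Hypotheses (p1 : 1 <= p) (phi_cont : continuous (fun r : R => phi `|r|)).
Implicit Types (f g psi : R[i] -> R[i]) (z : R[i]).
Implicit Types (T K : (R[i] -> R[i]) -> (R[i] -> R[i])).
Local Notation mu := (@lebesgue_measure R).
Local Notation normc := (@Normc.normc R).

Let p0 : 0 < p. Proof. exact: lt_le_trans p1. Qed.

Lemma ereal_cvg0_le (u : nat -> \bar R) (x : R) : 0 < x -> u n @[n --> \oo] --> 0%E ->
  exists n0, forall n, (n0 <= n)%N -> (u n <= x%:E)%E.
Proof.
move=> x0 ucvg.
have : nbhs (0%E : \bar R) [set y | (y < x%:E)%E].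
  by apply: open_nbhs_nbhs; split; [exact: open_ereal_lt_ereal|rewrite /= lte_fin].
by move/ucvg => [n0 _ h]; exists n0 => n nn; apply: ltW; exact: h.
Qed.

Lemma integrable_fock_density g : fock_space phi p g ->
  (mu \x mu)%E.-integrable setT (fun w => (2 `^ p * fock_density phi p g w)%:E).
Proof.
move=> [ge gf]; apply/integrableP; split.
  apply/measurable_EFinP; apply: measurable_funM; first exact: measurable_cst.
  exact: measurable_fock_density.
under eq_integral => w _.
  rewrite abse_EFin ger0_norm ?mulr_ge0 ?powR_ge0 ?fock_density_ge0// EFinM.
  over.
rewrite ge0_integralZl//.
- by rewrite lte_mul_pinfty// lee_fin powR_ge0.
- by apply/measurable_EFinP; exact: measurable_fock_density.
- by move=> w _; rewrite lee_fin fock_density_ge0.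
Qed.

(* Dominated convergence for the positive part of |D_n|^p - 2^p |D_n - g|^p, which
   is at most 2^p |g|^p. *)
Lemma pointwise_null_separation (D : nat -> R[i] -> R[i]) g (k : R) :
  (forall n, entire (D n)) -> fock_space phi p g -> 0 < k ->
  (forall w, fock_density phi p (D n) w @[n --> \oo] --> (0 : R)) ->
  exists n0, forall n, (n0 <= n)%N ->
    (fock_integral phi p (D n) <=
      k%:E + (2 `^ p)%:E * fock_integral phi p (fun z => D n z - g z)%R)%E.
Proof.
move=> De gs k0 Dcvg; have [ge gf] := gs.
have dens0 f w : 0 <= fock_density phi p f w by exact: fock_density_ge0.
have Dge n : entire (fun z => D n z - g z).
  by move=> z; apply: derivableB; [exact: De|exact: ge].
have mD n := measurable_fock_density p phi_cont (De n).
have mg := measurable_fock_density p phi_cont ge.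
have mDg n := measurable_fock_density p phi_cont (Dge n).
pose F n w := Num.max 0 (fock_density phi p (D n) w -
   2 `^ p * fock_density phi p (fun z => D n z - g z) w).
have mF n : measurable_fun setT (F n).
  apply: measurable_maxr; first exact: measurable_cst.
  apply: measurable_funB; first exact: mD.
  by apply: measurable_funM; [exact: measurable_cst|exact: mDg].
have F0 n w : 0 <= F n w by rewrite le_max lexx.
have Fle n w : F n w <= fock_density phi p (D n) w.
  by rewrite ge_max dens0/= lerBlDr lerDl mulr_ge0// powR_ge0.
have Fg n w : F n w <= 2 `^ p * fock_density phi p g w.
  rewrite ge_max mulr_ge0 ?powR_ge0//= lerBlDl -mulrDr.
  apply: fock_densityD_le => // z.
  by have := le_normcD (D n z - g z) (g z); rewrite subrK.
have Fcvg : (\int[mu \x mu]_w (F n w)%:E)%E @[n --> \oo] --> 0%E.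
  have A w : (F n w)%:E @[n --> \oo] --> 0%E.
    apply: cvg_EFin; first by near=> n.
    apply: (@squeeze_cvgr _ _ _ _ (fun=> 0) (fun n => fock_density phi p (D n) w)) => //.
      by near=> n; rewrite /= F0 Fle.
    exact: cvg_cst.
  have B w n : (`|(F n w)%:E| <= (2 `^ p * fock_density phi p g w)%:E)%E.
    by rewrite gee0_abs ?lee_fin.
  have dc := @dominated_convergence _ _ R (mu \x mu)%E setT measurableT
    (fun n w => (F n w)%:E) (fun=> 0%E) (fun w => (2 `^ p * fock_density phi p g w)%:E)
    (fun n => (measurable_EFinP _ _).2 (mF n)) (measurable_cst _).
  case: dc => [|||_ _].
  - by apply: aeW => w _; exact: A.
  - exact: integrable_fock_density.
  - by apply: aeW => w n _; exact: B.
  by rewrite integral0.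
have [n0 hn0] := ereal_cvg0_le k0 Fcvg; exists n0 => n nn.
have mDE := (measurable_EFinP _ _).2 (mD n); have mFE := (measurable_EFinP _ _).2 (mF n).
have mDgE := (measurable_EFinP _ _).2 (mDg n).
have mP : measurable_fun setT (fun w => ((2 `^ p)%:E *
    (fock_density phi p (fun z => D n z - g z)%R w)%:E)%E).
  by apply: emeasurable_funM; [exact: measurable_cst|exact: mDgE].
apply: (@le_trans _ _ (\int[mu \x mu]_w ((F n w)%:E +
   (2 `^ p)%:E * (fock_density phi p (fun z => D n z - g z) w)%:E))%E).
  rewrite fock_integralE; apply: ge0_le_integral => //.
  - by move=> w _; rewrite lee_fin.
  - exact: emeasurable_funD.
  - by move=> w _; rewrite -EFinM -EFinD lee_fin -lerBlDr le_max lexx orbT.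
rewrite ge0_integralD//; last 2 first.
- by move=> w _; rewrite lee_fin.
- by move=> w _; rewrite -EFinM lee_fin mulr_ge0// powR_ge0.
rewrite ge0_integralZl//; last by move=> w _; rewrite lee_fin.
by rewrite -fock_integralE leeD2r// hn0.
Unshelve. all: by end_near. Qed.

Lemma compact_lower_bound T K (e : nat -> R[i] -> R[i]) (kap : R) :
  compact_operator phi p K -> 0 < kap ->
  (forall n, fock_space phi p (e n)) -> (forall n, fock_integral phi p (e n) <= 1)%E ->
  (forall n, entire (T (e n))) ->
  (forall w, fock_density phi p (T (e n)) w @[n --> \oo] --> (0 : R)) ->
  (forall n0, exists2 n, (n0 <= n)%N & (kap%:E <= fock_integral phi p (T (e n)))%E) ->
  (((kap / 4) `^ p^-1 / 4)%:E <= op_norm phi p (op_sub T K))%E.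
Proof.
move=> [[Kspace _] Kcpt] kap0 es e1 Te Tcvg Tlow.
have norm1 n : (fock_norm phi p (e n) <= 1%:E)%E.
  by rewrite (@fock_norm_le _ _ _ p1 _ _ ler01) powR1.
(* [sig] need not be monotone: sig n >= n is enough for the limits along sig (s k). *)
have /choice[sig sigP] : forall n0, exists n, (n0 <= n)%N /\ (kap%:E <= fock_integral phi p (T (e n)))%E.
  by move=> n0; have [n h1 h2] := Tlow n0; exists n.
have bdd : exists M : R, forall n, (fock_norm phi p (e (sig n)) <= M%:E)%E.
  by exists 1 => n; exact: norm1.
have [s sinc [g gs gcvg]] := Kcpt (fun n => e (sig n)) (fun n => es (sig n)) bdd.
set c := _ / 4; rewrite leNgt; apply/negP => Tc.
have k4 : 0 < kap / 4 by rewrite divr_gt0.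
have c0 : 0 < c by rewrite divr_gt0// powR_gt0.
(* Two uses of the 2^p inequality cost 4^p, which the divisor 4 in [c] repays. The total kap / 4 +
   kap / 2 stays below kap. *)
have cp : (2 `^ p * (2 `^ p * (c `^ p + c `^ p))) = kap / 2.
  have -> : c `^ p = kap / 4 * 4^-1 `^ p.
    rewrite /c [LHS]powRM ?powR_ge0 ?invr_ge0//; congr (_ * _).
    by rewrite -powRrM mulVf ?gt_eqF// powRr1// ltW.
  have E : 2 `^ p * 2 `^ p * 4^-1 `^ p = 1 :> R.
    by rewrite -!powRM ?mulr_ge0// (_ : 2 * 2 / 4 = 1) ?powR1//; lra.
  transitivity (kap / 2 * (2 `^ p * 2 `^ p * 4^-1 `^ p)); last by rewrite E mulr1.
  by field.
pose D k := T (e (sig (s k))).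
have sk k : (k <= s k)%N.
  elim: k => // k IH; apply: leq_ltn_trans IH _.
  by have := sinc k.+1 k; rewrite !leEnat ltnn leqNgt => /negbFE.
have Dcvg w : fock_density phi p (D k) w @[k --> \oo] --> (0 : R).
  apply/cvgrPdist_le => eps eps0.
  have := Tcvg w; move=> /cvgrPdist_le/(_ eps eps0)[n0 _ hn0].
  exists n0 => // k /= nk; apply: hn0 => /=.
  by apply: leq_trans (leq_trans nk (sk k)) _; case: (sigP (s k)).
have [n1 hn1] := pointwise_null_separation (fun k => Te (sig (s k))) gs k4 Dcvg.
have [n2 hn2] := ereal_cvg0_le c0 gcvg.
pose k := maxn n1 n2.
have h1 := hn1 k (leq_maxl _ _); have h2 := hn2 k (leq_maxr _ _).
rewrite (@fock_norm_le _ _ _ p1 _ _ (ltW c0)) in h2.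
have h3 : (fock_norm phi p (op_sub T K (e (sig (s k)))) <= c%:E)%E.
  apply/ltW; apply: le_lt_trans Tc; apply: ereal_sup_ubound.
  exists (e (sig (s k))); last by reflexivity.
  by split; [exact: es|exact: norm1].
rewrite (@fock_norm_le _ _ _ p1 _ _ (ltW c0)) in h3.
have Kes := Kspace _ (es (sig (s k))).
have h4 : (fock_integral phi p (fun z => D k z - g z)%R <=
    (2 `^ p)%:E * ((c `^ p)%:E + (c `^ p)%:E))%E.
  apply: le_trans (fock_integralD_le p1 phi_cont
    (f := op_sub T K (e (sig (s k)))) (g := K (e (sig (s k))) \- g) _ _ _ _) _.
  - by move=> z; apply: derivableB; [exact: Te|exact: Kes.1].
  - by move=> z; apply: derivableB; [exact: Kes.1|exact: gs.1].
  - by move=> z; apply: derivableB; [exact: Te|exact: gs.1].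
  - move=> z; rewrite /op_sub /D /=.
    by apply: le_trans (le_normcD _ _); rewrite addrA subrK.
  apply: lee_wpmul2l; first by rewrite lee_fin powR_ge0.
  exact: (leeD h3 h2).
have [_ h5] := sigP (s k).
have : (kap%:E <= (kap / 4)%:E + (2 `^ p)%:E * ((2 `^ p)%:E * ((c `^ p)%:E + (c `^ p)%:E)))%E.
  apply: le_trans h5 (le_trans h1 _); apply: leeD; first exact: lexx.
  by apply: lee_wpmul2l; [rewrite lee_fin powR_ge0|exact: h4].
by rewrite -(EFinD (c `^ p) (c `^ p)) -!EFinM cp -EFinD lee_fin; lra.
Qed.

End CompactPerturbation.

Section UnimodularPowers.
Context {R : realType}.
Local Notation normc := (@Normc.normc R).

(* While |a^n - b^n| <= 1/2, doubling n multiplies this distance by at least 3/2. *)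
Lemma unimodular_powers_apart (a b : R[i]) : normc a = 1 -> normc b = 1 -> a != b ->
  forall n0, exists2 n, (n0 <= n)%N & 1 / 2 <= normc (a ^+ n - b ^+ n).
Proof.
move=> a1 b1 ab n0; apply: contrapT => none.
have small n : (n0 <= n)%N -> normc (a ^+ n - b ^+ n) < 1 / 2.
  by move=> nn; rewrite ltNge; apply/negP => h; apply: none; exists n.
have dbl n : (n0 <= n)%N -> 3 / 2 * normc (a ^+ n - b ^+ n) <= normc (a ^+ (n * 2) - b ^+ (n * 2)).
  move=> nn; rewrite !exprM subr_sqr Normc.normcM mulrC; apply: ler_wpM2l; first exact: normc_ge0.
  have -> : a ^+ n + b ^+ n = 2 * a ^+ n - (a ^+ n - b ^+ n) by ring.
  have := normcB_ge (2 * a ^+ n) (a ^+ n - b ^+ n).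
  rewrite Normc.normcM normcX a1 expr1n mulr1.
  have -> : normc 2 = 2.
    by rewrite (_ : 2 = (2 : R)%:C) ?normc_real ?ger0_norm// rmorphD.
  have := small n nn; lra.
have geo k : forall n, (n0 <= n)%N -> normc (a ^+ n - b ^+ n) <= (2 / 3) ^+ k.
  elim: k => [|k IH] n nn; first by rewrite expr0; have := small n nn; lra.
  have h := dbl n nn; have nn2 : (n0 <= n * 2)%N by rewrite (leq_trans nn)// leq_pmulr.
  have := IH _ nn2; rewrite exprS; lra.
have zero n : (n0 <= n)%N -> a ^+ n = b ^+ n.
  move=> nn; apply/eqP; rewrite -subr_eq0 -normc_eq0 eq_le normc_ge0 andbT.
  apply/ler_addgt0Pr => e e0; rewrite add0r.
  have c : (2 / 3 : R) ^+ k @[k --> \oo] --> (0 : R).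
    by apply: cvg_expr; rewrite ger0_norm; lra.
  move: c => /cvgrPdist_le/(_ e e0)[k _ /(_ k (leqnn k))].
  rewrite /= sub0r normrN ger0_norm ?exprn_ge0 ?divr_ge0//.
  by apply: le_trans; exact: geo.
have h1 := zero n0 (leqnn _); have := zero n0.+1 (leqnSn _).
rewrite !exprS h1 => /mulIf E; move/eqP: ab; apply; apply: E.
by rewrite -normc_eq0 normcX b1 expr1n oner_eq0.
Qed.

End UnimodularPowers.

(** * Normalized monomials and the rigidity of rotations *)

Section NormalizedMonomials.
Context {R : realType}.
Variables (phi : R -> R) (p : R).
Hypotheses (p1 : 1 <= p) (phi_cont : continuous (fun r : R => phi `|r|)).
Hypothesis phi_mono : forall r s : R, 0 <= r -> r <= s -> phi r <= phi s.
Hypothesis monomial_space : forall n, fock_space phi p (@monomial R n).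
Implicit Types (f g psi : R[i] -> R[i]) (z : R[i]).
Local Notation mu := (@lebesgue_measure R).
Local Notation normc := (@Normc.normc R).

Let p0 : 0 < p. Proof. exact: lt_le_trans p1. Qed.

Lemma powR_exprn (n : nat) (x : R) : 0 <= x -> (x ^+ n) `^ p = (x `^ p) ^+ n.
Proof.
by move=> x0; rewrite -powR_mulrn// -powRrM mulrC powRrM powR_mulrn// powR_ge0.
Qed.

(** Only the unit square [r, r + 1] x [0, 1] is kept; there r <= |w| <= r + 2, so [m] does not
    depend on n. *)
Lemma monomial_mass (r : R) : 0 <= r -> exists2 m : R, 0 < m &
  forall n, (((r ^+ n) `^ p * m)%:E <= fock_integral phi p (monomial n))%E.
Proof.
move=> r0; exists (expR (- (p * phi (r + 2)))); first exact: expR_gt0.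
move=> n; set k := _ * _.
have k0 : 0 <= k by rewrite mulr_ge0 ?powR_ge0 ?expR_ge0.
pose S : set (R * R) := `[r, r + 1] `*` `[0, 1].
have mS : measurable S by apply: measurableX; exact: measurable_itv.
have mD := measurable_fock_density p phi_cont (@entire_monomial R n).
have mDE := (measurable_EFinP _ _).2 mD.
rewrite fock_integralE.
apply: (@le_trans _ _ (\int[mu \x mu]_(w in S) (fock_density phi p (monomial n) w)%:E)%E); last first.
  apply: ge0_subset_integral => //.
  by move=> w _; rewrite lee_fin fock_density_ge0.
apply: (@le_trans _ _ (\int[mu \x mu]_(w in S) k%:E)%E).
  rewrite integral_cst// [X in (_ <= _ * X)%E](_ : _ = 1%E) ?mule1//.
  transitivity (mu `[r, (r + 1)%R] * mu `[0%R, 1%R])%E.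
    by apply: product_measure1E; exact: measurable_itv.
  rewrite !lebesgue_measure_itv/= !lte_fin ltrDl ltr01 -!EFinD -EFinM.
  by rewrite subr0 mulr1 addrAC subrr add0r.
apply: ge0_le_integral => //.
- exact: measurable_funTS.
- move=> [x y] [/=]; rewrite !in_itv/= => /andP[x1 x2] /andP[y1 y2].
  rewrite lee_fin /fock_density/= /monomial normcX.
  have xz : x <= normc (x +i* y).
    by have := normRe_le (x +i* y); rewrite /= => /(le_trans (ler_norm _)).
  have zr : normc (x +i* y) <= r + 2.
    apply: le_trans (normc_le_ReIm _) _; rewrite /= !ger0_norm; lra.
  rewrite /k; apply: ler_pM; rewrite ?powR_ge0 ?expR_ge0//.
    have rz : r <= normc (x +i* y) by exact: le_trans xz.
    apply: ge0_ler_powR; rewrite ?nnegrE ?exprn_ge0 ?normc_ge0 ?(ltW p0)//.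
    by rewrite lerXn2r ?nnegrE ?normc_ge0.
  rewrite ler_expR lerN2 ler_wpM2l ?(ltW p0)// /radial_ext.
  by apply: phi_mono => //; exact: normc_ge0.
Qed.

Definition monomial_mass_of n : R := fine (fock_integral phi p (monomial n)).

Lemma monomial_massE n : fock_integral phi p (monomial n) = (monomial_mass_of n)%:E.
Proof.
rewrite /monomial_mass_of fineK// ge0_fin_numE; first by case: (monomial_space n).
exact: fock_integral_ge0.
Qed.

Lemma monomial_mass_gt0 n : 0 < monomial_mass_of n.
Proof.
have [m m0 hm] := monomial_mass ler01.
have := hm n; rewrite monomial_massE expr1n powR1 mul1r lee_fin.
exact: lt_le_trans.
Qed.

(** The reciprocal of the norm of z^n. *)
Definition monomial_scale n : R := monomial_mass_of n `^ (- p^-1).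

Definition unit_monomial n : R[i] -> R[i] := fun z => (monomial_scale n)%:C * monomial n z.

Lemma monomial_scale_ge0 n : 0 <= monomial_scale n.
Proof. exact: powR_ge0. Qed.

Lemma monomial_scaleXp n : monomial_scale n `^ p = (monomial_mass_of n)^-1.
Proof.
have m0 := monomial_mass_gt0 n.
by rewrite /monomial_scale -powRrM mulNr mulVf ?gt_eqF// powR_inv1// ltW.
Qed.

Lemma entire_unit_monomial n : entire (unit_monomial n).
Proof. exact: (@entireZ _ _ _ (@entire_monomial R n)). Qed.

Lemma fock_integral_unit_monomial n : fock_integral phi p (unit_monomial n) = 1%E.
Proof.
rewrite /unit_monomial (@fock_integralZ _ _ _ phi_cont _ _ (@entire_monomial R n)).
rewrite normc_real ger0_norm ?monomial_scale_ge0// monomial_scaleXp monomial_massE -EFinM.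
by rewrite mulVf// gt_eqF// monomial_mass_gt0.
Qed.

Lemma fock_space_unit_monomial n : fock_space phi p (unit_monomial n).
Proof. exact: (@fock_spaceZ _ _ _ phi_cont _ _ (monomial_space n)). Qed.

(* Compare with the mass of z^n on a unit square at distance X + 1. *)
Lemma monomial_scale_geometric (X : R) : 0 <= X ->
  (monomial_scale n * X ^+ n) `^ p @[n --> \oo] --> (0 : R).
Proof.
move=> X0; have X1 : 0 < X + 1 by rewrite ltr_wpDl.
have [m m0 hm] := monomial_mass (ltW X1).
pose q := (X / (X + 1)) `^ p.
have q0 : 0 <= q by exact: powR_ge0.
have Xq : 0 <= X / (X + 1) by rewrite divr_ge0// ltW.
have q1 : q < 1.
  rewrite [ltRHS](_ : 1 = 1 `^ p); last by rewrite powR1.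
  apply: gt0_ltr_powR; rewrite ?nnegrE//.
  by rewrite ltr_pdivrMr// mul1r ltrDl.
have bound n : (monomial_scale n * X ^+ n) `^ p <= q ^+ n / m.
  rewrite powRM ?monomial_scale_ge0 ?exprn_ge0// monomial_scaleXp mulrC.
  rewrite ler_pdivrMr ?monomial_mass_gt0//.
  have := hm n; rewrite monomial_massE lee_fin => hn.
  apply: (@le_trans _ _ (q ^+ n / m * (((X + 1) ^+ n) `^ p * m))); last first.
    by rewrite ler_wpM2l// divr_ge0 ?exprn_ge0 ?(ltW m0).
  rewrite mulrACA mulVf ?gt_eqF// mulr1 !powR_exprn ?(ltW X1)// -exprMn /q -powRM ?(ltW X1)//.
  by rewrite divfK// gt_eqF.
apply: (@squeeze_cvgr _ _ _ _ (fun=> 0) (fun n => q ^+ n / m)).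
- by near=> n; rewrite powR_ge0 bound.
- exact: cvg_cst.
- rewrite -(mul0r m^-1); apply: cvgM; last exact: cvg_cst.
  by apply: cvg_expr; rewrite ger0_norm.
Unshelve. all: by end_near. Qed.

(** At a fixed point both images are at most [monomial_scale n] times X^n, with X the larger of |z|
    and |psi1 z|. *)
Lemma unit_monomial_difference_null (a : R[i]) psi1 : normc a = 1 -> forall w,
  fock_density phi p (op_sub (composition_operator (fun z => a * z)) (composition_operator psi1)
    (unit_monomial n)) w @[n --> \oo] --> (0 : R).
Proof.
move=> a1 [x y]; set z := x +i* y.
pose X := Num.max (normc z) (normc (psi1 z)).
have X0 : 0 <= X by rewrite le_max normc_ge0.
pose E := expR (- (p * radial_ext phi z)).
apply: (@squeeze_cvgr _ _ _ _ (fun=> 0)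
  (fun n => 2 `^ p * (monomial_scale n * X ^+ n) `^ p * E)); last 2 first.
- exact: cvg_cst.
- rewrite -(mul0r E) -(mulr0 (2 `^ p)); apply: cvgM; last exact: cvg_cst.
  by apply: cvgM; [exact: cvg_cst|exact: monomial_scale_geometric].
near=> n; rewrite fock_density_ge0/= /fock_density ler_wpM2r ?expR_ge0//=.
have s0 := monomial_scale_ge0 n.
have sX : 0 <= monomial_scale n * X ^+ n by rewrite mulr_ge0// exprn_ge0.
rewrite -powRM//; apply: ge0_ler_powR; [exact: ltW|exact: normc_ge0|exact: mulr_ge0|].
rewrite -/z /op_sub /composition_operator/= /unit_monomial.
apply: le_trans (le_normcD _ _) _; rewrite normcN !Normc.normcM !normcX normc_real ger0_norm//.
rewrite Normc.normcM a1 mul1r mulrDl mul1r; apply: lerD; rewrite ler_wpM2l//.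
  by rewrite lerXn2r ?nnegrE ?normc_ge0// le_max lexx.
by rewrite lerXn2r ?nnegrE ?normc_ge0// le_max lexx orbT.
Unshelve. all: by end_near. Qed.

(** For |z| > r0 one has |a1 z + b1| <= q |z| with q < 1, and for |z| <= r0 it is at most X. The
    first part contributes q^n times a unit vector, the second the constant X^n divided by the norm
    of z^n. *)
Lemma contraction_image_null (a1 b1 : R[i]) (k : R) : normc a1 < 1 -> 0 < k ->
  exists n0, forall n, (n0 <= n)%N ->
    (fock_integral phi p (composition_operator (fun z => a1 * z + b1)%R (unit_monomial n)) <= k%:E)%E.
Proof.
move=> ha k0; have na := normc_ge0 a1; have nb := normc_ge0 b1.
pose q := (1 + normc a1) / 2.
have q0 : 0 <= q by rewrite /q; lra.
have q1 : q < 1 by rewrite /q; lra.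
pose r0 := normc b1 / (q - normc a1).
have qa : 0 < q - normc a1 by rewrite /q; lra.
pose X := normc a1 * r0 + normc b1.
have r00 : 0 <= r0 by rewrite divr_ge0// ltW.
have X0 : 0 <= X by rewrite addr_ge0// mulr_ge0.
have le_sum z n : normc (a1 * z + b1) ^+ n <= q ^+ n * normc z ^+ n + X ^+ n.
  have h := le_normcD (a1 * z) b1; rewrite Normc.normcM in h.
  have [zr|rz] := leP (normc z) r0.
    rewrite -[leLHS]add0r; apply: lerD; first by rewrite mulr_ge0 ?exprn_ge0 ?normc_ge0.
    rewrite lerXn2r ?nnegrE ?normc_ge0//; apply: le_trans h _.
    by rewrite lerD2r ler_wpM2l.
  rewrite -[leLHS]addr0; apply: lerD; last by rewrite exprn_ge0.
  have qz : 0 <= q * normc z := mulr_ge0 q0 (normc_ge0 z).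
  rewrite -exprMn lerXn2r ?nnegrE ?qz ?normc_ge0//; apply: le_trans h _.
  by move: rz; rewrite /r0 ltr_pdivrMr// => rz; lra.
pose c0 := monomial_mass_of 0.
have lim : 2 `^ p * ((q `^ p) ^+ n + (monomial_scale n * X ^+ n) `^ p * c0) @[n --> \oo] --> (0 : R).
  rewrite -(mulr0 (2 `^ p)); apply: cvgM; first exact: cvg_cst.
  rewrite -[0 in X in _ --> X](addr0 0); apply: cvgD.
    apply: cvg_expr; rewrite ger0_norm ?powR_ge0//.
    rewrite [ltRHS](_ : 1 = 1 `^ p); last by rewrite powR1.
    by apply: gt0_ltr_powR; rewrite ?nnegrE.
  rewrite -(mul0r c0); apply: cvgM; last exact: cvg_cst.
  exact: monomial_scale_geometric.
move: lim => /cvgrPdist_le/(_ k k0)[n0 _ hn0]; exists n0 => n nn.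
have := hn0 n nn; rewrite /= sub0r normrN => /(le_trans (ler_norm _)) hk.
have s0 := monomial_scale_ge0 n.
apply: (@le_trans _ _ ((2 `^ p)%:E * (fock_integral phi p (fun z => (q ^+ n)%:C * unit_monomial n z)%R +
   fock_integral phi p (fun z => (monomial_scale n * X ^+ n)%:C * monomial 0 z)%R))%E).
  apply: (fock_integralD_le p1 phi_cont).
  - exact: (@entireZ _ _ _ (@entire_unit_monomial n)).
  - exact: (@entireZ _ _ _ (@entire_monomial R 0)).
  - exact: (entire_comp (@entire_unit_monomial n) (@entire_affine R a1 b1)).
  move=> z; rewrite /composition_operator /comp /unit_monomial /monomial expr0 mulr1.
  rewrite !Normc.normcM !normc_real normcX (ger0_norm s0) (ger0_norm (exprn_ge0 n q0)).
  rewrite (ger0_norm (mulr_ge0 s0 (exprn_ge0 n X0))) normcX mulrCA -mulrDr.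
  by rewrite ler_wpM2l.
rewrite (@fock_integralZ _ _ _ phi_cont _ _ (@entire_unit_monomial n)).
rewrite (@fock_integralZ _ _ _ phi_cont _ _ (@entire_monomial R 0)).
rewrite fock_integral_unit_monomial monomial_massE mule1 !normc_real.
rewrite (ger0_norm (exprn_ge0 n q0)) (ger0_norm (mulr_ge0 s0 (exprn_ge0 n X0))).
rewrite (powR_exprn n q0) -(EFinM _ (monomial_mass_of 0)) -(EFinD ((q `^ p) ^+ n)).
by rewrite -EFinM lee_fin.
Qed.

(** If |a1| = 1, both operators multiply the unit monomials by scalars, a^n and a1^n, which differ
    by 1/2 infinitely often. If |a1| < 1, one image keeps norm 1 while the other tends to 0. *)
Lemma rotation_separation (a a1 b1 : R[i]) : normc a = 1 -> normc a1 <= 1 ->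
  (normc a1 = 1 -> b1 = 0) -> (fun z => a1 * z + b1) <> (fun z => a * z) ->
  forall n0, exists2 n, (n0 <= n)%N &
    (((1 / 2) `^ p / 2)%:E <= fock_integral phi p (op_sub (composition_operator (fun z => a * z)%R)
       (composition_operator (fun z => a1 * z + b1)%R) (unit_monomial n)))%E.
Proof.
move=> ha ha1 hb1 neq n0.
have h0 : 0 < (1 / 2 : R) `^ p by rewrite powR_gt0.
(* The value with 2^p (k + k) = 1: two integrals of size k cannot add up to a unit vector. It also
   lies below (1/2)^p, the bound of the first case. *)
set k := (1 / 2) `^ p / 2; have k0 : 0 < k by rewrite divr_gt0.
have [a1E|a1ne] := eqVneq (normc a1) 1.
  have b10 := hb1 a1E.
  have aa1 : a != a1.
    by apply/eqP => E; apply: neq; apply/funext => z; rewrite b10 addr0 E.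
  have [n nn hn] := unimodular_powers_apart ha a1E aa1 n0; exists n => //.
  have -> : op_sub (composition_operator (fun z => a * z)) (composition_operator (fun z => a1 * z + b1))
     (unit_monomial n) = (fun z => (a ^+ n - a1 ^+ n) * unit_monomial n z).
    apply/funext => z; rewrite /op_sub /composition_operator/= /unit_monomial /monomial b10 addr0.
    by rewrite !exprMn; ring.
  rewrite (@fock_integralZ _ _ _ phi_cont _ _ (@entire_unit_monomial n)) fock_integral_unit_monomial mule1 lee_fin.
  apply: (@le_trans _ _ ((1 / 2) `^ p)); first by rewrite /k; lra.
  by apply: ge0_ler_powR; rewrite ?nnegrE ?normc_ge0 ?(ltW p0)//; lra.
have a1lt : normc a1 < 1 by rewrite lt_neqAle a1ne.
have [n1 hn1] := contraction_image_null b1 a1lt k0.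
pose n := maxn n0 n1; exists n; first exact: leq_maxl.
have hn := hn1 n (leq_maxr _ _).
set D := op_sub _ _ _; rewrite leNgt; apply/negP => hD.
have := fock_integralD_le p1 phi_cont (f := D)
  (g := composition_operator (fun z => a1 * z + b1) (unit_monomial n))
  (h := fun z => a ^+ n * unit_monomial n z).
have comp1 : entire (composition_operator (fun z => a1 * z + b1) (unit_monomial n)).
  exact: (entire_comp (@entire_unit_monomial n) (@entire_affine R a1 b1)).
have rotE : composition_operator (fun z => a * z) (unit_monomial n) = (fun z => a ^+ n * unit_monomial n z).
  by apply/funext => z; rewrite /composition_operator/= /unit_monomial /monomial exprMn; ring.
have rote : entire (fun z => a ^+ n * unit_monomial n z).
  exact: (@entireZ _ _ _ (@entire_unit_monomial n)).
have De : entire D.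
  by move=> z; rewrite /D /op_sub rotE; apply: derivableB; [exact: rote|exact: comp1].
move=> /(_ De comp1 rote) H.
have /H : forall z, normc (a ^+ n * unit_monomial n z) <=
    normc (D z) + normc (composition_operator (fun z => a1 * z + b1) (unit_monomial n) z).
  by move=> z; apply: le_trans (le_normcD _ _); rewrite /D /op_sub rotE /= subrK.
rewrite (@fock_integralZ _ _ _ phi_cont _ _ (@entire_unit_monomial n)) fock_integral_unit_monomial mule1.
rewrite normcX ha expr1n powR1; apply/negP; rewrite -ltNge.
have -> : (1%:E = (2 `^ p)%:E * (k%:E + k%:E) :> \bar R)%E.
  rewrite -EFinD -EFinM; congr (_%:E); rewrite /k.
  have E : 2 `^ p * (1 / 2) `^ p = 1 :> R by rewrite -powRM// (_ : 2 * (1 / 2) = 1) ?powR1//; lra.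
  by transitivity (2 `^ p * (1 / 2) `^ p : R); [rewrite E|field].
have p2 : 0 < (2 : R) `^ p by rewrite powR_gt0.
rewrite lte_pmul2l//; apply: lte_leD; [|exact: hD|exact: hn].
by rewrite ge0_fin_numE ?fock_integral_ge0// (le_lt_trans hn)// ltry.
Qed.

Lemma rotation_essentially_isolated (a : R[i]) : normc a = 1 ->
  (forall psi1, bounded_composition phi p psi1 -> exists a1 b1 : R[i],
     [/\ psi1 = (fun z => a1 * z + b1), normc a1 <= 1 & normc a1 = 1 -> b1 = 0]) ->
  essentially_isolated_composition phi p (fun z => a * z).
Proof.
move=> ha affine; pose k : R := (1 / 2) `^ p / 2.
have k0 : 0 < k by rewrite divr_gt0// powR_gt0.
(* The constant of [compact_lower_bound] for kap = k; it depends on p alone, hence is uniform in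
   [psi1]. *)
exists ((k / 4) `^ p^-1 / 4); first by rewrite divr_gt0// powR_gt0// divr_gt0.
move=> psi1 /affine[a1 [b1 [-> ha1 hb1]]] neq.
apply: le_ereal_inf_tmp => _ [K Kcpt <-].
apply: (compact_lower_bound p1 phi_cont (e := unit_monomial) Kcpt k0).
- exact: fock_space_unit_monomial.
- by move=> n; rewrite fock_integral_unit_monomial.
- move=> n z; rewrite /op_sub /composition_operator; apply: derivableB.
    apply: (entire_comp (@entire_unit_monomial n) (g := fun z => a * z)).
    exact: (@entireZ _ _ _ (@entire_id R)).
  exact: (entire_comp (@entire_unit_monomial n) (@entire_affine R a1 b1)).
- exact: unit_monomial_difference_null.
- exact: rotation_separation.
Qed.

End NormalizedMonomials.

Section EssentialNorm.
Context {R : realType}.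
Variables (phi : R -> R) (p : R).
Hypothesis p1 : 1 <= p.

Let p0 : 0 < p. Proof. exact: lt_le_trans p1. Qed.

Lemma compact_operator0 : compact_operator phi p (fun _ _ => 0).
Proof.
have int0 : fock_integral phi p (fun=> 0) = 0%E.
  rewrite fock_integralE; under eq_integral => w _.
    rewrite /fock_density Normc.normc0 powR0 ?gt_eqF// mul0r.
    over.
  exact: integral0.
have space0 : fock_space phi p (fun=> 0).
  by split; [move=> z; exact: derivable_cst|rewrite int0 ltry].
split.
  split; first by [].
  by move=> a f g _ _; apply/funext => z; rewrite mulr0 addr0.
move=> f_ _ _; exists id; first by [].
exists (fun=> 0); first by [].
have -> : (fun n : nat => fock_norm phi p ((fun=> 0) \- (fun=> 0 : R[i]))) = (fun=> 0%E).
  apply/funext => n; rewrite /fock_norm [X in fock_integral _ _ X](_ : _ = (fun=> 0)).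
    by rewrite int0 poweR0r// invr_eq0 gt_eqF.
  by apply/funext => z /=; rewrite subr0.
exact: cvg_cst.
Qed.

(** The zero operator competes in the infimum; thus a constant of essential isolation is also one of
    isolation. *)
Lemma ess_norm_le_op_norm T : (ess_norm phi p T <= op_norm phi p T)%E.
Proof.
apply: ge_ereal_inf; exists (op_norm phi p (op_sub T (fun _ _ => 0))).
  by exists (fun _ _ => 0); first exact: compact_operator0.
rewrite le_eqVlt; apply/orP; left; apply/eqP; congr (op_norm phi p _); apply/funext => f; apply/funext => z.
by rewrite /op_sub/= subr0.
Qed.

End EssentialNorm.

Theorem theorem2p7 (R : realType) (phi : R -> R) (p : R)
    (hphi : admissible_weight phi) (hp : (1 <= p)%R)
    (psi : R[i]%C -> R[i]%C) (hpsi : bounded_composition phi p psi) :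
  essentially_isolated_composition phi p psi <-> isolated_composition phi p psi.
Proof.
split.
  move=> [c c0 hc]; exists c => // psi1 h1 neq.
  exact: le_trans (hc psi1 h1 neq) (ess_norm_le_op_norm phi hp _).
have phi0 : forall r : R, 0 <= r -> 0 <= phi r by case: hphi.
have [cphi mphi [N [tangent [R1 R10 [quad inc]]]]] := admissible_weight_facts hphi.
have affine := bounded_composition_affine hp phi0 cphi mphi tangent quad inc.
move=> iso; have [a [b [psiE a1 ab]]] := affine psi hpsi.
have [na|na] := eqVneq (Normc.normc a) 1; last first.
  exfalso; apply: (contraction_not_isolated hp phi0 cphi mphi inc (a := a) (b := b)).
    by rewrite lt_neqAle na.
  by rewrite -psiE.
have -> : psi = (fun z => a * z) by apply/funext => z; rewrite psiE ab// addr0.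
apply: rotation_essentially_isolated => //.
exact: fock_space_monomial hp phi0 cphi tangent quad.
Qed.
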